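(* There exists a family of weights $(u_1,u_2,v,w_1,w_2)_\theta$ parametrized by $\theta\in[\frac{\pi}{3},\frac{2\pi}{3}]$ such that, for every such $\theta$ and for these weights, the limit $\lim_{n\to\infty}\sqrt[n]{\tilde{c}_n}$ exists and is equal to $\frac{1}{u_1}$, where $\tilde c_n=\frac{1}{u_1^n}\sum_{|\gamma|=n}\omega(\gamma)$ (sum over self-avoiding walks $\gamma$ on $\Lambda$ starting at $0$ with length $|\gamma|=n$). Furthermore, this holds for the following explicit weights: $$u_1=\frac{\sin(\frac{5\pi}{4})\sin(\frac{5\pi}{8}+\frac{3\theta}{8})}{\sin(\frac{5\pi}{4}+\frac{3\theta}{8})\sin(\frac{5\pi}{8}-\frac{3\theta}{8})},\qquad u_2=\frac{\sin(\frac{5\pi}{4})\sin(\frac{3\theta}{8})}{\sin(\frac{5\pi}{4}+\frac{3\theta}{8})\sin(\frac{5\pi}{8}-\frac{3\theta}{8})},$$ $$v=\frac{\sin(\frac{5\pi}{8}+\frac{3\theta}{8})\sin(-\frac{3\theta}{8})}{\sin(\frac{5\pi}{4}+\frac{3\theta}{8})\sin(\frac{5\pi}{8}-\frac{3\theta}{8})},$$ $$w_1=\frac{\sin(\frac{5\pi}{8}+\frac{3\theta}{8})\sin(\frac{5\pi}{4}-\frac{3\theta}{8})}{\sin(\frac{5\pi}{4}+\frac{3\theta}{8})\sin(\frac{5\pi}{8}-\frac{3\theta}{8})},\qquad w_2=\frac{\sin(\frac{15\pi}{8}+\frac{3\theta}{8})\sin(-\frac{3\theta}{8})}{\sin(\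frac{5\pi}{4}+\frac{3\theta}{8})\sin(\frac{5\pi}{8}-\frac{3\theta}{8})}.$$
   Context: Fix $\theta\in[\frac{\pi}{3},\frac{2\pi}{3}]$. $\Lambda$ is the skewed $\mathbb{Z}^2$ lattice in the plane: all edges have length $1$ and every face (plaquet) is a rhombus with angles $\theta$ and $\pi-\theta$ (all rhombi are translates of one another). A self-avoiding walk on $\Lambda$ is a (directed) non-self-intersecting curve starting and ending at midpoints of edges, crossing edges only at their midpoints and at right angles, visiting each edge midpoint at most once, and whose intersection with each rhombus is one of the following: nothing; one straight line connecting the midpoints of two opposite sides; one arc connecting the midpoints of two adjacent sides (i.e. surrounding their common vertex); or two disjoint arcs surrounding two opposite vertices. In particular a walk may visit the same rhombus twice. An arc surrounding a vertex at which the rhombus has angle $\theta$ (resp. $\pi-\theta$) is called an arc of angle $\theta$ (resp. $\pi-\theta$). The empty walk (a single midpoint) is allowed. Given numbers $u_1,u_2,v,w_1,w_2$, the weight $\omega(r)$ of a rhombus $r$ is: $1$ if it is empty; $u_1$ if it contains exactly one arc, of angle $\theta$; $u_2$ if it contains exactly one arc, of angle $\pi-\theta$; $v$ if it contains a straight line; $w_1$ if it contains two arcs of angle $\theta$; $w_2$ if it contains two arcs of angle $\pi-\theta$. The weight of a walk is $\omega(\gamma)=\prod_{r}\omega(r)$, the product over all rhombi $r$ of $\Lambda$. One edge midpoint of $\Lambda$ is fixed and denoted $0$. The length $|\gamma|$ is the number of arcs in $\gamma$, where a straight passing of a rhombus is counted as one arc (and a rhombus with two arcs contributes $2$). *)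

(* Defs.v *)
From HB Require Import structures.
From mathcomp Require Import all_boot all_order all_algebra.
From mathcomp Require Import all_classical all_reals all_analysis.

Set Implicit Arguments.
Unset Strict Implicit.
Unset Printing Implicit Defensive.

Import Order.TTheory GRing.Theory Num.Theory numFieldNormedType.Exports.

Local Open Scope classical_set_scope.
Local Open Scope ring_scope.

(* The skewed lattice has vertices x + y e^(i theta) for integers x, y; only  *)
(* the values of the angles depend on theta, so the lattice is given by its   *)
(* coordinates.  The midpoint (false, x, y) is that of the edge from (x, y)   *)
(* to (x + 1, y); (true, x, y) is that of the edge from (x, y) to (x, y + 1). *)
Definition midpoint : Type := (bool * int * int)%type.

(* (x, y) is the rhombus with corners (x, y), (x+1, y), (x, y+1), (x+1, y+1). *)
Definition rhombus : Type := (int * int)%type.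

(* (false, b) is the side parallel to the vector 1, at height y + b;          *)
(* (true, b) is the side parallel to e^(i theta), at abscissa x + b.          *)
Definition side : Type := (bool * bool)%type.

Definition side_midpoint (r : rhombus) (s : side) : midpoint :=
  if s.1 then (true, r.1 + (s.2 : nat)%:Z, r.2)
  else (false, r.1, r.2 + (s.2 : nat)%:Z).

(* (a, b) is the corner (x + a, y + b). *)
Definition corner : Type := (bool * bool)%type.

(* The angle is theta at the corners (x, y) and (x + 1, y + 1), and           *)
(* pi - theta at the other two.                                               *)
Definition theta_corner (c : corner) : bool := c.1 == c.2.

Definition opposite (c : corner) : corner := (~~ c.1, ~~ c.2).

(* One directed passage through a rhombus: (rhombus, (entry, exit)). *)
Definition passage : Type := (rhombus * (side * side))%type.

Definition arc_source (a : passage) : midpoint := side_midpoint a.1 a.2.1.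
Definition arc_target (a : passage) : midpoint := side_midpoint a.1 a.2.2.

(* The corner surrounded by a passage between two adjacent sides; None for a  *)
(* passage between two sides that are not adjacent.                           *)
Definition arc_corner (a : passage) : option corner :=
  match a.2 with
  | ((false, b), (true, c)) => Some (c, b)
  | ((true, c), (false, b)) => Some (c, b)
  | _ => None
  end.

Definition arcs_in (g : seq passage) (r : rhombus) : seq passage :=
  [seq a <- g | a.1 == r].

Definition admissible (l : seq passage) : bool :=
  match l with
  | [::] => true
  | [:: a] => a.2.1 != a.2.2
  | [:: a; b] =>
      match arc_corner a, arc_corner b with
      | Some c, Some d => d == opposite c
      | _, _ => false
      end
  | _ => false
  end.

(* b continues a: it starts at the midpoint where a ends, on the other side   *)
(* of the edge.                                                               *)
Definition crosses (a b : passage) : bool :=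
  (arc_target a == arc_source b) && (a.1 != b.1).

Definition visited (o : midpoint) (g : seq passage) : seq midpoint :=
  o :: map arc_target g.

(* The self-avoiding walks starting at o, as sequences of passages; the empty *)
(* sequence is the empty walk.                                                *)
Definition self_avoiding (o : midpoint) (g : seq passage) : Prop :=
  [/\ match g with [::] => True | a :: _ => arc_source a = o end,
      sorted crosses g,
      uniq (visited o g)
    & forall r : rhombus, admissible (arcs_in g r)].

Definition walk_length (g : seq passage) : nat := size g.

Definition walks (o : midpoint) (n : nat) : set (seq passage) :=
  [set g | self_avoiding o g /\ walk_length g = n].

Record weights (R : Type) :=
  Weights { u1 : R; u2 : R; v : R; w1 : R; w2 : R }.

(* The value 0 is only reached by configurations that are not admissible. *)
Definition config_weight (R : realType) (W : weights R) (l : seq passage) : R :=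
  match l with
  | [::] => 1
  | [:: a] =>
      match arc_corner a with
      | Some c => if theta_corner c then u1 W else u2 W
      | None => v W
      end
  | [:: a; _] =>
      match arc_corner a with
      | Some c => if theta_corner c then w1 W else w2 W
      | None => 0
      end
  | _ => 0
  end.

(* All but finitely many factors are 1. *)
Definition walk_weight (R : realType) (W : weights R) (g : seq passage) : R :=
  \big[*%R/1]_(r \in [set: rhombus]) config_weight W (arcs_in g r).

Definition ctilde (R : realType) (W : weights R) (o : midpoint) (n : nat) : R :=
  (u1 W ^+ n)^-1 * \sum_(g \in walks o n) walk_weight W g.

(* The first two clauses say that the quotients and the n-th roots in the     *)
(* third one are meaningful.                                                  *)
Definition connective_constant_eq (R : realType) (o : midpoint)
    (W : weights R) : Prop :=
  [/\ u1 W != 0,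
      forall n : nat, 0 <= ctilde W o n
    & (fun n : nat => ctilde W o n `^ (n%:R)^-1) @ \oo --> (u1 W)^-1].

Definition explicit_weights (R : realType) (theta : R) : weights R :=
  let t := 3 * theta / 8 in
  let d := sin (5 * pi / 4 + t) * sin (5 * pi / 8 - t) in
  {| u1 := sin (5 * pi / 4) * sin (5 * pi / 8 + t) / d;
     u2 := sin (5 * pi / 4) * sin t / d;
     v := sin (5 * pi / 8 + t) * sin (- t) / d;
     w1 := sin (5 * pi / 8 + t) * sin (5 * pi / 4 - t) / d;
     w2 := sin (15 * pi / 8 + t) * sin (- t) / d |}.

(* Main.v *)
(* A walk is a word of turns, whose direction is lifted to the integers so
   that it records the total turning. For g d = cos (3/8 of the angle turned),
   weigh a walk by omega times the value of g at its end. When a walk enters a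
   new rhombus, this quantity is preserved by summing over the next turn; when
   it enters a visited rhombus, the defect cancels against that of the walk that
   runs through the last loop backwards. Only the possible turnings of a loop
   matter here, and they come from Hopf's argument for secants: the direction
   of the secant between two times lifts continuously to a triangle. Summation
   over the walks in a parallelogram gives, as its height grows, an identity
   B_T + g 2 * A_T + (top and bottom) = 1 for the bridges and arches in a strip
   of width T.
   Upper bound: B_T <= 1, so for x < 1 bridges of width T weigh at most x^T
   in the generating function, and cutting walks at their last visit to an
   extreme column bounds the generating function of all walks.
   Lower bound: w1 <= u1^2 and w2 <= u2^2 make the total weight c_n of the walks
   of length n submultiplicative. If some c_n < 1, then c_n decays
   exponentially, top and bottom vanish in the limit, and
   A_(T+1) - A_T <= k B_T B_(T+1) gives B_T <= B_(T+1) (1 + k B_T); then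
   prod (1 + k B_t) stays bounded as sum B_t does, so that B_T is bounded below,
   and sum B_t diverges, a contradiction. *)

Require Import Defs.
From HB Require Import structures.
From mathcomp Require Import all_boot all_order all_algebra.
From mathcomp Require Import zify ring lra.
Set Implicit Arguments.
Unset Strict Implicit.
Unset Printing Implicit Defensive.
Import Order.TTheory GRing.Theory Num.Theory.
Local Open Scope ring_scope.

(** * Directions of secants *)

(** The number 3/8 is 1 - 5/8. The usual observable has spin 5/8, that is, a factor exp(-5iW/8) for
    the winding W; in a contour sum it is multiplied by the direction exp(iW) of the outgoing step,
    and [g] keeps the real part of the product. The obstacle is that a rhombus can be visited twice.
    The direction of a walk at its second visit must then be known as a lift, not just modulo a full
    turn. This is obtained without a Jordan curve theorem: the loop is closed by a fictitious chord
    inside the revisited rhombus, and the start, on the border of a half-plane that contains the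
    walk, rules out the loops around it. Second visits also keep the weight from being
    multiplicative under concatenation. A concatenation weighs at most the product, which is the
    direction needed at every cut; and a turn that is changed by a cut in an extreme column lies in
    a rhombus not visited before, so that the change costs a bounded factor. *)

Definition turn : Type := option bool.
Definition tz (e : turn) : int :=
  match e with None => 0 | Some true => 1 | Some false => -1 end.

Definition ex (d : int) : int :=
  if (d %% 4)%Z == 0 then 1 else if (d %% 4)%Z == 2 then -1 else 0.
Definition ey (d : int) : int :=
  if (d %% 4)%Z == 1 then 1 else if (d %% 4)%Z == 3 then -1 else 0.

Lemma dirP (d : int) :
  [\/ [/\ (d %% 4)%Z = 0, ex d = 1 & ey d = 0],
      [/\ (d %% 4)%Z = 1, ex d = 0 & ey d = 1],
      [/\ (d %% 4)%Z = 2, ex d = -1 & ey d = 0] |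
      [/\ (d %% 4)%Z = 3, ex d = 0 & ey d = -1]].
Proof.
rewrite /ex /ey.
have : (d %% 4)%Z = 0 \/ (d %% 4)%Z = 1 \/ (d %% 4)%Z = 2 \/ (d %% 4)%Z = 3 by lia.
by case=> [->|[->|[->|->]]]; [apply: Or41|apply: Or42|apply: Or43|apply: Or44].
Qed.

Lemma tzP (e : turn) : [\/ tz e = 0, tz e = 1 | tz e = -1].
Proof. by case: e => [[]|]; [apply: Or32|apply: Or33|apply: Or31]. Qed.

(* Eight classes of directions: the odd ones are the diagonals, the even ones
   the open sectors between them. The zero vector gets the junk value 7. *)
Definition ang (X Y : int) : int :=
  if 0 < X + Y then (if Y < X then 0 else if Y == X then 1 else 2)
  else if X + Y == 0 then (if X < Y then 3 else 7)
  else (if X < Y then 4 else if Y == X then 5 else 6).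

Definition dlt (X Y X' Y' : int) : int :=
  ((ang X' Y' - ang X Y + 4) %% 8)%Z - 4.

Variant ang_spec (X Y : int) : int -> Prop :=
  | Ang0 of 0 < X + Y & Y < X : ang_spec X Y 0
  | Ang1 of 0 < X + Y & Y = X : ang_spec X Y 1
  | Ang2 of 0 < X + Y & X < Y : ang_spec X Y 2
  | Ang3 of X + Y = 0 & X < Y : ang_spec X Y 3
  | Ang4 of X + Y < 0 & X < Y : ang_spec X Y 4
  | Ang5 of X + Y < 0 & Y = X : ang_spec X Y 5
  | Ang6 of X + Y < 0 & Y < X : ang_spec X Y 6
  | Ang7 of X + Y = 0 & Y <= X : ang_spec X Y 7.

Lemma angP X Y : ang_spec X Y (ang X Y).
Proof.
rewrite /ang; case: ltrP => [h1|h1].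
  case: ltrP => [h2|h2]; first by constructor.
  by case: eqP => h3; constructor; lia.
case: eqP => h2.
  by case: ltrP => h3; constructor; lia.
case: ltrP => h3; first by constructor; lia.
by case: eqP => h4; constructor; lia.
Qed.

(* The steps of a polygonal path through midpoints, in coordinates where the
   rhombi have side 2. *)
Definition king (X Y X' Y' : int) : Prop :=
  [/\ ~ (X = 0 /\ Y = 0), ~ (X' = 0 /\ Y' = 0), ((X + Y) %% 2)%Z = 0,
      ((X' + Y') %% 2)%Z = 0 & `|X' - X| + `|Y' - Y| <= 2].

(** Such a step turns by at most two classes, so [dlt] stays away from the ends of its range [-4, 4)
    and is the true change of direction. *)
Lemma dlt_small X Y X' Y' : king X Y X' Y' -> `|dlt X Y X' Y'| <= 2.
Proof.
case=> n0 n0' p p' k; rewrite /dlt.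
by case: (angP X Y) => a1 a2; case: (angP X' Y') => b1 b2; lia.
Qed.

Lemma dlt_mod X Y X' Y' :
  ((dlt X Y X' Y' - (ang X' Y' - ang X Y)) %% 8)%Z = 0.
Proof. rewrite /dlt; lia. Qed.

Lemma exD4 (d m : int) : ex (d + 4 * m) = ex d.
Proof. by rewrite /ex; have -> : ((d + 4 * m) %% 4 = d %% 4)%Z by lia. Qed.
Lemma eyD4 (d m : int) : ey (d + 4 * m) = ey d.
Proof. by rewrite /ey; have -> : ((d + 4 * m) %% 4 = d %% 4)%Z by lia. Qed.

Lemma ex_modl (d k : int) : ex (d + k) = ex ((d %% 4)%Z + k).
Proof. by rewrite -(exD4 ((d %% 4)%Z + k) (d %/ 4)%Z); congr ex; lia. Qed.
Lemma ey_modl (d k : int) : ey (d + k) = ey ((d %% 4)%Z + k).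
Proof. by rewrite -(eyD4 ((d %% 4)%Z + k) (d %/ 4)%Z); congr ey; lia. Qed.
Lemma ex_mod d : ex d = ex (d %% 4)%Z.
Proof. by have := ex_modl d 0; rewrite !addr0. Qed.
Lemma ey_mod d : ey d = ey (d %% 4)%Z.
Proof. by have := ey_modl d 0; rewrite !addr0. Qed.

Definition secants (Dx Dy a b : int) (e f : turn) : seq (int * int) :=
  let x := ex a in let y := ey a in
  let x' := ex (a + tz e) in let y' := ey (a + tz e) in
  let s := ex b in let t := ey b in
  let s' := ex (b + tz f) in let t' := ey (b + tz f) in
  [:: (2 * Dx - s + x, 2 * Dy - t + y); (2 * Dx + s' + x, 2 * Dy + t' + y);
      (2 * Dx + s' - x', 2 * Dy + t' - y'); (2 * Dx - s - x', 2 * Dy - t - y')].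

Definition dltp (z z' : int * int) : int := dlt z.1 z.2 z'.1 z'.2.

Definition flat (l : seq (int * int)) : bool :=
  if l is [:: z1; z2; z3; z4] then
    dltp z1 z2 + dltp z2 z3 == dltp z1 z4 + dltp z4 z3
  else false.

Definition units : seq int := [:: -1; 0; 1].
Definition dirs : seq int := [:: 0; 1; 2; 3].
Definition turns : seq turn := [:: None; Some true; Some false].

(** Offsets of at most one rhombus, by enumeration. Excluded are a zero secant and a straight first
    passage in the same rhombus: two crossing chords have 0 inside their parallelogram of
    secants. *)
Lemma flat_near_check :
  all (fun Dx => all (fun Dy => all (fun a => all (fun b =>
    all (fun e => all (fun f => let l := secants Dx Dy a b e f in
      (((0 : int, 0 : int) \notin l) && ~~ [&& Dx == 0, Dy == 0 & e == None])
        ==> flat l)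
    turns) turns) dirs) dirs) units) units.
Proof. by vm_compute. Qed.

Lemma mem_turns e : e \in turns. Proof. by case: e => [[]|]. Qed.

Lemma mem_dirs (d : int) : (d %% 4)%Z \in dirs.
Proof. by rewrite !inE; lia. Qed.

Lemma secants_mod Dx Dy a b e f :
  secants Dx Dy a b e f = secants Dx Dy (a %% 4)%Z (b %% 4)%Z e f.
Proof.
rewrite /secants (ex_modl a) (ex_modl b) (ey_modl a) (ey_modl b).
by rewrite (ex_mod a) (ex_mod b) (ey_mod a) (ey_mod b).
Qed.

(* Lift of the class of a vector to the interval [m - 4, m + 4). *)
Definition lft (m X Y : int) : int := ((ang X Y - m + 4) %% 8)%Z + m - 4.

(** The closed half-plane about the axis direction of class [m]. In it classes lift to an interval
    of length 4, too short for a jump by 8. *)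
Definition half (m X Y : int) : Prop :=
  [\/ (m %% 8)%Z = 0 /\ 0 <= X, (m %% 8)%Z = 2 /\ 0 <= Y,
      (m %% 8)%Z = 4 /\ X <= 0 | (m %% 8)%Z = 6 /\ Y <= 0].

Lemma lft_half m X Y : ~ (X = 0 /\ Y = 0) -> half m X Y ->
  m - 2 <= lft m X Y <= m + 2.
Proof.
move=> n0; rewrite /lft.
by case=> [[hm h]|[hm h]|[hm h]|[hm h]]; case: (angP X Y) => a1 a2; lia.
Qed.

Lemma dlt_lft m X Y X' Y' : king X Y X' Y' -> half m X Y -> half m X' Y' ->
  dlt X Y X' Y' = lft m X' Y' - lft m X Y.
Proof.
move=> k h h'; have := dlt_small k; have := dlt_mod X Y X' Y'.
have [n0 n0' _ _ _] := k.
have := lft_half n0 h; have := lft_half n0' h'.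
rewrite /lft; set A := ang X Y; set B := ang X' Y'; lia.
Qed.

Lemma unit_parity d : ((ex d + ey d) %% 2)%Z = 1.
Proof. by case: (dirP d) => -[_ -> ->]. Qed.

Lemma chord_small d e :
  `|ex d + ex (d + tz e)| + `|ey d + ey (d + tz e)| <= 2.
Proof.
case: (dirP d) => -[_ -> ->]; case: (dirP (d + tz e)) => -[_ -> ->]; lia.
Qed.

Lemma king_secant (X Y X' Y' d : int) (e : turn) :
  ~ (X = 0 /\ Y = 0) -> ~ (X' = 0 /\ Y' = 0) -> ((X + Y) %% 2)%Z = 0 ->
  X' = X + (ex d + ex (d + tz e)) -> Y' = Y + (ey d + ey (d + tz e)) ->
  king X Y X' Y'.
Proof.
move=> n0 n0' p eX eY; split=> //.
  by have := unit_parity d; have := unit_parity (d + tz e); lia.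
have := chord_small d e; rewrite eX eY; lia.
Qed.

Lemma king_sym X Y X' Y' : king X Y X' Y' -> king X' Y' X Y.
Proof. case=> *; split=> //; lia. Qed.

Lemma dltN X Y X' Y' : ~ (X = 0 /\ Y = 0) -> ~ (X' = 0 /\ Y' = 0) ->
  dlt (-X) (-Y) (-X') (-Y') = dlt X Y X' Y'.
Proof.
have aN U V : ~ (U = 0 /\ V = 0) -> ((ang (-U) (-V) - ang U V) %% 8)%Z = 4.
  by move=> n0; case: (angP U V) => a1 a2; case: (angP (-U) (-V)) => b1 b2; lia.
move=> /aN h /aN h'; rewrite /dlt.
move: h h'; set a := ang X Y; set b := ang X' Y'; set a' := ang (-X) (-Y).
set b' := ang (-X') (-Y'); lia.
Qed.

Definition nz (z : int * int) : Prop := ~ (z.1 = 0 /\ z.2 = 0).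

(** Inside one half-plane [dlt] is a difference of lifts, so both sides telescope to the change from
    [z1] to [z3]. *)
Lemma flat_half m z1 z2 z3 z4 :
  half m z1.1 z1.2 -> half m z2.1 z2.2 -> half m z3.1 z3.2 -> half m z4.1 z4.2 ->
  king z1.1 z1.2 z2.1 z2.2 -> king z2.1 z2.2 z3.1 z3.2 ->
  king z1.1 z1.2 z4.1 z4.2 -> king z4.1 z4.2 z3.1 z3.2 ->
  dltp z1 z2 + dltp z2 z3 = dltp z1 z4 + dltp z4 z3.
Proof.
move=> h1 h2 h3 h4 k12 k23 k14 k43; rewrite /dltp.
rewrite (dlt_lft k12 h1 h2) (dlt_lft k23 h2 h3) (dlt_lft k14 h1 h4).
by rewrite (dlt_lft k43 h4 h3); lia.
Qed.

(* The four vectors span a parallelogram; it does not contain 0 because the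
   chords [a, e] and [b, f] of two rhombi at offset [D] are disjoint. *)
Lemma flat_secants (Dx Dy a b : int) (e f : turn) (z1 z2 z3 z4 : int * int) :
  secants Dx Dy a b e f = [:: z1; z2; z3; z4] ->
  nz z1 -> nz z2 -> nz z3 -> nz z4 -> ~ [/\ Dx = 0, Dy = 0 & e = None] ->
  dltp z1 z2 + dltp z2 z3 = dltp z1 z4 + dltp z4 z3.
Proof.
move=> eS n1 n2 n3 n4 ncr.
have [near|far] := boolP ((`|Dx| <= 1) && (`|Dy| <= 1)).
  have mx : Dx \in units by rewrite !inE; lia.
  have my : Dy \in units by rewrite !inE; lia.
  have := flat_near_check.
  move=> /allP/(_ _ mx)/allP/(_ _ my)/allP/(_ _ (mem_dirs a)).
  move=> /allP/(_ _ (mem_dirs b))/allP/(_ _ (mem_turns e)).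
  move=> /allP/(_ _ (mem_turns f)); cbv beta zeta.
  rewrite -secants_mod eS => /implyP H.
  apply/eqP; apply: H; apply/andP; split.
    rewrite !inE; apply/negP; case/or4P => /eqP E.
    - by apply: n1; rewrite -E.
    - by apply: n2; rewrite -E.
    - by apply: n3; rewrite -E.
    - by apply: n4; rewrite -E.
  by apply/negP => /and3P[/eqP ? /eqP ? /eqP ?]; apply: ncr.
case: eS => E1 E2 E3 E4.
have pr : [/\ ((z1.1 + z1.2) %% 2)%Z = 0, ((z2.1 + z2.2) %% 2)%Z = 0,
           ((z3.1 + z3.2) %% 2)%Z = 0 & ((z4.1 + z4.2) %% 2)%Z = 0].
  rewrite -E1 -E2 -E3 -E4 /=.
  have := unit_parity a; have := unit_parity (a + tz e).
  have := unit_parity b; have := unit_parity (b + tz f).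
  move: (ex a) (ey a) (ex b) (ey b) (ex (a + tz e)) (ey (a + tz e)).
  move: (ex (b + tz f)) (ey (b + tz f)) => *.
  by split; lia.
have [p1 p2 p3 p4] := pr.
have k12 : king z1.1 z1.2 z2.1 z2.2.
  by apply: (@king_secant _ _ _ _ b f) => //; rewrite -E1 -E2 /=; ring.
have k43 : king z4.1 z4.2 z3.1 z3.2.
  by apply: (@king_secant _ _ _ _ b f) => //; rewrite -E4 -E3 /=; ring.
have k14 : king z1.1 z1.2 z4.1 z4.2.
  by apply/king_sym/(@king_secant _ _ _ _ a e) => //; rewrite -E1 -E4 /=; ring.
have k23 : king z2.1 z2.2 z3.1 z3.2.
  by apply/king_sym/(@king_secant _ _ _ _ a e) => //; rewrite -E2 -E3 /=; ring.
have bnd d : [/\ -1 <= ex d, ex d <= 1, -1 <= ey d & ey d <= 1].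
  by case: (dirP d) => -[_ -> ->].
have [a1 a2 a3 a4] := bnd a; have [b1 b2 b3 b4] := bnd b.
have [c1 c2 c3 c4] := bnd (a + tz e); have [d1 d2 d3 d4] := bnd (b + tz f).
(* An offset of 2 is 4 in doubled coordinates and outweighs the two unit displacements, so the four
   secants share a half-plane. *)
have : [\/ 2 <= Dx, 2 <= Dy, Dx <= -2 | Dy <= -2].
  have [|] := lerP 2 Dx; first by constructor 1.
  have [|] := lerP 2 Dy; first by constructor 2.
  have [|] := lerP Dx (-2); first by constructor 3.
  by constructor 4; lia.
case=> hD; [apply: (@flat_half 0)|apply: (@flat_half 2)|apply: (@flat_half 4)|apply: (@flat_half 6)]=> //;
 rewrite -?E1 -?E2 -?E3 -?E4 /=;
 [constructor 1|constructor 1|constructor 1|constructor 1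
 |constructor 2|constructor 2|constructor 2|constructor 2
 |constructor 3|constructor 3|constructor 3|constructor 3
 |constructor 4|constructor 4|constructor 4|constructor 4]; split=> //; lia.
Qed.

Lemma chord_check : all (fun a => all (fun e => all (fun f =>
    let x := ex a in let y := ey a in
    let x' := ex (a + tz e) in let y' := ey (a + tz e) in
    let x'' := ex (a + tz e + tz f) in let y'' := ey (a + tz e + tz f) in
    (dlt (x + x') (y + y') (x + x' + (x' + x'')) (y + y' + (y' + y'')) +
     dlt (x + x' + (x' + x'')) (y + y' + (y' + y'')) (x' + x'') (y' + y'')
      == tz e + tz f) &&
    (((ang (x + x') (y + y') - (a + a + tz e)) %% 8)%Z == 0))
  turns) turns) dirs.
Proof. by vm_compute. Qed.

(** Going from a chord to the next one through their sum changes the class by the difference of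
    [d i + d i.+1] at consecutive times. This starts the induction for path independence on the
    diagonal. *)
Lemma chord_turn a e f :
    let x := ex a in let y := ey a in
    let x' := ex (a + tz e) in let y' := ey (a + tz e) in
    let x'' := ex (a + tz e + tz f) in let y'' := ey (a + tz e + tz f) in
    dlt (x + x') (y + y') (x + x' + (x' + x'')) (y + y' + (y' + y'')) +
     dlt (x + x' + (x' + x'')) (y + y' + (y' + y'')) (x' + x'') (y' + y'')
      = tz e + tz f.
Proof.
cbv zeta; have := chord_check.
move=> /allP/(_ _ (mem_dirs a))/allP/(_ _ (mem_turns e)).
move=> /allP/(_ _ (mem_turns f)); cbv beta zeta.
rewrite -!(addrA _ (tz e) (tz f)) -!ex_modl -!ey_modl.
by rewrite -ex_mod -ey_mod => /andP[/eqP].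
Qed.

(** A chord points midway between its entry and exit directions. As there are two classes per
    quarter turn, its class is the sum of these directions. *)
Lemma chord_class a e :
  ((ang (ex a + ex (a + tz e)) (ey a + ey (a + tz e)) - (a + a + tz e)) %% 8)%Z
  = 0.
Proof.
have := chord_check.
move=> /allP/(_ _ (mem_dirs a))/allP/(_ _ (mem_turns e)).
move=> /allP/(_ _ (mem_turns e)); cbv beta zeta; rewrite -!ex_modl -!ey_modl.
rewrite -ex_mod -ey_mod => /andP[_ /eqP].
by move: (ang _ _) => A; lia.
Qed.

(** * Turning of self-avoiding paths *)

(* [q] and [m] are the directions in which a walk enters a rhombus for the
   first and the second time, [e] its first turn there, [f] the turn after it
   and [g] the last turn before it is back. The sum is that of the changes of
   direction of the secants along the sides of the triangle in Hopf's argument;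
   for a loop it is twice the turning [m - q]. *)
Definition loop_sum (q m : int) (e f g : turn) : int :=
  let q1 := q + tz e in
  let q2 := q1 + tz f in let m1 := m - tz g in
  let kk := (ex q + ex q1, ey q + ey q1) in
  let kn := (ex q - ex m, ey q - ey m) in
  let k1n := (- ex m - ex q1, - ey m - ey q1) in
  let k2n := (- ex m - ex q1 - (ex q1 + ex q2), - ey m - ey q1 - (ey q1 + ey q2)) in
  let k2k := (- (ex q1 + ex q2), - (ey q1 + ey q2)) in
  let nk := (ex q1 + ex m + (ex m + ex m1), ey q1 + ey m + (ey m + ey m1)) in
  let nn := (ex m + ex m1, ey m + ey m1) in
  let kn' := (- (ex q1 + ex m + (ex m + ex m1)), - (ey q1 + ey m + (ey m + ey m1))) in
  tz g - tz f + 2 * dltp kk kn + 2 * dltp kn k1n + dltp k1n k2n - dltp k2k k2n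
  - dltp kn' k1n + dltp nk nn.

(* The first turn of a loop and its total turning. *)
Definition loop_table : seq (turn * int) :=
  [:: (Some true, -2); (Some true, -3); (None, 3); (None, -3);
      (Some false, 2); (Some false, 3)].

Lemma loop_check : all (fun q => all (fun m => all (fun e => all (fun f =>
    all (fun g =>
      [&& (m - q) %% 4 != 0, (m - (q + tz e + 2)) %% 4 != 0 &
          ((loop_sum q m e f g - 2 * (m - q)) %% 8 == 0)]%Z ==>
      has (fun c => (c.1 == e) && (2 * c.2 == loop_sum q m e f g)) loop_table)
  turns) turns) turns) dirs) dirs.
Proof. by vm_compute. Qed.

Lemma loop_sum_mod q m e f g :
  loop_sum q m e f g = loop_sum (q %% 4)%Z (m %% 4)%Z e f g.
Proof.
rewrite /loop_sum /=.
rewrite -(addrA q) -(addrA (q %% 4)%Z) (ex_modl q) (ey_modl q) (ex_modl m) (ey_modl m).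
by rewrite (ex_modl q) (ey_modl q) (ex_mod q) (ex_mod m) (ey_mod q) (ey_mod m).
Qed.

Lemma loop_tableP q m e f g : ((m - q) %% 4)%Z <> 0 ->
  ((m - (q + tz e + 2)) %% 4)%Z <> 0 -> 2 * (m - q) = loop_sum q m e f g ->
  (e, m - q) \in loop_table.
Proof.
move=> h1 h2 h3.
have := loop_check => /allP/(_ _ (mem_dirs q))/allP/(_ _ (mem_dirs m)).
move=> /allP/(_ _ (mem_turns e))/allP/(_ _ (mem_turns f))/allP/(_ _ (mem_turns g)).
rewrite -loop_sum_mod => /implyP H.
have prem : [&& ((m %% 4)%Z - (q %% 4)%Z) %% 4 != 0,
    ((m %% 4)%Z - ((q %% 4)%Z + tz e + 2)) %% 4 != 0 &
    (loop_sum q m e f g - 2 * ((m %% 4)%Z - (q %% 4)%Z)) %% 8 == 0]%Z.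
  by rewrite -h3; apply/and3P; split; [apply/eqP|apply/eqP|]; lia.
have /hasP[[e' t] ht /= /andP[/eqP e_eq /eqP E]] := H prem.
by rewrite -e_eq (_ : m - q = t) //; lia.
Qed.

(* The path enters the rhombus [(x i, y i)] in direction [d i]. Midpoints have
   doubled coordinates, with origin at the centre of the rhombus [(0, 0)]. *)
Section Path.
Variables (n : nat) (x y d : nat -> int) (e : nat -> turn).
Hypothesis d_step : forall i, (i < n)%N -> d i.+1 = d i + tz (e i).
Hypothesis x_step : forall i, (i < n)%N -> x i.+1 = x i + ex (d i.+1).
Hypothesis y_step : forall i, (i < n)%N -> y i.+1 = y i + ey (d i.+1).

Definition midx (i : nat) : int := 2 * x i - ex (d i).
Definition midy (i : nat) : int := 2 * y i - ey (d i).

Hypothesis mids_distinct : forall i j, (i < j)%N -> (j <= n)%N ->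
  ~ (midx i = midx j /\ midy i = midy j).
Hypothesis no_crossing : forall i j, (i < j)%N -> (j < n)%N ->
  x i = x j -> y i = y j -> e i <> None.

Definition sec (i j : nat) : int * int := (midx j - midx i, midy j - midy i).

Lemma midx_step i : (i < n)%N -> midx i.+1 = midx i + (ex (d i) + ex (d i + tz (e i))).
Proof. by move=> h; rewrite /midx x_step // -d_step //; ring. Qed.
Lemma midy_step i : (i < n)%N -> midy i.+1 = midy i + (ey (d i) + ey (d i + tz (e i))).
Proof. by move=> h; rewrite /midy y_step // -d_step //; ring. Qed.

Lemma sec_nz i j : (i < j)%N -> (j <= n)%N -> nz (sec i j).
Proof. by move=> ij jn [/= h1 h2]; apply: (mids_distinct ij jn); lia. Qed.

Lemma sec_nz' i j : (i < j)%N -> (j <= n)%N -> nz (sec j i).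
Proof. by move=> ij jn [/= h1 h2]; apply: (mids_distinct ij jn); lia. Qed.

Lemma mid_parity i : (i <= n)%N -> ((midx i + midy i) %% 2)%Z = 1.
Proof. by move=> _; rewrite /midx /midy; have := unit_parity (d i); lia. Qed.

Lemma sec_flat i j : (i.+1 < j)%N -> (j < n)%N ->
  dltp (sec i j) (sec i j.+1) + dltp (sec i j.+1) (sec i.+1 j.+1) =
  dltp (sec i j) (sec i.+1 j) + dltp (sec i.+1 j) (sec i.+1 j.+1).
Proof.
move=> ij jn; have hi : (i < n)%N by lia.
apply: (@flat_secants (x j - x i) (y j - y i) (d i) (d j) (e i) (e j)).
- rewrite /sec (midx_step jn) (midy_step jn) (midx_step hi) (midy_step hi).
  rewrite /secants /midx /midy; congr [:: (_, _); (_, _); (_, _); (_, _)]; ring.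
- by apply: sec_nz; lia.
- by apply: sec_nz; lia.
- by apply: sec_nz; lia.
- by apply: sec_nz; lia.
- by case=> h1 h2; apply: (@no_crossing i j) => //; lia.
Qed.

(* The direction of the secant from i to j, lifted to the integers (eight
   units per turn) continuously in i and j. *)
Definition Theta (i j : nat) : int :=
  d i + d i.+1 + \sum_(i.+1 <= l < j) dltp (sec i l) (sec i l.+1).

Lemma Theta_chord i : Theta i i.+1 = d i + d i.+1.
Proof. by rewrite /Theta big_geq // addr0. Qed.

Lemma Theta_row i j : (i < j)%N ->
  Theta i j.+1 = Theta i j + dltp (sec i j) (sec i j.+1).
Proof. by move=> ij; rewrite /Theta big_nat_recr //= addrA. Qed.

(** [Theta] is defined along rows; flatness of the unit squares makes it independent of the path, by
    induction from the diagonal, where [chord_turn] applies. *)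
Lemma Theta_col i j : (i.+1 < j)%N -> (j <= n)%N ->
  Theta i.+1 j = Theta i j + dltp (sec i j) (sec i.+1 j).
Proof.
elim: j => [//|j IH] ij jn.
have [E|ne] := eqVneq j i.+1.
  rewrite E Theta_chord Theta_row // Theta_chord /dltp /sec /=.
  have hi : (i < n)%N by lia. have hi' : (i.+1 < n)%N by lia.
  rewrite (midx_step hi') (midy_step hi') (midx_step hi) (midy_step hi).
  have := chord_turn (d i) (e i) (e i.+1); cbv zeta.
  rewrite (d_step hi') (d_step hi).
  set A := dlt _ _ _ _; set B := dlt _ _ _ _ => H.
  set A' := dlt _ _ _ _; set B' := dlt _ _ _ _.
  have -> : A' = A by rewrite /A' /A; congr dlt; ring.
  have -> : B' = B by rewrite /B' /B; congr dlt; ring.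
  by move: H; clear; lia.
have ij' : (i.+1 < j)%N by lia.
rewrite Theta_row //.
rewrite IH //; last by lia.
rewrite Theta_row; last by lia.
have := sec_flat ij' jn.
move: (dltp _ _) (dltp _ _) (dltp _ _) (dltp _ _) => *; lia.
Qed.

Lemma sec_king_row i j : (i < j)%N -> (j < n)%N ->
  king (sec i j).1 (sec i j).2 (sec i j.+1).1 (sec i j.+1).2.
Proof.
move=> ij jn; apply: (@king_secant _ _ _ _ (d j) (e j)).
- by apply: sec_nz; lia.
- by apply: sec_nz; lia.
- have := @mid_parity i; have := @mid_parity j; rewrite /sec /=; lia.
- by rewrite /sec /= midx_step //; ring.
- by rewrite /sec /= midy_step //; ring.
Qed.

Lemma sec_king_col i j : (i.+1 < j)%N -> (j <= n)%N ->
  king (sec i j).1 (sec i j).2 (sec i.+1 j).1 (sec i.+1 j).2.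
Proof.
move=> ij jn; have hi : (i < n)%N by lia.
apply/king_sym/(@king_secant _ _ _ _ (d i) (e i)).
- by apply: sec_nz; lia.
- by apply: sec_nz; lia.
- have := @mid_parity i.+1; have := @mid_parity j; rewrite /sec /=; lia.
- by rewrite /sec /= midx_step //; ring.
- by rewrite /sec /= midy_step //; ring.
Qed.

Lemma Theta_mod i j : (i < j)%N -> (j <= n)%N ->
  ((Theta i j - ang (sec i j).1 (sec i j).2) %% 8)%Z = 0.
Proof.
elim: j => [//|j IH] ij jn.
have [E|ne] := eqVneq j i.
  have hi : (i < n)%N by lia.
  rewrite E Theta_chord (d_step hi) /sec /= (midx_step hi) (midy_step hi).
  have := chord_class (d i) (e i).
  set A := ang _ _; set B := ang _ _.
  have -> : B = A by rewrite /B /A; congr ang; ring.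
  by move: A B => A B; clear; lia.
rewrite Theta_row; last by lia.
have := dlt_mod (sec i j).1 (sec i j).2 (sec i j.+1).1 (sec i j.+1).2.
have : ((Theta i j - ang (sec i j).1 (sec i j).2) %% 8)%Z = 0 by apply: IH; lia.
rewrite /dltp; move: (ang _ _) (ang _ _) (dlt _ _ _ _) (Theta _ _) => *; lia.
Qed.

Definition in_half (m : int) (z : int * int) : Prop := half m z.1 z.2.

(** The new value is within 2 of the interval and is known modulo 8 from the class of [z'], whose
    only lift that close lies in the interval. *)
Lemma half_propagate m z z' T : king z.1 z.2 z'.1 z'.2 ->
  in_half m z' -> m - 2 <= T <= m + 2 ->
  ((T - ang z.1 z.2) %% 8)%Z = 0 ->
  m - 2 <= T + dltp z z' <= m + 2.
Proof.
move=> k h hT mT; have := dlt_small k; have [_ n0 _ _ _] := k.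
have := lft_half n0 h; have := dlt_mod z.1 z.2 z'.1 z'.2.
rewrite /lft /dltp; move: mT hT.
move: (ang _ _) (ang _ _) (dlt _ _ _ _) => A B C; lia.
Qed.

Lemma Theta_row_half m i j : (i < j)%N -> (j <= n)%N ->
  m - 2 <= Theta i i.+1 <= m + 2 ->
  (forall l, (i < l)%N -> (l <= j)%N -> in_half m (sec i l)) ->
  m - 2 <= Theta i j <= m + 2.
Proof.
elim: j => [//|j IH] ij jn h0 hl.
have [->//|ne] := eqVneq j i.
rewrite Theta_row; last by lia.
apply: half_propagate.
- by apply: sec_king_row; lia.
- by apply: hl; lia.
- apply: IH => //; first by lia. by lia.
  by move=> l l1 l2; apply: hl; lia.
- by apply: Theta_mod; lia.
Qed.

Lemma Theta_col_half m i j : (i < j)%N -> (j <= n)%N ->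
  m - 2 <= Theta 0 j <= m + 2 ->
  (forall l, (l <= i)%N -> in_half m (sec l j)) ->
  m - 2 <= Theta i j <= m + 2.
Proof.
elim: i => [//|i IH] ij jn h0 hl.
rewrite Theta_col //.
apply: half_propagate.
- by apply: sec_king_col.
- by apply: hl.
- by apply: IH => //; [lia|move=> l l1; apply: hl; lia].
- by apply: Theta_mod; lia.
Qed.
Lemma side_eq i j : x i = x j -> y i = y j -> (d i %% 4)%Z = (d j %% 4)%Z ->
  midx i = midx j /\ midy i = midy j.
Proof.
by move=> hx hy hd; rewrite /midx /midy hx hy (ex_mod (d i)) (ey_mod (d i)) hd -ex_mod -ey_mod.
Qed.

(** The midpoint of time [i.+1] as a side of the rhombus of time [i]: the side by which direction
    [d i.+1 + 2] would enter it. *)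
Lemma exit_mid i : (i < n)%N ->
  midx i.+1 = 2 * x i - ex (d i.+1 + 2) /\ midy i.+1 = 2 * y i - ey (d i.+1 + 2).
Proof.
move=> hi; rewrite /midx /midy x_step // y_step //.
by case: (dirP (d i.+1)) => -[h1 -> ->]; case: (dirP (d i.+1 + 2)) => -[h2 -> ->];
  lia.
Qed.

Lemma entry_distinct i j : (i < j)%N -> (j <= n)%N -> x i = x j -> y i = y j ->
  (d i %% 4)%Z <> (d j %% 4)%Z.
Proof. by move=> ij jn hx hy hd; apply: (mids_distinct ij jn); apply: side_eq. Qed.

Lemma step_neq i : (i < n)%N -> x i.+1 = x i -> y i.+1 = y i -> False.
Proof.
by move=> hi; rewrite x_step // y_step //; case: (dirP (d i.+1)) => -[h1 -> ->]; lia.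
Qed.

Lemma exit_entry_distinct i j : (i < j)%N -> (j <= n)%N -> x i = x j -> y i = y j ->
  ((d i.+1 + 2) %% 4)%Z <> (d j %% 4)%Z.
Proof.
move=> ij jn hx hy hd; have hi : (i < n)%N by lia.
have [E|ne] := eqVneq j i.+1; first by subst j; apply: (step_neq hi).
apply: (@mids_distinct i.+1 j) => //; first by lia.
have [-> ->] := exit_mid hi.
by rewrite /midx /midy hx hy (ex_mod (d j)) (ey_mod (d j)) -hd -ex_mod -ey_mod.
Qed.

Lemma entry_exit_distinct i j : (i < j)%N -> (j < n)%N -> x i = x j -> y i = y j ->
  (d i %% 4)%Z <> ((d j.+1 + 2) %% 4)%Z.
Proof.
move=> ij jn hx hy hd.
apply: (@mids_distinct i j.+1) => //; first by lia.
have [-> ->] := exit_mid jn.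
by rewrite /midx /midy hx hy (ex_mod (d i)) (ey_mod (d i)) hd -ex_mod -ey_mod.
Qed.

Lemma exit_exit_distinct i j : (i < j)%N -> (j < n)%N -> x i = x j -> y i = y j ->
  (d i.+1 %% 4)%Z <> (d j.+1 %% 4)%Z.
Proof.
move=> ij jn hx hy hd.
have hi : (i < n)%N by lia.
apply: (@mids_distinct i.+1 j.+1) => //.
have [-> ->] := exit_mid hi; have [-> ->] := exit_mid jn.
rewrite hx hy (ex_modl (d i.+1)) (ey_modl (d i.+1)) hd.
by rewrite -ex_modl -ey_modl.
Qed.

Lemma own_sides_distinct i : (i < n)%N -> (d i %% 4)%Z <> ((d i.+1 + 2) %% 4)%Z.
Proof. by move=> hi; rewrite d_step //; case: (tzP (e i)) => ->; lia. Qed.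

(** Two visits use up the four sides, and none is left for a third entry. *)
Lemma no_third_visit i j l : (i < j)%N -> (j < l)%N -> (l <= n)%N ->
  x i = x l -> y i = y l -> x j = x l -> y j = y l -> False.
Proof.
move=> ij jl ln hxi hyi hxj hyj.
have hx : x i = x j by rewrite hxi. have hy : y i = y j by rewrite hyi.
have hil : (i < l)%N by lia. have hjn : (j < n)%N by lia.
have hjn' : (j <= n)%N by lia. have hin : (i < n)%N by lia.
have := entry_distinct ij hjn' hx hy.
have := entry_distinct hil ln hxi hyi.
have := entry_distinct jl ln hxj hyj.
have := exit_entry_distinct ij hjn' hx hy.
have := exit_entry_distinct hil ln hxi hyi.
have := exit_entry_distinct jl ln hxj hyj.
have := entry_exit_distinct ij hjn hx hy.
have := exit_exit_distinct ij hjn hx hy.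
have := own_sides_distinct hin; have := own_sides_distinct hjn.
move: (d i) (d j) (d l) (d i.+1) (d j.+1) => *; lia.
Qed.

Hypothesis start_x : x 0 = 0.
Hypothesis start_y : y 0 = 0.
Hypothesis start_d : d 0 = 0.
Hypothesis right_side : forall i, (i < n)%N -> 0 <= x i.

Lemma midx_ge i : (i <= n)%N -> -1 <= midx i.
Proof.
case: i => [|i] hi; first by rewrite /midx start_x start_d.
have [-> _] := exit_mid hi; have := right_side hi.
by case: (dirP (d i.+1 + 2)) => -[_ -> _]; lia.
Qed.

Lemma midx0 : midx 0 = -1. Proof. by rewrite /midx start_x start_d. Qed.

(** No midpoint is to the left of the start, so the secants from the start stay in the right
    half-plane. *)
Lemma Theta0_half j : (0 < j)%N -> (j <= n)%N -> -2 <= Theta 0 j <= 2.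
Proof.
move=> j0 jn; have := @Theta_row_half 0 0 j j0 jn; rewrite sub0r add0r; apply.
  by rewrite Theta_chord d_step ?start_d; [case: (tzP (e 0%N)) => ->|lia].
move=> l l0 lj; apply: Or41; split=> //.
by rewrite /sec /= midx0; have := @midx_ge l; lia.
Qed.

Lemma Theta_last : (0 < n)%N -> Theta n.-1 n = d n.-1 + d n.
Proof. by move=> n0; have := Theta_chord n.-1; rewrite prednK. Qed.

(** No midpoint is to the right of the last one, so the secants to it stay in the right half-plane
    too. This bounds [Theta] at the last chord and leaves one lift of the final direction. The next
    three lemmas use the half-plane of their own side. *)
Lemma exit_right : (0 < n)%N -> (forall i, (i < n)%N -> x i < x n) -> d n = 0.
Proof.
move=> n0 hn; have hn1 : (n.-1 < n)%N by lia.
have E : n.-1.+1 = n by lia.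
have := hn _ hn1; have := x_step hn1; have := d_step hn1; rewrite E => hd hx hlt.
have : -2 <= Theta n.-1 n <= 2.
  have := @Theta_col_half 0 n.-1 n hn1 (leqnn _); rewrite sub0r add0r; apply.
    exact: Theta0_half.
  move=> [|l] hl; apply: Or41; split=> //; rewrite /sec /=.
    by rewrite midx0; have := midx_ge (leqnn n); lia.
  have hl' : (l < n)%N by lia.
  have [-> _] := exit_mid hl'; have := hn _ hl'.
  rewrite /midx hx; move: hlt; rewrite hx.
  by case: (dirP (d n)) => -[_ -> _]; case: (dirP (d l.+1 + 2)) => -[_ -> _]; lia.
rewrite Theta_last //; move: hlt; rewrite hx.
case: (dirP (d n)) => -[hm -> _]; move: hd; case: (tzP (e n.-1)) => ->; lia.
Qed.

Lemma exit_left : (0 < n)%N -> x n = -1 -> d n = 2 \/ d n = -2.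
Proof.
move=> n0 hn; have hn1 : (n.-1 < n)%N by lia.
have E : n.-1.+1 = n by lia.
have := x_step hn1; have := d_step hn1; rewrite E => hd hx.
have := right_side hn1 => h0.
have hdn : (d n %% 4)%Z = 2.
  by move: hx; case: (dirP (d n)) => -[h -> _]; lia.
have hmx : midx n = -1.
  by move: hx; rewrite /midx hn; case: (dirP (d n)) => -[h -> _]; lia.
have hT := Theta0_half n0 (leqnn _).
have hl l : (l <= n.-1)%N -> (sec l n).1 <= 0.
  by move=> hl; rewrite /sec /= hmx; have := @midx_ge l; lia.
(* Both ends have abscissa -1 in doubled coordinates, so the secant between them is vertical. *)
have : Theta 0 n = 2 \/ Theta 0 n = -2.
  have := Theta_mod n0 (leqnn _); have := sec_nz n0 (leqnn n).
  rewrite /nz /sec /= hmx midx0; move: hT; set u := _ - _; set Y := _ - _.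
  have -> : u = 0 by [].
  by case: angP => *; lia.
have key m : (m %% 8)%Z = 4 -> m - 2 <= Theta 0 n <= m + 2 ->
    m - 2 <= d n.-1 + d n <= m + 2.
  move=> hm h0n; have := @Theta_col_half m n.-1 n hn1 (leqnn _) h0n.
  rewrite Theta_last //; apply=> l /hl h; apply: Or43; split=> //.
case=> h0n; [left|right].
  by have := key 4 erefl; rewrite h0n; move: hd; case: (tzP (e n.-1)) => ->; lia.
by have := key (-4) erefl; rewrite h0n; move: hd; case: (tzP (e n.-1)) => ->; lia.
Qed.

Lemma exit_top : (0 < n)%N -> (forall i, (i < n)%N -> y i < y n) -> d n = 1.
Proof.
move=> n0 hn; have hn1 : (n.-1 < n)%N by lia.
have E : n.-1.+1 = n by lia.
have := hn _ hn1; have := y_step hn1; have := d_step hn1; rewrite E => hd hy hlt.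
have hdn : (d n %% 4)%Z = 1 /\ y n = y n.-1 + 1.
  by move: hy hlt; case: (dirP (d n)) => -[h _ ->]; lia.
have hmy : midy n = 2 * y n - 1.
  by rewrite /midy; case: hdn; case: (dirP (d n)) => -[h _ ->]; lia.
have hl l : (l <= n.-1)%N -> 0 <= (sec l n).2 /\ (l = 0%N -> 0 < (sec l n).2).
  case: l => [|l] hl; rewrite /sec /= hmy.
    rewrite /midy start_d (_ : ey 0 = 0) // start_y.
    by have := hn _ n0; rewrite start_y; lia.
  have hl' : (l < n)%N by lia.
  have [_ ->] := exit_mid hl'; have := hn _ hl'.
  by case: (dirP (d l.+1 + 2)) => -[_ _ ->]; lia.
have hT := Theta0_half n0 (leqnn _).
(* The secant from start to end also points strictly upwards, which leaves half of the interval. *)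
have h0n : 0 <= Theta 0 n <= 2.
  have := Theta_mod n0 (leqnn _); have [_ /(_ erefl)] := hl 0%N isT.
  have : 0 <= (sec 0 n).1 by rewrite /sec /= midx0; have := midx_ge (leqnn n); lia.
  by move: hT; case: angP => *; lia.
have : 2 - 2 <= Theta n.-1 n <= 2 + 2.
  apply: (@Theta_col_half 2 n.-1 n hn1 (leqnn _)); first by lia.
  by move=> l /hl[h _]; apply: Or42; split.
rewrite Theta_last //; case: hdn => hm _.
by move: hd; case: (tzP (e n.-1)) => ->; lia.
Qed.

Lemma exit_bottom : (0 < n)%N -> (forall i, (i < n)%N -> y n < y i) -> d n = -1.
Proof.
move=> n0 hn; have hn1 : (n.-1 < n)%N by lia.
have E : n.-1.+1 = n by lia.
have := hn _ hn1; have := y_step hn1; have := d_step hn1; rewrite E => hd hy hlt.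
have hdn : (d n %% 4)%Z = 3 /\ y n = y n.-1 - 1.
  by move: hy hlt; case: (dirP (d n)) => -[h _ ->]; lia.
have hmy : midy n = 2 * y n + 1.
  by rewrite /midy; case: hdn; case: (dirP (d n)) => -[h _ ->]; lia.
have hl l : (l <= n.-1)%N -> (sec l n).2 <= 0 /\ (l = 0%N -> (sec l n).2 < 0).
  case: l => [|l] hl; rewrite /sec /= hmy.
    rewrite /midy start_d (_ : ey 0 = 0) // start_y.
    by have := hn _ n0; rewrite start_y; lia.
  have hl' : (l < n)%N by lia.
  have [_ ->] := exit_mid hl'; have := hn _ hl'.
  by case: (dirP (d l.+1 + 2)) => -[_ _ ->]; lia.
have hT := Theta0_half n0 (leqnn _).
have h0n : -2 <= Theta 0 n <= 0.
  have := Theta_mod n0 (leqnn _); have [_ /(_ erefl)] := hl 0%N isT.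
  have : 0 <= (sec 0 n).1 by rewrite /sec /= midx0; have := midx_ge (leqnn n); lia.
  by move: hT; case: angP => *; lia.
have : -2 - 2 <= Theta n.-1 n <= -2 + 2.
  apply: (@Theta_col_half (-2) n.-1 n hn1 (leqnn _)); first by lia.
  by move=> l /hl[h _]; apply: Or44; split.
rewrite Theta_last //; case: hdn => hm _.
by move: hd; case: (tzP (e n.-1)) => ->; lia.
Qed.

(** * The turning of a loop *)

Section Loop.
Variable k : nat.
Hypothesis k_lt : (k < n)%N.
Hypothesis xk : x k = x n.
Hypothesis yk : y k = y n.

Lemma not_revisited i : (i < n)%N -> i != k -> ~ (x i = x k /\ y i = y k).
Proof.
move=> hi ne [hx hy].
have [h|h] : (i < k)%N \/ (k < i)%N by lia.
  by apply: (@no_third_visit i k n); rewrite ?hx ?hy.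
by apply: (@no_third_visit k i n); rewrite ?hx ?hy.
Qed.

(** The exit of the first visit and the entry of the second are joined by a chord of the rhombus,
    which closes the loop; [f] is the turn of this fictitious passage. *)
Lemma chord_turn_exists : exists f : turn, ((d n - d k.+1 - tz f) %% 4)%Z = 0.
Proof.
have := exit_entry_distinct k_lt (leqnn n) xk yk => h.
have [h0|[h0|h0]] : ((d n - d k.+1) %% 4 = 0 \/ (d n - d k.+1) %% 4 = 1 \/
  (d n - d k.+1) %% 4 = 3)%Z by lia.
- by exists None; rewrite /=; lia.
- by exists (Some true); rewrite /=; lia.
- by exists (Some false); rewrite /=; lia.
Qed.

Lemma short_loop : (k.+2 < n)%N.
Proof.
have hk1 : k.+1 <> n.
  move=> E; apply: (step_neq k_lt); rewrite ?E ?xk ?yk //.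
suff : k.+2 <> n by lia.
move=> E; have hk1n : (k.+1 < n)%N by lia.
have := x_step k_lt; have := y_step k_lt.
have := x_step hk1n; have := y_step hk1n; rewrite E -xk -yk.
have := exit_entry_distinct k_lt (leqnn n) xk yk.
by case: (dirP (d k.+1)) => -[h -> ->]; case: (dirP (d n)) => -[h' -> ->]; lia.
Qed.

(** Flatness against the closing chord. At the times [k] and [k.+1] a secant would vanish. *)
Lemma loop_flat i : (i < n)%N -> (i.+1 < n)%N -> i != k -> i != k.+1 ->
  dltp (sec i k.+1) (sec i n) + dltp (sec i n) (sec i.+1 n) =
  dltp (sec i k.+1) (sec i.+1 k.+1) + dltp (sec i.+1 k.+1) (sec i.+1 n).
Proof.
move=> hi hi1 ik ik1; have [f hf] := chord_turn_exists.
apply: (@flat_secants (x k - x i) (y k - y i) (d i) (d k.+1 + 2) (e i) f).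
- have [e1 e2] := exit_mid k_lt.
  rewrite /sec e1 e2 (midx_step hi) (midy_step hi) /secants.
  have e3 : (d k.+1 + 2 + tz f = d n + 2 + 4 * (- ((d n - d k.+1 - tz f) %/ 4)%Z)).
    by lia.
  rewrite e3 exD4 eyD4 /midx /midy -xk -yk.
  have -> : ex (d n + 2) = - ex (d n).
    by case: (dirP (d n)) => -[h -> _]; case: (dirP (d n + 2)) => -[h' -> _]; lia.
  have -> : ey (d n + 2) = - ey (d n).
    by case: (dirP (d n)) => -[h _ ->]; case: (dirP (d n + 2)) => -[h' _ ->]; lia.
  congr [:: (_, _); (_, _); (_, _); (_, _)]; ring.
- have [h|h] : (i < k.+1)%N \/ (k.+1 < i)%N by lia.
    by apply: sec_nz; lia.
  by apply: sec_nz'; lia.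
- by apply: sec_nz; lia.
- by apply: sec_nz; lia.
- have [h|h] : (i.+1 < k.+1)%N \/ (k.+1 < i.+1)%N by lia.
    by apply: sec_nz; lia.
  by apply: sec_nz'; lia.
- case=> h1 h2 _; apply: (@not_revisited i) => //; lia.
Qed.

Lemma Theta_before i : (i <= k)%N ->
  Theta i n = Theta i k.+1 + dltp (sec i k.+1) (sec i n).
Proof.
have sl := short_loop.
elim: i => [|i IH] hi.
  (* Both values of [Theta] lie in [-2, 2] and [dlt] is at most 2 in absolute value, so the two
     sides, equal modulo 8, are equal. Here the position of the start enters. *)
  have h1 := @Theta0_half k.+1 isT k_lt; have n0 : (0 < n)%N by lia.
  have h2 := Theta0_half n0 (leqnn n).
  have m1 := Theta_mod (isT : (0 < k.+1)%N) k_lt.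
  have m2 := Theta_mod n0 (leqnn n).
  have [f hf] := chord_turn_exists.
  have hk : king (sec 0 k.+1).1 (sec 0 k.+1).2 (sec 0 n).1 (sec 0 n).2.
    split; [exact: sec_nz|exact: sec_nz| | | ].
    - by have := mid_parity k_lt; have := mid_parity (leq0n n); rewrite /sec /=; lia.
    - by have := mid_parity (leqnn n); have := mid_parity (leq0n n); rewrite /sec /=; lia.
    - have [e1 e2] := exit_mid k_lt; rewrite /sec /= e1 e2 /midx /midy xk yk.
      have := exit_entry_distinct k_lt (leqnn n) xk yk.
      case: (dirP (d k.+1 + 2)) => -[h -> ->]; case: (dirP (d n)) => -[h' -> ->]; lia.
  have := dlt_small hk; have := dlt_mod (sec 0 k.+1).1 (sec 0 k.+1).2 (sec 0 n).1 (sec 0 n).2.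
  move: h1 h2 m1 m2; rewrite /dltp; clear.
  move: (ang _ _) (ang _ _) (dlt _ _ _ _) => A B C; lia.
have hin : (i < n)%N by lia.
have -> : Theta i.+1 n = Theta i n + dltp (sec i n) (sec i.+1 n).
  by apply: Theta_col; lia.
have -> : Theta i.+1 k.+1 = Theta i k.+1 + dltp (sec i k.+1) (sec i.+1 k.+1).
  by apply: Theta_col; lia.
rewrite IH; last by lia.
have hin1 : (i.+1 < n)%N by lia.
have ik : i != k by lia. have ik1 : i != k.+1 by lia.
have := loop_flat hin hin1 ik ik1; clear.
move: (dltp _ _) (dltp _ _) (dltp _ _) (dltp _ _) => *; lia.
Qed.

Lemma dltp_rev i j l : (i < j)%N -> (j < n)%N -> (i < l)%N -> (l <= n)%N ->
  dltp (sec i j) (sec i l) = dltp (sec j i) (sec l i).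
Proof.
move=> ij jn il ln; have h1 : nz (sec i j) by apply: sec_nz; lia.
have h2 : nz (sec i l) by apply: sec_nz; lia.
rewrite /dltp -dltN // /sec /= ; congr dlt; lia.
Qed.

(** The left side does not depend on [i]: one step along the loop changes the secants to the two
    ends of the closing chord by amounts that [loop_flat] compares. *)
Lemma Theta_after i : (k.+2 <= i)%N -> (i < n)%N ->
  Theta i n - Theta k.+1 i - dltp (sec i k.+1) (sec i n) =
  Theta k.+2 n - Theta k.+1 k.+2 - dltp (sec k.+2 k.+1) (sec k.+2 n).
Proof.
elim: i => [//|i IH] h1 h2.
have [E|ne] := eqVneq i k.+1; first by rewrite E.
rewrite -IH; [|lia|lia].
have -> : Theta i.+1 n = Theta i n + dltp (sec i n) (sec i.+1 n).
  by apply: Theta_col; lia.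
have -> : Theta k.+1 i.+1 = Theta k.+1 i + dltp (sec k.+1 i) (sec k.+1 i.+1).
  by apply: Theta_row; lia.
have -> : dltp (sec k.+1 i) (sec k.+1 i.+1) = dltp (sec i k.+1) (sec i.+1 k.+1).
  by apply: dltp_rev; lia.
have hin : (i < n)%N by lia. have ik : i != k by lia. 
have := loop_flat hin h2 ik ne; clear.
move: (dltp _ _) (dltp _ _) (dltp _ _) (dltp _ _) => *; lia.
Qed.

(** Following [Theta] around the triangle of times between [k] and [n] leaves only secants near its
    corners, collected in [loop_sum]. By the table a loop that begins with a left turn runs
    clockwise and one that begins with a right turn counterclockwise: the other sense would enclose
    the start. *)
Lemma loop_turning : (e k, d n - d k) \in loop_table.
Proof.
have sl := short_loop.
apply: (@loop_tableP _ _ _ (e k.+1) (e n.-1)).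
- by have := entry_distinct k_lt (leqnn n) xk yk; lia.
- have := exit_entry_distinct k_lt (leqnn n) xk yk.
  by rewrite (d_step k_lt); lia.
have n0 : (0 < n)%N by lia. have En : n.-1.+1 = n by lia.
have hn1 : (n.-1 < n)%N by lia. have hk1 : (k.+1 < n)%N by lia.
have tb := Theta_before (leqnn k).
have tc : Theta k.+1 n = Theta k n + dltp (sec k n) (sec k.+1 n).
  by apply: Theta_col; lia.
have td : Theta k.+2 n = Theta k.+1 n + dltp (sec k.+1 n) (sec k.+2 n).
  by apply: Theta_col; lia.
have th : Theta k.+1 n = Theta k.+1 n.-1 + dltp (sec k.+1 n.-1) (sec k.+1 n).
  have := @Theta_row k.+1 n.-1; rewrite En; apply; lia.
have tg : Theta n.-1 n - Theta k.+1 n.-1 - dltp (sec n.-1 k.+1) (sec n.-1 n) =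
  Theta k.+2 n - Theta k.+1 k.+2 - dltp (sec k.+2 k.+1) (sec k.+2 n).
  by apply: Theta_after; lia.
have ta := Theta_chord k; have te := Theta_chord k.+1.
have tl := Theta_last n0.
have dk := d_step k_lt; have dk1 := d_step hk1.
have dn := d_step hn1; rewrite En in dn.
have dn' : d n.-1 = d n - tz (e n.-1) by lia.
have exk := midx_step k_lt; have eyk := midy_step k_lt.
have exk1 := midx_step hk1; have eyk1 := midy_step hk1.
have exn := midx_step hn1; have eyn := midy_step hn1.
rewrite En -dn dn' in exn eyn. rewrite dk in exk1 eyk1.
have dxk : midx n - midx k = ex (d k) - ex (d n) by rewrite /midx xk; lia.
have dyk : midy n - midy k = ey (d k) - ey (d n) by rewrite /midy yk; lia.
rewrite /loop_sum.
set kk := (_, _); set kn := (_, _); set k1n := (_, _); set k2n := (_, _).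
set k2k := (_, _); set kn' := (_, _); set nk := (_, _); set nn := (_, _).
cbv zeta.
have -> : kk = sec k k.+1 by rewrite /kk /sec; congr (_, _); lia.
have -> : kn = sec k n by rewrite /kn /sec; congr (_, _); lia.
have -> : k1n = sec k.+1 n by rewrite /k1n /sec; congr (_, _); lia.
have -> : k2n = sec k.+2 n by rewrite /k2n /sec; congr (_, _); lia.
have -> : k2k = sec k.+2 k.+1 by rewrite /k2k /sec; congr (_, _); lia.
have -> : kn' = sec k.+1 n.-1 by rewrite /kn' /sec; congr (_, _); lia.
have -> : nk = sec n.-1 k.+1 by rewrite /nk /sec; congr (_, _); lia.
have -> : nn = sec n.-1 n by rewrite /nn /sec; congr (_, _); lia.
move: tb tc td th tg ta te tl dk dk1 dn'; clear.
move: (dltp _ _) (dltp _ _) (dltp _ _) (dltp _ _) (dltp _ _) (dltp _ _).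
move: (Theta _ _) (Theta _ _) (Theta _ _) (Theta _ _) (Theta _ _) (Theta _ _) (Theta _ _) => *.
lia.
Qed.
End Loop.
End Path.

(** * Words of turns *)

(* [Some true] for an arc of angle theta, [Some false] for one of angle
   pi - theta, [None] for a straight passage. *)
Definition kind (q : int) (e : turn) : option bool :=
  match e with
  | None => None
  | Some true => Some ((q %% 2)%Z == 1)
  | Some false => Some ((q %% 2)%Z == 0)
  end.

(* The only side of a rhombus left free by a walk that entered it in direction
   [q], made the turn [e] and came back in direction [q + c] is the one
   reached by the turn [last_turn e c]. *)
Definition last_turn (e : turn) (c : int) : turn :=
  match e with
  | None => None
  | Some true => if c == -2 then Some true else Some false
  | Some false => if c == 2 then Some false else Some true
  end.

(* The first turn of the walk that runs through the loop backwards. *)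
Definition loop_partner (x : turn * int) : turn * int :=
  match x.1 with
  | None => if x.2 == 3 then (Some true, -2) else (Some false, 2)
  | Some true => if x.2 == -2 then (None, 3) else (Some false, 3)
  | Some false => if x.2 == 2 then (None, -3) else (Some true, -3)
  end.

(* [((x, y), d)]: the walk enters the rhombus [(x, y)] in direction [d], which
   counts quarter turns and is not reduced modulo 4. *)
Definition state : Type := (int * int * int)%type.
Definition sx (s : state) : int := s.1.1.
Definition sy (s : state) : int := s.1.2.
Definition sd (s : state) : int := s.2.

Definition step (s : state) (e : turn) : state :=
  let d := sd s + tz e in ((sx s + ex d, sy s + ey d), d).
Definition run (s : state) (w : seq turn) : state := foldl step s w.
Definition mid (s : state) : int * int :=
  (2 * sx s - ex (sd s), 2 * sy s - ey (sd s)).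

Fixpoint mids (s : state) (w : seq turn) : seq (int * int) :=
  mid s :: (if w is e :: w' then mids (step s e) w' else [::]).

Definition label : Type := (int * int * option bool)%type.

Fixpoint labels (s : state) (w : seq turn) : seq label :=
  if w is e :: w' then (s.1, kind (sd s) e) :: labels (step s e) w' else [::].

Definition simple (s : state) (w : seq turn) : bool := uniq (mids s w).

Lemma run_cat s w w' : run s (w ++ w') = run (run s w) w'.
Proof. exact: foldl_cat. Qed.

Lemma run_rcons s w e : run s (rcons w e) = step (run s w) e.
Proof. by rewrite -cats1 run_cat. Qed.

Lemma labels_cat s w w' : labels s (w ++ w') = labels s w ++ labels (run s w) w'.
Proof. by elim: w s => [//|e w IH] s /=; rewrite IH. Qed.

Lemma mids_cat s w w' :
  mids s (w ++ w') = mids s w ++ behead (mids (run s w) w').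
Proof.
elim: w s => [|e w IH] s /=; first by case: w' => [|e w'].
by rewrite IH.
Qed.

Lemma labels_rcons s w e :
  labels s (rcons w e) = rcons (labels s w) ((run s w).1, kind (sd (run s w)) e).
Proof. by rewrite -!cats1 labels_cat. Qed.

Lemma mids_rcons s w e : mids s (rcons w e) = rcons (mids s w) (mid (run s (rcons w e))).
Proof. by rewrite -!cats1 mids_cat run_cat. Qed.

Lemma size_mids s w : size (mids s w) = (size w).+1.
Proof. by elim: w s => [//|e w IH] s /=; rewrite IH. Qed.

Lemma size_labels s w : size (labels s w) = size w.
Proof. by elim: w s => [//|e w IH] s /=; rewrite IH. Qed.

Lemma nth_mids z s w i : (i <= size w)%N ->
  nth z (mids s w) i = mid (run s (take i w)).
Proof.
elim: w s i => [|e w IH] s [|i] //= hi.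
by rewrite IH.
Qed.

Lemma nth_labels z s w i : (i < size w)%N -> nth z (labels s w) i =
  ((run s (take i w)).1, kind (sd (run s (take i w))) (nth None w i)).
Proof.
elim: w s i => [|e w IH] s [|i] //= hi.
by rewrite IH.
Qed.

Lemma run_take_next s w i : (i < size w)%N ->
  run s (take i.+1 w) = step (run s (take i w)) (nth None w i).
Proof. by move=> hi; rewrite (take_nth None hi) run_rcons. Qed.

Lemma mids_head s w : mids s w = mid s :: behead (mids s w).
Proof. by case: w. Qed.

Lemma simple_catl s w w' : simple s (w ++ w') -> simple s w.
Proof. by rewrite /simple mids_cat cat_uniq => /andP[]. Qed.

Lemma mid_run_last s w : mid (run s w) = last (mid s) (behead (mids s w)).
Proof.
have := @nth_mids (mid s) s w (size w) (leqnn _); rewrite take_size => <-.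
by rewrite -[size w]/((size w).+1.-1) -(size_mids s w) nth_last mids_head.
Qed.

Lemma simple_catr s w w' : simple s (w ++ w') -> simple (run s w) w'.
Proof.
rewrite /simple mids_cat cat_uniq => /and3P[_ h1 h2].
rewrite mids_head /= h2 andbT; apply: contra h1 => h1.
apply/hasP; exists (mid (run s w)) => //.
by rewrite mid_run_last mids_head mem_last.
Qed.

Lemma simple_neq s w i j : simple s w -> (i < j)%N -> (j <= size w)%N ->
  mid (run s (take i w)) != mid (run s (take j w)).
Proof.
move=> h ij hj; have hi : (i <= size w)%N by lia.
rewrite -(nth_mids (0, 0) s hi) -(nth_mids (0, 0) s hj) nth_uniq ?size_mids //.
  by lia.
Qed.

(** * Symmetries of the lattice acting on words *)

Section Isometry.
Variables (F : state -> state) (tau : turn -> turn).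
Variables (phi psi : int * int -> int * int).
Hypothesis F_step : forall s e, F (step s e) = step (F s) (tau e).
Hypothesis F_rhombus : forall s, (F s).1 = phi s.1.
Hypothesis F_mid : forall s, mid (F s) = psi (mid s).
Hypothesis F_kind : forall s e, kind (sd (F s)) (tau e) = kind (sd s) e.

Lemma run_isometry s w : run (F s) (map tau w) = F (run s w).
Proof. by elim: w s => [//|e w IH] s /=; rewrite -F_step IH. Qed.

Lemma mids_isometry s w : mids (F s) (map tau w) = map psi (mids s w).
Proof. by elim: w s => [|e w IH] s /=; rewrite ?F_mid // -F_step IH. Qed.

Lemma labels_isometry s w :
  labels (F s) (map tau w) = [seq (phi l.1, l.2) | l <- labels s w].
Proof. by elim: w s => [|e w IH] s //=; rewrite -F_step IH F_kind F_rhombus. Qed.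
End Isometry.

(** With [k] a multiple of 4, as below, only the lift of the direction changes and not the direction
    itself. *)
Definition translate (c : int * int) (k : int) (s : state) : state :=
  ((c.1 + sx s, c.2 + sy s), sd s + k).

Definition rotate (c : int * int) (k : int) (s : state) : state :=
  ((c.1 - sx s, c.2 - sy s), sd s + k).

(** This reflection fixes the diagonal through the corners of angle theta. It exchanges left and
    right turns and keeps the angles of arcs. *)
Definition swap (s : state) : state := ((sy s, sx s), 1 - sd s).
Definition topp (e : turn) : turn := omap negb e.

Lemma tz_topp e : tz (topp e) = - tz e.
Proof. by case: e => [[]|]. Qed.

Lemma toppK : involutive topp. Proof. by case=> [[]|]. Qed.

Lemma kind_add2 q k e : (k %% 2)%Z = 0 -> kind (q + k) e = kind q e.
Proof.
move=> hk; rewrite /kind; have -> // : ((q + k) %% 2)%Z = (q %% 2)%Z by lia.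
Qed.

Lemma ex_add4 q k : (k %% 4)%Z = 0 -> ex (q + k) = ex q.
Proof. by move=> hk; rewrite -(exD4 q (k %/ 4)%Z); congr ex; lia. Qed.
Lemma ey_add4 q k : (k %% 4)%Z = 0 -> ey (q + k) = ey q.
Proof. by move=> hk; rewrite -(eyD4 q (k %/ 4)%Z); congr ey; lia. Qed.
Lemma ex_add2 q k : (k %% 4)%Z = 2 -> ex (q + k) = - ex q.
Proof.
by move=> hk; case: (dirP q) => -[h -> _]; case: (dirP (q + k)) => -[h' -> _]; lia.
Qed.
Lemma ey_add2 q k : (k %% 4)%Z = 2 -> ey (q + k) = - ey q.
Proof.
by move=> hk; case: (dirP q) => -[h _ ->]; case: (dirP (q + k)) => -[h' _ ->]; lia.
Qed.
Lemma ex_swap q : ex (1 - q) = ey q.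
Proof. by case: (dirP q) => -[h _ ->]; case: (dirP (1 - q)) => -[h' -> _]; lia. Qed.
Lemma ey_swap q : ey (1 - q) = ex q.
Proof. by case: (dirP q) => -[h -> _]; case: (dirP (1 - q)) => -[h' _ ->]; lia. Qed.

Section Translate.
Variables (c : int * int) (k : int).
Hypothesis hk : (k %% 4)%Z = 0.
Let psi (z : int * int) := (2 * c.1 + z.1, 2 * c.2 + z.2).
Let phi (z : int * int) := (c.1 + z.1, c.2 + z.2).

Lemma translate_step s e : translate c k (step s e) = step (translate c k s) e.
Proof.
rewrite /translate /step /sx /sy /sd /= [s.2 + k + _]addrAC.
by rewrite (ex_add4 _ hk) (ey_add4 _ hk) !addrA.
Qed.

Lemma run_translate s w : run (translate c k s) w = translate c k (run s w).
Proof.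
rewrite -{1}(map_id w); apply: run_isometry => *; exact: translate_step.
Qed.

Lemma mids_translate s w : mids (translate c k s) w = map psi (mids s w).
Proof.
rewrite -{1}(map_id w); apply: mids_isometry => [*|]; first exact: translate_step.
move=> s'; rewrite /mid /psi /= /sx /sy /sd /= (ex_add4 _ hk) (ey_add4 _ hk).
by congr (_, _); ring.
Qed.

Lemma labels_translate s w :
  labels (translate c k s) w = [seq (phi l.1, l.2) | l <- labels s w].
Proof.
rewrite -{1}(map_id w).
apply: (@labels_isometry _ _ phi) => [*|//|]; first exact: translate_step.
by move=> s' e; apply: kind_add2; lia.
Qed.

Lemma simple_translate s w : simple (translate c k s) w = simple s w.
Proof.
rewrite /simple mids_translate map_inj_uniq // => -[a b] [a' b'] [] /addrI -> /addrI ->.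
by [].
Qed.
End Translate.

Section Rotate.
Variables (c : int * int) (k : int).
Hypothesis hk : (k %% 4)%Z = 2.
Let psi (z : int * int) := (2 * c.1 - z.1, 2 * c.2 - z.2).
Let phi (z : int * int) := (c.1 - z.1, c.2 - z.2).

Lemma rotate_step s e : rotate c k (step s e) = step (rotate c k s) e.
Proof.
rewrite /rotate /step /sx /sy /sd /= [s.2 + k + _]addrAC.
by rewrite (ex_add2 _ hk) (ey_add2 _ hk) !opprD !addrA.
Qed.

Lemma run_rotate s w : run (rotate c k s) w = rotate c k (run s w).
Proof.
rewrite -{1}(map_id w); apply: run_isometry => *; exact: rotate_step.
Qed.

Lemma labels_rotate s w :
  labels (rotate c k s) w = [seq (phi l.1, l.2) | l <- labels s w].
Proof.
rewrite -{1}(map_id w).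
apply: (@labels_isometry _ _ phi) => [*|//|]; first exact: rotate_step.
by move=> s' e; apply: kind_add2; lia.
Qed.

Lemma simple_rotate s w : simple (rotate c k s) w = simple s w.
Proof.
rewrite /simple -{1}(map_id w) (@mids_isometry _ _ psi).
- rewrite map_inj_uniq // => -[a b] [a' b'] [] h1 h2.
  by congr (_, _); [move: h1|move: h2]; lia.
- exact: rotate_step.
- move=> s'; rewrite /mid /psi /= /sx /sy /sd /= (ex_add2 _ hk) (ey_add2 _ hk).
  by congr (_, _); ring.
Qed.
End Rotate.

Lemma swap_step s e : swap (step s e) = step (swap s) (topp e).
Proof.
rewrite /swap /step /sx /sy /sd /= tz_topp.
have -> : 1 - s.2 - tz e = 1 - (s.2 + tz e) by ring.
by rewrite ex_swap ey_swap.
Qed.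

Lemma kind_swap q e : kind (1 - q) (topp e) = kind q e.
Proof.
by case: e => [[]|] //=; congr Some; apply/eqP/eqP; lia.
Qed.

Lemma labels_swap s w : labels (swap s) (map topp w) =
  [seq ((l.1.2, l.1.1), l.2) | l <- labels s w].
Proof.
apply: (@labels_isometry _ _ (fun z => (z.2, z.1))) => //; first exact: swap_step.
by move=> s' e; apply: kind_swap.
Qed.

Lemma simple_swap s w : simple (swap s) (map topp w) = simple s w.
Proof.
rewrite /simple (@mids_isometry _ _ (fun z => (z.2, z.1))).
- by rewrite map_inj_uniq // => -[a b] [a' b'] [-> ->].
- exact: swap_step.
- by move=> s'; rewrite /mid /swap /sx /sy /sd /= ex_swap ey_swap.
Qed.

(* The same midpoint, crossed in the other direction. *)
Definition turn_back (s : state) : state :=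
  ((sx s - ex (sd s), sy s - ey (sd s)), sd s + 2).

Definition rev_word (w : seq turn) : seq turn := rev (map topp w).

Lemma rev_wordK : involutive rev_word.
Proof. by move=> w; rewrite /rev_word map_rev revK -map_comp (eq_map toppK) map_id. Qed.

Lemma size_rev_word w : size (rev_word w) = size w.
Proof. by rewrite size_rev size_map. Qed.

Lemma rev_word_cons e w : rev_word (e :: w) = rcons (rev_word w) (topp e).
Proof. by rewrite /rev_word /= rev_cons. Qed.

Lemma step_back s e : step (turn_back (step s e)) (topp e) = turn_back s.
Proof.
rewrite /turn_back /step /sx /sy /sd /= tz_topp.
have -> : s.2 + tz e + 2 - tz e = s.2 + 2 by ring.
by rewrite !addrK ex_add2 // ey_add2.
Qed.

Lemma mid_back s : mid (turn_back s) = mid s.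
Proof.
rewrite /mid /turn_back /sx /sy /sd /= ex_add2 // ey_add2 //.
by congr (_, _); ring.
Qed.

Lemma run_back s w : run (turn_back (run s w)) (rev_word w) = turn_back s.
Proof.
elim: w s => [//|e w IH] s; rewrite rev_word_cons run_rcons /= IH.
exact: step_back.
Qed.

Lemma mids_back s w : mids (turn_back (run s w)) (rev_word w) = rev (mids s w).
Proof.
elim: w s => [|e w IH] s /=; first by rewrite mid_back.
rewrite rev_word_cons mids_rcons run_rcons /= IH run_back step_back mid_back.
by rewrite rev_cons.
Qed.

Lemma labels_back s w : labels (turn_back (run s w)) (rev_word w) = rev (labels s w).
Proof.
elim: w s => [//|e w IH] s; rewrite rev_word_cons labels_rcons /= IH run_back.
rewrite rev_cons; congr rcons; congr (_, _).
  by rewrite /turn_back /step /sx /sy /sd /= !addrK; case: (s.1).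
rewrite /turn_back /step /sd /=.
by case: e => [[]|] //=; congr Some; apply/eqP/eqP; lia.
Qed.

Lemma simple_back s w : simple (turn_back (run s w)) (rev_word w) = simple s w.
Proof. by rewrite /simple mids_back rev_uniq. Qed.

(** * Loops and their reversal *)

Definition origin : state := ((0, 0), 0).
Definition visits (s : state) (w : seq turn) : seq (int * int) :=
  map fst (labels s w).
Definition at_time (s : state) (w : seq turn) (i : nat) : state := run s (take i w).

Lemma size_visits s w : size (visits s w) = size w.
Proof. by rewrite size_map size_labels. Qed.

Lemma nth_visits z s w i : (i < size w)%N ->
  nth z (visits s w) i = (at_time s w i).1.
Proof.
move=> hi; rewrite (nth_map (z, None)) ?size_labels //.
by rewrite nth_labels.
Qed.

Lemma at_time_size s w : at_time s w (size w) = run s w.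
Proof. by rewrite /at_time take_size. Qed.

Lemma at_time0 s w : at_time s w 0 = s.
Proof. by rewrite /at_time take0. Qed.

Lemma visitsP s w r :
  reflect (exists2 i, (i < size w)%N & (at_time s w i).1 = r) (r \in visits s w).
Proof.
apply: (iffP (nthP (0, 0))) => -[i]; rewrite ?size_visits => hi h.
  by exists i => //; rewrite -(nth_visits (0, 0) s hi).
by exists i; rewrite ?size_visits // (nth_visits (0, 0) s hi).
Qed.

Lemma midsP s w z :
  reflect (exists2 i, (i <= size w)%N & mid (at_time s w i) = z) (z \in mids s w).
Proof.
apply: (iffP (nthP (0, 0))) => -[i]; rewrite ?size_mids ?ltnS => hi h.
  by exists i => //; rewrite -h (nth_mids (0, 0) s hi).
by exists i; rewrite ?size_mids ?ltnS // (nth_mids (0, 0) s hi).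
Qed.

(** Only the earlier passage is constrained: in a simple walk a straight passage and an arc of one
    rhombus would share a side, so the later one turns as well. *)
Definition crossing_free (s : state) (w : seq turn) : Prop :=
  forall i j, (i < j)%N -> (j < size w)%N ->
    (at_time s w i).1 = (at_time s w j).1 -> nth None w i <> None.

Section Word.
Variables (s : state) (w : seq turn).
Let x i := sx (at_time s w i).
Let y i := sy (at_time s w i).
Let d i := sd (at_time s w i).
Let e i := nth None w i.

Lemma word_d i : (i < size w)%N -> d i.+1 = d i + tz (e i).
Proof. by move=> hi; rewrite /d /at_time run_take_next. Qed.
Lemma word_x i : (i < size w)%N -> x i.+1 = x i + ex (d i.+1).
Proof. by move=> hi; rewrite /x /d /at_time run_take_next. Qed.
Lemma word_y i : (i < size w)%N -> y i.+1 = y i + ey (d i.+1).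
Proof. by move=> hi; rewrite /y /d /at_time run_take_next. Qed.
Lemma word_distinct : simple s w -> forall i j, (i < j)%N -> (j <= size w)%N ->
  ~ (midx x d i = midx x d j /\ midy y d i = midy y d j).
Proof.
move=> hw i j ij hj; have := simple_neq hw ij hj; rewrite -/(at_time s w i) -/(at_time s w j).
by rewrite /midx /midy => /eqP h [h1 h2]; apply: h; rewrite /mid; congr (_, _).
Qed.
Lemma word_crossing : crossing_free s w -> forall i j, (i < j)%N -> (j < size w)%N ->
  x i = x j -> y i = y j -> e i <> None.
Proof.
move=> h i j ij hj hx hy; apply: (h i j) => //; exact: injective_projections.
Qed.

Lemma rhombus_eq i j : (at_time s w i).1 = (at_time s w j).1 -> x i = x j /\ y i = y j.
Proof. by rewrite /x /y /sx /sy => ->. Qed.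

Lemma word_third_visit i j l : simple s w -> (i < j)%N -> (j < l)%N ->
  (l <= size w)%N -> (at_time s w i).1 = (at_time s w l).1 ->
  (at_time s w j).1 = (at_time s w l).1 -> False.
Proof.
move=> hw ij jl hl /rhombus_eq[h1 h2] /rhombus_eq[h3 h4].
exact: (no_third_visit word_d word_x word_y (word_distinct hw) ij jl hl).
Qed.
End Word.

Section FromOrigin.
Variable (w : seq turn).
Hypothesis w_simple : simple origin w.
Hypothesis w_cross : crossing_free origin w.
Hypothesis w_right : forall r, r \in visits origin w -> 0 <= r.1.

Let x_ge0 i : (i < size w)%N -> 0 <= sx (at_time origin w i).
Proof. by move=> hi; apply: w_right; apply/visitsP; exists i. Qed.

Let in_visits i : (i < size w)%N -> (at_time origin w i).1 \in visits origin w.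
Proof. by move=> hi; apply/visitsP; exists i. Qed.

Lemma word_exit_right : (0 < size w)%N ->
  (forall r, r \in visits origin w -> r.1 < sx (run origin w)) ->
  sd (run origin w) = 0.
Proof.
move=> n0 h; rewrite -at_time_size.
apply: (exit_right (@word_d _ _) (@word_x _ _) (@word_y _ _)
  (word_distinct w_simple) (word_crossing w_cross)); rewrite ?at_time0 //.
by move=> i hi; rewrite at_time_size; apply/h/in_visits.
Qed.

Lemma word_exit_left : (0 < size w)%N -> sx (run origin w) = -1 ->
  sd (run origin w) = 2 \/ sd (run origin w) = -2.
Proof.
rewrite -at_time_size => n0 h.
apply: (exit_left (@word_d _ _) (@word_x _ _) (@word_y _ _)
  (word_distinct w_simple) (word_crossing w_cross)); by rewrite ?at_time0.
Qed.

Lemma word_exit_top : (0 < size w)%N ->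
  (forall r, r \in visits origin w -> r.2 < sy (run origin w)) ->
  sd (run origin w) = 1.
Proof.
move=> n0 h; rewrite -at_time_size.
apply: (exit_top (@word_d _ _) (@word_x _ _) (@word_y _ _)
  (word_distinct w_simple) (word_crossing w_cross)); rewrite ?at_time0 //.
by move=> i hi; rewrite at_time_size; apply/h/in_visits.
Qed.

Lemma word_exit_bottom : (0 < size w)%N ->
  (forall r, r \in visits origin w -> sy (run origin w) < r.2) ->
  sd (run origin w) = -1.
Proof.
move=> n0 h; rewrite -at_time_size.
apply: (exit_bottom (@word_d _ _) (@word_x _ _) (@word_y _ _)
  (word_distinct w_simple) (word_crossing w_cross)); rewrite ?at_time0 //.
by move=> i hi; rewrite at_time_size; apply/h/in_visits.
Qed.

Lemma word_loop k : (k < size w)%N ->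
  (at_time origin w k).1 = (run origin w).1 ->
  (nth None w k, sd (run origin w) - sd (at_time origin w k)) \in loop_table.
Proof.
move=> hk; rewrite -at_time_size => /rhombus_eq[hx hy].
by apply: (loop_turning (@word_d _ _) (@word_x _ _) (@word_y _ _)
  (word_distinct w_simple) (word_crossing w_cross)); rewrite ?at_time0.
Qed.
End FromOrigin.

Lemma mid_eq s s' : mid s = mid s' ->
  (s.1 = s'.1 /\ ((sd s - sd s') %% 4)%Z = 0) \/
  (s.1 = (turn_back s').1 /\ ((sd s - sd s') %% 4)%Z = 2).
Proof.
case: s s' => [[x y] d] [[x' y'] d']; rewrite /mid /turn_back /sx /sy /sd /= => -[].
case: (dirP d) => -[h -> ->]; case: (dirP d') => -[h' -> ->] h1 h2;
 try (exfalso; lia); try (left; split; [congr (_, _); lia|lia]);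
 (right; split; [congr (_, _); lia|lia]).
Qed.

Lemma mid_same_dir s s' : s.1 = s'.1 -> ((sd s - sd s') %% 4)%Z = 0 -> mid s = mid s'.
Proof.
move=> h hd; rewrite /mid /sx /sy h (_ : sd s = sd s' + 4 * ((sd s - sd s') %/ 4)%Z).
  by rewrite exD4 eyD4.
by lia.
Qed.

Lemma prev_rhombus s w j : (j < size w)%N ->
  (at_time s w j).1 = (turn_back (at_time s w j.+1)).1.
Proof.
move=> hj; rewrite /at_time run_take_next // /turn_back /step /sx /sy /sd /= !addrK.
by rewrite -surjective_pairing.
Qed.

(** A repeated midpoint is a side of the current rhombus: the entry or exit side of an earlier
    visit, or the start reached from the rhombus behind it. From [origin] that rhombus is in column
    -1. *)
Lemma mid_new_step s w e i : (i <= size w)%N ->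
  mid (at_time s w i) = mid (step (run s w) e) ->
  [\/ (i < size w)%N /\ (at_time s w i).1 = (run s w).1,
      [/\ i = 0%N, s.1 = (step (run s w) e).1 & ((sd s - (sd (run s w) + tz e)) %% 4)%Z = 0] |
      exists2 j, i = j.+1 & (at_time s w j).1 = (run s w).1].
Proof.
move=> hi /mid_eq.
have back : (turn_back (step (run s w) e)).1 = (run s w).1.
  by rewrite /turn_back /step /sx /sy /sd /= !addrK -surjective_pairing.
rewrite back; case=> -[h hd].
  case: i hi h hd => [|j] hi h hd.
    by rewrite at_time0 in h hd; apply: Or32.
  apply: Or33; exists j => //; rewrite prev_rhombus // -back /turn_back.
  move: h hd; rewrite /sx /sy; move: (at_time s w j.+1) => t h hd; rewrite h.
  rewrite (_ : sd t = sd (step (run s w) e) + 4 * ((sd t - sd (step (run s w) e)) %/ 4)%Z).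
    by rewrite exD4 eyD4.
  by lia.
have [hlt|hge] := ltnP i (size w); first by apply: Or31.
have E : i = size w by lia.
move: hd; rewrite E at_time_size /step /sd /=.
by case: (tzP e) => ->; lia.
Qed.

Lemma simple_rcons s w e :
  simple s (rcons w e) = simple s w && (mid (step (run s w) e) \notin mids s w).
Proof. by rewrite /simple mids_rcons rcons_uniq run_rcons andbC. Qed.

Lemma simple_new_rhombus w e : simple origin w -> (run origin w).1 \notin visits origin w ->
  0 <= sx (run origin w) -> simple origin (rcons w e).
Proof.
move=> hw hnew h0; rewrite simple_rcons hw; apply/negP => /midsP[i hi].
move=> /(mid_new_step hi)[[hlt h]|[_ h hd]|[j E h]].
- by move/negP: hnew; apply; apply/visitsP; exists i.
- move: h h0 hd; rewrite /step /origin /sx /sy /sd /=; set d := _ + tz e.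
  by case: (dirP d) => -[hm -> ->] [? ?]; lia.
- by move/negP: hnew; apply; apply/visitsP; exists j => //; lia.
Qed.

(** The two congruences describe an exit through the side of the first entry and one through the
    side of the first exit. *)
Lemma last_turn_check : all (fun x => all (fun f =>
    ~~ ((((x.2 + tz f - 2) %% 4)%Z == 0) || (((x.2 + tz f - tz x.1) %% 4)%Z == 0))
      == (f == last_turn x.1 x.2)) turns) loop_table.
Proof. by vm_compute. Qed.

(** The first expression is the change of lift between entering the loop backwards by the turn [y.1]
    and turning round at its end; the two cross the same midpoint in the same direction. *)
Lemma loop_partner_check : all (fun x => let y := loop_partner x in
    [&& ((tz y.1 - x.2 - 2) %% 4)%Z == 0, y.2 == tz x.1 + tz y.1 - x.2,
        y \in loop_table & loop_partner y == x]) loop_table.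
Proof. by vm_compute. Qed.

Section Revisit.
Variables (P l : seq turn) (e : turn).
Let w := P ++ e :: l.
Hypothesis w_simple : simple origin w.
Hypothesis w_start : 0 <= sx (run origin w).
Hypothesis back : (run origin P).1 = (run origin w).1.
Let c := sd (run origin w) - sd (run origin P).
Hypothesis c_table : (e, c) \in loop_table.

Let at_P : at_time origin w (size P) = run origin P.
Proof. by rewrite /at_time take_size_cat. Qed.

Let at_Pe : at_time origin w (size P).+1 = step (run origin P) e.
Proof.
rewrite /at_time /w -cat_rcons -(size_rcons P e) take_size_cat //.
by rewrite run_rcons.
Qed.

Let size_w : (size P < size w)%N.
Proof. by rewrite /w size_cat /=; lia. Qed.

Lemma visit_once i : (i < size w)%N -> (at_time origin w i).1 = (run origin w).1 ->
  i = size P.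
Proof.
move=> hi h; apply/eqP; apply: contraT => ne; exfalso.
rewrite -at_time_size in h.
have hP : (at_time origin w (size P)).1 = (at_time origin w (size w)).1.
  by rewrite at_P back at_time_size.
have [lt|gt] : (i < size P)%N \/ (size P < i)%N by lia.
  exact: (word_third_visit w_simple lt size_w (leqnn _) h hP).
exact: (word_third_visit w_simple gt hi (leqnn _) hP h).
Qed.

Lemma visits_before : (run origin w).1 \notin visits origin P.
Proof.
apply/negP => /visitsP[i hi h].
have E : at_time origin w i = at_time origin P i.
  by rewrite /at_time /w takel_cat // ltnW.
by have := @visit_once i; rewrite E h => /(_ _ erefl); lia.
Qed.

Lemma visits_after : (run origin w).1 \notin visits (step (run origin P) e) l.
Proof.
apply/negP => /visitsP[i hi h].
have E : at_time origin w ((size P).+1 + i) = at_time (step (run origin P) e) l i.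
  rewrite /at_time /w -cat_rcons take_cat size_rcons ltnNge leq_addr /=.
  by rewrite addKn run_cat run_rcons.
have := @visit_once ((size P).+1 + i); rewrite E h => /(_ _ erefl).
by rewrite /w size_cat /=; lia.
Qed.

Lemma simple_last_turn e' :
  simple origin (rcons w e') = (e' == last_turn e c).
Proof.
rewrite simple_rcons w_simple /=.
have hd' : sd (step (run origin w) e') = sd (run origin P) + c + tz e'.
  by rewrite /step /c /sd /=; ring.
have hd1 : sd (step (run origin P) e) = sd (run origin P) + tz e by [].
have key : mid (step (run origin w) e') \in mids origin w =
   (((c + tz e' - 2) %% 4)%Z == 0) || (((c + tz e' - tz e) %% 4)%Z == 0).
  apply/midsP/orP => [[i hi h]|].
    have h' := h; move/mid_new_step: h' => /(_ hi) [[hlt h1]|[i0 h1 hd]|[j E h1]].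
    - left; have E := visit_once hlt h1; rewrite E at_P in h.
      move/mid_eq: h => []; last first.
        by case=> _; rewrite hd' => hm; apply/eqP; lia.
      case=> h2 _; move: h2; rewrite back /step /sx /sy /= => h2; exfalso.
      move: h2; move: (sd _ + tz e') => d'.
      by case: (_.1) => x y [] /=; case: (dirP d') => -[_ -> ->]; lia.
    - exfalso; move: w_start hd h1; rewrite /step /origin /sx /sy /sd /=.
      by set d := _ + tz e'; case: (dirP d) => -[hm -> ->] ? ? [? ?]; lia.
    - right; have hj : (j < size w)%N by lia.
      have E' := visit_once hj h1; rewrite E E' at_Pe in h.
      move/mid_eq: h => [].
        by case=> _; rewrite hd' hd1 => hm; apply/eqP; lia.
      case=> h2 _; exfalso; move: h2; rewrite /turn_back /step /sx /sy /sd /= !addrK.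
      rewrite -back; move: (_ + tz e) => d' [].
      by case: (dirP d') => -[_ -> ->]; lia.
  case=> /eqP hm.
    exists (size P); first exact: ltnW.
    rewrite at_P -mid_back; apply: mid_same_dir.
      rewrite /turn_back /step /sx /sy /= -back.
      have [-> ->] : ex (sd (run origin w) + tz e') = - ex (sd (run origin P)) /\
          ey (sd (run origin w) + tz e') = - ey (sd (run origin P)).
        have -> : sd (run origin w) + tz e' = sd (run origin P) + (c + tz e').
          by rewrite /c; ring.
        by rewrite ex_add2 ?ey_add2; lia.
      by [].
    by rewrite hd' /turn_back /sd /= -/(sd (run origin P)); lia.
  exists (size P).+1 => //; rewrite at_Pe; apply: mid_same_dir; last first.
    by rewrite hd' hd1; lia.
  rewrite /step /sx /sy /= -back.
  have -> : sd (run origin w) + tz e' = sd (run origin P) + tz e + (c + tz e' - tz e).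
    by rewrite /c; ring.
  by rewrite (ex_add4 _ hm) (ey_add4 _ hm).
rewrite key; apply/eqP.
exact: (allP (allP last_turn_check _ c_table) _ (mem_turns e')).
Qed.

Let y := loop_partner (e, c).
Let w' := P ++ y.1 :: rev_word l.
Let k := tz y.1 - c - 2.

Let y_table : [/\ (k %% 4)%Z = 0, y.2 = tz e + tz y.1 - c, y \in loop_table &
  loop_partner y = (e, c)].
Proof. by have /and4P[/eqP ? /eqP ? ? /eqP ?] := allP loop_partner_check _ c_table. Qed.

Let back_state : step (run origin P) y.1 = translate (0, 0) k (turn_back (run origin w)).
Proof.
have [hk _ _ _] := y_table.
have hd : sd (run origin P) + tz y.1 = sd (run origin w) + (k + 2).
  by rewrite /k /c; ring.
have h2 : ((k + 2) %% 4)%Z = 2 by lia.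
rewrite /step /translate /turn_back /sx /sy /= hd -back !add0r.
by rewrite (ex_add2 _ h2) (ey_add2 _ h2) /sd /= [k + 2]addrC addrA.
Qed.

Let run_w : run origin w = run (step (run origin P) e) l.
Proof. by rewrite /w run_cat. Qed.

Let run_w' : run origin w' =
  translate (0, 0) k (turn_back (step (run origin P) e)).
Proof.
have [hk _ _ _] := y_table.
by rewrite /w' run_cat /= back_state run_w run_translate // run_back.
Qed.

Lemma partner_rhombus : (run origin w').1 = (run origin w).1.
Proof.
rewrite run_w' /translate /turn_back /step /sx /sy /sd /= !add0r !addrK -back.
by rewrite -surjective_pairing.
Qed.

Lemma partner_dir : sd (run origin w') = sd (run origin P) + y.2.
Proof.
have [_ -> _ _] := y_table.
by rewrite run_w' /translate /turn_back /step /sd /= /k; ring.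
Qed.

Let translate0_map (t : seq (int * int)) :
  map (fun z : int * int => (2 * 0 + z.1, 2 * 0 + z.2)) t = t.
Proof.
rewrite -[RHS]map_id; apply: eq_map => z.
by rewrite mulr0 !add0r -surjective_pairing.
Qed.

(** The partner passes the midpoints of the loop in the opposite order, so the set of midpoints is
    unchanged. *)
Lemma partner_simple : simple origin w'.
Proof.
have [hk _ _ _] := y_table.
have E : mids origin w' =
    mids origin P ++ rev (mids (step (run origin P) e) l).
  by rewrite /w' mids_cat /= back_state run_w mids_translate // translate0_map mids_back.
rewrite /simple E (perm_uniq (_ : perm_eq _ (mids origin w))) //.
by rewrite /w mids_cat /= perm_cat2l perm_rev.
Qed.

Lemma labels_partner : labels origin w' = labels origin P ++
  ((run origin w).1, kind (sd (run origin P)) y.1) ::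
  rev (labels (step (run origin P) e) l).
Proof.
have [hk _ _ _] := y_table.
rewrite /w' labels_cat /= back back_state run_w labels_translate // labels_back.
congr (_ ++ _ :: _); rewrite -[RHS]map_id; apply: eq_map => z.
by rewrite !add0r; case: z => [[a b] kk].
Qed.

Lemma partner_visits : perm_eq (visits origin w') (visits origin w).
Proof.
rewrite /visits labels_partner /w labels_cat /= back.
by rewrite !map_cat /= perm_cat2l perm_cons map_rev perm_rev.
Qed.

Lemma partner_labels_away :
  perm_eq [seq x <- labels origin w' | x.1 != (run origin w).1]
          [seq x <- labels origin w | x.1 != (run origin w).1].
Proof.
rewrite labels_partner [in labels _ w]/w labels_cat /= back !filter_cat /= eqxx /=.
by rewrite perm_cat2l filter_rev perm_rev.
Qed.

Lemma labels_here :
  [seq x.2 | x <- labels origin w & x.1 == (run origin w).1] =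
  [:: kind (sd (run origin P)) e].
Proof.
have away s v : (run origin w).1 \notin visits s v ->
    [seq x <- labels s v | x.1 == (run origin w).1] = [::].
  move=> h; apply/eqP; rewrite -size_eq0 size_filter eqn0Ngt -has_count.
  by apply: contra h => /hasP[x hx /eqP <-]; apply: map_f.
rewrite [in labels _ w]/w labels_cat /= filter_cat /= back eqxx.
by rewrite (away _ _ visits_before) (away _ _ visits_after).
Qed.

Lemma first_visit_at : index (run origin w).1 (visits origin w) = size P.
Proof.
rewrite [in visits _ w]/visits /w labels_cat map_cat index_cat.
rewrite -/(visits origin P) (negbTE visits_before) size_visits /= back eqxx.
by rewrite addn0.
Qed.
End Revisit.

Definition first_visit (w : seq turn) : nat :=
  index (run origin w).1 (visits origin w).

Definition loop_type (w : seq turn) : turn * int :=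
  (nth None w (first_visit w),
   sd (run origin w) - sd (at_time origin w (first_visit w))).

Definition returning (w : seq turn) : bool :=
  [&& simple origin w, 0 <= sx (run origin w),
      (run origin w).1 \in visits origin w & loop_type w \in loop_table].

Definition partner (w : seq turn) : seq turn :=
  take (first_visit w) w ++
  (loop_partner (loop_type w)).1 :: rev_word (drop (first_visit w).+1 w).

Lemma first_visit_lt w : (run origin w).1 \in visits origin w ->
  (first_visit w < size w)%N.
Proof. by rewrite -(size_visits origin) index_mem. Qed.

Lemma first_visit_split w : (run origin w).1 \in visits origin w ->
  w = take (first_visit w) w ++
      nth None w (first_visit w) :: drop (first_visit w).+1 w.
Proof. by move=> /first_visit_lt h; rewrite -drop_nth // cat_take_drop. Qed.

Lemma first_visit_rhombus w : (run origin w).1 \in visits origin w ->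
  (run origin (take (first_visit w) w)).1 = (run origin w).1.
Proof.
move=> h; have := first_visit_lt h => hlt.
by rewrite -[RHS](nth_index (0, 0) h) -/(first_visit w) nth_visits.
Qed.

Lemma returning_split w : returning w -> exists P e l,
  [/\ w = P ++ e :: l, simple origin (P ++ e :: l),
  0 <= sx (run origin (P ++ e :: l)),
  (run origin P).1 = (run origin (P ++ e :: l)).1 &
  (e, sd (run origin (P ++ e :: l)) - sd (run origin P)) \in loop_table].
Proof.
move=> /and4P[h1 h2 h3 h4]; have E := first_visit_split h3.
exists (take (first_visit w) w), (nth None w (first_visit w)).
exists (drop (first_visit w).+1 w).
by rewrite -E; split=> //; exact: first_visit_rhombus.
Qed.

Section Split.
Variables (P l : seq turn) (e : turn).
Let w := P ++ e :: l.
Hypothesis w_simple : simple origin w.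
Hypothesis w_start : 0 <= sx (run origin w).
Hypothesis back : (run origin P).1 = (run origin w).1.
Let c := sd (run origin w) - sd (run origin P).
Hypothesis c_table : (e, c) \in loop_table.

Lemma first_visit_catE : first_visit w = size P.
Proof. exact: first_visit_at. Qed.

Lemma loop_type_catE : loop_type w = (e, c).
Proof.
rewrite /loop_type first_visit_catE /at_time /w take_size_cat //.
by rewrite nth_cat ltnn subnn.
Qed.

Lemma returning_cat : returning w.
Proof.
apply/and4P; split=> //; last by rewrite loop_type_catE.
by rewrite /visits /w labels_cat map_cat mem_cat /= back inE eqxx orbT.
Qed.

Lemma partner_catE :
  partner w = P ++ (loop_partner (e, c)).1 :: rev_word l.
Proof.
rewrite /partner first_visit_catE loop_type_catE /w take_size_cat //.
by rewrite -(cat_rcons e) drop_size_cat ?size_rcons.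
Qed.
End Split.

(** Away from the last rhombus the labels agree, and the end and the first visit to it are the same.
    The two walks differ by the first turn and the total turning of the loop, which are what
    [ob_loop] compares. *)
Lemma partner_facts w : returning w ->
  [/\ returning (partner w), partner (partner w) = w, size (partner w) = size w &
    loop_type (partner w) = loop_partner (loop_type w)] /\
  [/\ (run origin (partner w)).1 = (run origin w).1,
    perm_eq (visits origin (partner w)) (visits origin w),
    at_time origin (partner w) (first_visit (partner w)) =
      at_time origin w (first_visit w) &
    perm_eq [seq x <- labels origin (partner w) | x.1 != (run origin w).1]
            [seq x <- labels origin w | x.1 != (run origin w).1]].
Proof.
move=> /returning_split[P [e [l [-> h1 h2 h3 h4]]]].
have := loop_partner_check => /allP/(_ _ h4)/and4P[_ _ hy /eqP hyy].
have hr := partner_rhombus h1 h2 h3 h4; have hd := partner_dir h1 h2 h3 h4.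
have hs := partner_simple h1 h2 h3 h4.
have hv := partner_visits h1 h2 h3 h4; have ha := partner_labels_away h1 h2 h3 h4.
rewrite (partner_catE h1 h2 h3 h4).
move: hr hd hs hv ha; set y := loop_partner _ => hr hd hs hv ha.
have h3' : (run origin P).1 = (run origin (P ++ y.1 :: rev_word l)).1.
  by rewrite hr.
have h2' : 0 <= sx (run origin (P ++ y.1 :: rev_word l)) by rewrite /sx hr.
have hc : sd (run origin (P ++ y.1 :: rev_word l)) - sd (run origin P) = y.2.
  by rewrite hd; ring.
have h4' : (y.1, sd (run origin (P ++ y.1 :: rev_word l)) - sd (run origin P))
    \in loop_table by rewrite hc -surjective_pairing.
split; split=> //.
- exact: (returning_cat hs h2' h3' h4').
- by rewrite (partner_catE hs h2' h3' h4') hc -surjective_pairing hyy rev_wordK.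
- by rewrite !size_cat /= size_rev_word.
- rewrite (loop_type_catE hs h2' h3' h4') (loop_type_catE h1 h2 h3 h4) hc.
  by rewrite -surjective_pairing.
- rewrite (first_visit_catE hs h2' h3' h4') (first_visit_catE h1 h2 h3 h4).
  by rewrite /at_time !take_size_cat.
Qed.

Lemma returning_labels_here w : returning w ->
  [seq x.2 | x <- labels origin w & x.1 == (run origin w).1] =
  [:: kind (sd (at_time origin w (first_visit w))) (loop_type w).1].
Proof.
move=> /returning_split[P [e [l [-> h1 h2 h3 h4]]]].
rewrite (labels_here h1 h2 h3 h4) (loop_type_catE h1 h2 h3 h4).
by rewrite (first_visit_catE h1 h2 h3 h4) /at_time take_size_cat.
Qed.

Lemma returning_simple_rcons w f : returning w ->
  simple origin (rcons w f) = (f == last_turn (loop_type w).1 (loop_type w).2).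
Proof.
move=> /returning_split[P [e [l [-> h1 h2 h3 h4]]]].
by rewrite (simple_last_turn h1 h2 h3 h4) (loop_type_catE h1 h2 h3 h4).
Qed.

From mathcomp Require Import all_classical all_reals all_analysis.
Import numFieldNormedType.Exports.

(** * The parafermionic observable *)

Definition wt1 (R : Type) (W : weights R) (k : option bool) : R :=
  match k with None => v W | Some true => u1 W | Some false => u2 W end.

(* Two crossing straight passages get weight 0. *)
Definition wt2 (R : realType) (W : weights R) (k : option bool) : R :=
  match k with None => 0 | Some true => w1 W | Some false => w2 W end.

(* [ob_visit] is conservation at the first visit of a rhombus; [ob_loop] says
   that the walks through a loop in the two directions cancel. *)
Record observable (R : realType) (W : weights R) (g : int -> R) : Prop :=
  Observable {
    ob_u1 : 0 < u1 W; ob_u2 : 0 < u2 W; ob_v : 0 < v W;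
    ob_w1 : 0 <= w1 W; ob_w2 : 0 <= w2 W;
    ob_w1_le : w1 W <= u1 W ^+ 2; ob_w2_le : w2 W <= u2 W ^+ 2;
    ob_right : g 0 = 1; ob_top : 0 <= g 1; ob_bottom : 0 <= g (-1);
    ob_left : 0 < g 2; ob_left' : g (-2) = g 2;
    ob_visit : forall q, g q = \sum_(e <- turns) wt1 W (kind q e) * g (q + tz e);
    ob_loop : forall q x, x \in loop_table ->
      let term x := wt1 W (kind q x.1) * g (q + x.2) -
        wt2 W (kind q x.1) * g (q + x.2 + tz (last_turn x.1 x.2)) in
      term x + term (loop_partner x) = 0
  }.

(** * Trigonometric identities behind the explicit weights *)

Section Trigonometry.
Variable R : realType.
Implicit Types (t al : R).

Let a : R := pi / 8.
Let C : R := cos a.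
Let h : R := sin (pi / 4).

Lemma cos_quarter : cos (pi / 4) = h.
Proof.
have -> : pi / 4 = - (pi / 4) + pi / 2 :> R by lra.
by rewrite cosDpihalf sinN opprK.
Qed.

Lemma sqr_quarter : h ^+ 2 = 1 / 2.
Proof. by have := cos2Dsin2 (pi / 4 : R); rewrite cos_quarter -/h; lra. Qed.

Lemma quarter_eighth : pi / 4 = a + a.
Proof. by rewrite /a; lra. Qed.

Lemma sin_eighth : sin a = (2 * h - 1) * C.
Proof.
have e1 := cos2Dsin2 a; have := cos_quarter.
have -> : h = 2 * (sin a * C) by rewrite /h quarter_eighth sinD -/C; lra.
rewrite quarter_eighth cosD -/C => e2.
have e3 : sin a * (2 * C ^+ 2) = sin a * (1 + 2 * (sin a * C)).
  by congr (_ * _); rewrite -/C in e1; lra.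
have e4 : C * (2 * sin a ^+ 2) = C * (1 - 2 * (sin a * C)).
  by congr (_ * _); rewrite -/C in e1; lra.
by lra.
Qed.

Lemma cos_3eighth : cos (3 * a) = (2 * h - 1) * C.
Proof.
rewrite -sin_eighth (_ : 3 * a = - a + pi / 2); last by rewrite /a; lra.
by rewrite cosDpihalf sinN opprK.
Qed.

Lemma sin_3eighth : sin (3 * a) = C.
Proof.
rewrite (_ : 3 * a = - a + pi / 2); last by rewrite /a; lra.
by rewrite sinDpihalf cosN.
Qed.

Lemma cos_6eighth : cos (6 * a) = - h.
Proof.
rewrite (_ : 6 * a = pi / 4 + pi / 2); last by rewrite /a; lra.
by rewrite cosDpihalf.
Qed.

Lemma sin_6eighth : sin (6 * a) = h.
Proof.
rewrite (_ : 6 * a = pi / 4 + pi / 2); last by rewrite /a; lra.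
by rewrite sinDpihalf cos_quarter.
Qed.

Definition trigE := (cosD, sinD, cosB, sinB, cosN, sinN, cos_3eighth, sin_3eighth,
  cos_6eighth, sin_6eighth, cos_quarter, sin_eighth).

Lemma sqr_sin t : sin t ^+ 2 = 1 - cos t ^+ 2.
Proof. by have := cos2Dsin2 t; lra. Qed.

(** [ob_visit] times the common denominator. Here and in the next three lemmas, the difference of
    the sides is an explicit combination of the relations for [h ^+ 2] and, where needed, for
    [sin t ^+ 2]. *)
Lemma trig_straight t al :
  sin (pi / 4 + t) * cos (a - t) * cos al =
  cos (a + t) * sin t * cos al + h * sin t * cos (al + 3 * a - t) +
  h * cos (a + t) * cos (al - t).
Proof.
rewrite !trigE -/C -/h; move: sqr_quarter.
set X := cos al; set Y := sin al; set c := cos t; set s := sin t => h2.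
apply/eqP; rewrite -subr_eq0; apply/eqP.
rewrite [LHS](_ : _ = (2 * s ^+ 2 * C * X + 2 * c * s * C * X) * (h ^+ 2 - 1 / 2)).
  by rewrite h2 subrr mulr0.
by field.
Qed.

(** For even directions this cancels the pair [(Some true, -2)], [(None, 3)] of the loop table, up
    to the factor [sin t]. [trig_loop1] serves [(Some false, 2)], [(None, -3)], and
    [trig_loop_across] serves [(Some true, -3)], [(Some false, 3)]. *)
Lemma trig_loop2 t al :
  h * cos (al - 3 * a) + cos (a + t) * cos (al + 6 * a - t) =
  sin (t - a) * cos (al - t).
Proof.
rewrite !trigE -/C -/h; move: sqr_quarter (sqr_sin t).
set X := cos al; set Y := sin al; set c := cos t; set s := sin t => h2 s2.
apply/eqP; rewrite -subr_eq0; apply/eqP.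
rewrite [LHS](_ : _ = (2 * C * X + 2 * s ^+ 2 * C * Y - 2 * s ^+ 2 * C * X
   + 2 * c * s * C * Y + 2 * c * s * C * X) * (h ^+ 2 - 1 / 2)
   + (- 1 * C * X - 1 * h * C * Y + 1 * h * C * X) * (s ^+ 2 - (1 - c ^+ 2))).
  by rewrite h2 s2 !subrr !mulr0 addr0.
by field.
Qed.

Lemma trig_loop1 t al :
  h * cos (al + 3 * a) + sin t * cos (al - 3 * a - t) =
  sin (pi / 4 - t) * cos (al + 3 * a - t).
Proof.
rewrite !trigE -/C -/h; move: sqr_quarter (sqr_sin t).
set X := cos al; set Y := sin al; set c := cos t; set s := sin t => h2 s2.
apply/eqP; rewrite -subr_eq0; apply/eqP.
rewrite [LHS](_ : _ = (2 * C * X + 2 * s ^+ 2 * C * Y - 2 * c * s * C * Y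
   + 2 * c * s * C * X - 2 * c ^+ 2 * C * X) * (h ^+ 2 - 1 / 2)
   + (- 1 * C * X + 1 * h * C * Y + 1 * h * C * X) * (s ^+ 2 - (1 - c ^+ 2))).
  by rewrite h2 s2 !subrr !mulr0 addr0.
by field.
Qed.

Lemma trig_loop_across t al :
  h * sin t * cos (al - 3 * a - t) + h * cos (a + t) * cos (al + 6 * a - t) =
  sin (t - a) * sin t * cos (al - 6 * a) +
  cos (a + t) * sin (pi / 4 - t) * cos (al + 6 * a).
Proof.
rewrite !trigE -/C -/h; move: sqr_quarter.
set X := cos al; set Y := sin al; set c := cos t; set s := sin t => h2.
apply/eqP; rewrite -subr_eq0; apply/eqP.
rewrite [LHS](_ : _ = (4 * s ^+ 2 * h * C * Y) * (h ^+ 2 - 1 / 2)).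
  by rewrite h2 subrr mulr0.
by field.
Qed.

(** The difference of the sides factors as h^2 cos(a + t) sin(t - a) sin(2t), and in [weight_sq2] as
    sin(t) sin(pi/4 - t) sin(6a - 2t) / 2; all factors are nonnegative. *)
Lemma weight_sq1 t : a <= t <= pi / 4 ->
  cos (a + t) * sin (pi / 4 - t) * (sin (pi / 4 + t) * cos (a - t)) <=
  (h * cos (a + t)) ^+ 2.
Proof.
move=> /andP[t1 t2]; have p := pi_gt0 R.
have ge1 : 0 <= cos (a + t).
  by apply/ltW/cos_gt0_pihalf; rewrite /a in t1 *; apply/andP; split; lra.
have ge2 : 0 <= sin (t - a) * sin (2 * t).
  apply: mulr_ge0; apply: sin_ge0_pi; rewrite /a in t1 *; apply/andP; split; lra.
have e1 : sin (pi / 4 - t) * sin (pi / 4 + t) = h ^+ 2 * (cos (2 * t)).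
  rewrite (_ : 2 * t = t + t); last by lra.
  by rewrite !(cosD, sinB, sinD) cos_quarter -/h; ring.
have e2 : cos (a + t) - cos (2 * t) * cos (a - t) = sin (t - a) * sin (2 * t).
  rewrite (_ : a + t = 2 * t - (t - a)); last by lra.
  by rewrite (cosB (2 * t)) -(cosN (a - t)) opprB; ring.
have -> : (h * cos (a + t)) ^+ 2 =
  h ^+ 2 * cos (a + t) * (cos (2 * t) * cos (a - t) + sin (t - a) * sin (2 * t)).
  by rewrite -e2; ring.
rewrite (_ : cos (a + t) * sin (pi / 4 - t) * _ = cos (a + t) * cos (a - t) *
  (sin (pi / 4 - t) * sin (pi / 4 + t))); last by ring.
rewrite e1 -subr_ge0 (_ : _ - _ = h ^+ 2 * (cos (a + t) * (sin (t - a) * sin (2 * t)))).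
  by apply: mulr_ge0; [exact: sqr_ge0|exact: mulr_ge0].
by ring.
Qed.

Lemma weight_sq2 t : a <= t <= pi / 4 ->
  sin (t - a) * sin t * (sin (pi / 4 + t) * cos (a - t)) <= (h * sin t) ^+ 2.
Proof.
move=> /andP[t1 t2]; have p := pi_gt0 R.
have ge1 : 0 <= sin t.
  by apply: sin_ge0_pi; rewrite /a in t1 *; apply/andP; split; lra.
have ge2 : 0 <= sin (pi / 4 - t) * sin (6 * a - 2 * t).
  by apply: mulr_ge0; apply: sin_ge0_pi; rewrite /a in t1 *; apply/andP; split; lra.
have e1 : 2 * (sin (t - a) * cos (a - t)) = sin (2 * t - pi / 4).
  rewrite (_ : 2 * t - pi / 4 = (t - a) + (t - a)); last by rewrite /a; lra.
  by rewrite (sinD (t - a)) -(cosN (a - t)) opprB; ring.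
have e2 : sin t - sin (2 * t - pi / 4) * sin (pi / 4 + t) =
    sin (pi / 4 - t) * sin (6 * a - 2 * t).
  rewrite (_ : 6 * a - 2 * t = pi - (2 * t + pi / 4)); last by rewrite /a; lra.
  rewrite (sinB pi) sinpi cospi mul0r sub0r mulN1r opprK.
  rewrite (_ : 2 * t = t + t); last by lra.
  rewrite !trigE -/h; move: sqr_quarter (sqr_sin t).
  set c := cos t; set s := sin t => h2 s2.
  apply/eqP; rewrite -subr_eq0; apply/eqP.
  rewrite [LHS](_ : _ = - 2 * s * (c ^+ 2 + s ^+ 2) * (h ^+ 2 - 1 / 2)
    - s * (s ^+ 2 - (1 - c ^+ 2))).
    by rewrite h2 s2 !subrr !mulr0 subrr.
  by field.
have -> : (h * sin t) ^+ 2 = sin t *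
  (sin (2 * t - pi / 4) * sin (pi / 4 + t) + sin (pi / 4 - t) * sin (6 * a - 2 * t)) / 2.
  by rewrite -e2 exprMn sqr_quarter; field.
rewrite -subr_ge0 -e1 (_ : _ - _ = sin t * (sin (pi / 4 - t) * sin (6 * a - 2 * t)) / 2).
  by rewrite divr_ge0 // mulr_ge0.
by field.
Qed.

Lemma den_gt0 t : a <= t <= pi / 4 -> 0 < sin (pi / 4 + t) * cos (a - t).
Proof.
move=> /andP[t1 t2]; have p := pi_gt0 R; apply: mulr_gt0.
  by apply: sin_gt0_pi; rewrite /a in t1 *; apply/andP; split; lra.
by apply: cos_gt0_pihalf; rewrite /a in t1 *; apply/andP; split; lra.
Qed.

Lemma h_gt0 : 0 < h.
Proof.
have p := pi_gt0 R.
by apply: sin_gt0_pi; apply/andP; split; lra.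
Qed.

Lemma explicit_weightsE (theta : R) : let t := 3 * theta / 8 in
  let D := sin (pi / 4 + t) * cos (a - t) in
  explicit_weights theta =
  {| u1 := h * cos (a + t) / D; u2 := h * sin t / D; v := cos (a + t) * sin t / D;
     w1 := cos (a + t) * sin (pi / 4 - t) / D; w2 := sin (t - a) * sin t / D |}.
Proof.
cbv zeta; rewrite /explicit_weights; set t := 3 * theta / 8.
have e1 : sin (5 * pi / 4) = - h.
  by rewrite (_ : 5 * pi / 4 = pi / 4 + pi) ?sinDpi //; lra.
have e2 : sin (5 * pi / 8 + t) = cos (a + t).
  by rewrite (_ : 5 * pi / 8 + t = a + t + pi / 2) ?sinDpihalf // /a; lra.
have e3 : sin (5 * pi / 8 - t) = cos (a - t).
  by rewrite (_ : 5 * pi / 8 - t = a - t + pi / 2) ?sinDpihalf // /a; lra.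
have e4 : sin (5 * pi / 4 + t) = - sin (pi / 4 + t).
  by rewrite (_ : 5 * pi / 4 + t = pi / 4 + t + pi) ?sinDpi //; lra.
have e5 : sin (5 * pi / 4 - t) = - sin (pi / 4 - t).
  by rewrite (_ : 5 * pi / 4 - t = pi / 4 - t + pi) ?sinDpi //; lra.
have e6 : sin (15 * pi / 8 + t) = sin (t - a).
  rewrite (_ : 15 * pi / 8 + t = t - a + pi *+ 2) ?sinD2pi //.
  by rewrite /a mulr2n; lra.
rewrite e1 e2 e3 e4 e5 e6 sinN.
by congr Weights; rewrite ?mulNr ?mulrN ?invrN ?mulrN ?opprK ?mulNr ?opprK.
Qed.

(* 3/8 of the angle by which a walk in direction [q] has turned: quarter turns
   to the left are alternately by pi - theta and by theta, and t = 3 theta / 8. *)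
Definition phase t (q : int) : R :=
  3 * a * ((q + 1) %/ 2)%Z%:~R - (if (q %% 2)%Z == 1 then t else 0).

Lemma parity_cases (q : int) : (q %% 2)%Z = 0 \/ (q %% 2)%Z = 1.
Proof. lia. Qed.

Lemma phase_even t q k : (q %% 2)%Z = 0 ->
  phase t (q + k) = phase t q + phase t k.
Proof.
move=> hq; rewrite /phase hq /= subr0.
have -> : ((q + k) %% 2)%Z = (k %% 2)%Z by lia.
have -> : ((q + k + 1) %/ 2)%Z = ((q + 1) %/ 2)%Z + ((k + 1) %/ 2)%Z by lia.
by rewrite intrD; ring.
Qed.

(** In an odd direction left and right turns exchange their angles, hence the reflected argument
    [- k]. *)
Lemma phase_odd t q k : (q %% 2)%Z = 1 ->
  phase t (q + k) = phase t q - phase t (- k).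
Proof.
move=> hq; rewrite /phase hq eqxx.
have -> : ((q + k + 1) %/ 2)%Z = ((q + 1) %/ 2)%Z - ((- k + 1) %/ 2)%Z by lia.
rewrite intrB; have [hk|hk] : ((k %% 2)%Z = 0 \/ (k %% 2)%Z = 1) by lia.
  have -> : ((q + k) %% 2)%Z = 1 by lia.
  have -> : ((- k) %% 2)%Z = 0 by lia.
  by rewrite /=; ring.
have -> : ((q + k) %% 2)%Z = 0 by lia.
have -> : ((- k) %% 2)%Z = 1 by lia.
by rewrite /=; ring.
Qed.

Lemma phase_values t : (phase t 0 = 0) * (phase t 1 = 3 * a - t) *
  (phase t (-1) = - t) * (phase t 2 = 3 * a) * (phase t (-2) = - (3 * a)) *
  (phase t 3 = 6 * a - t) * (phase t (-3) = - (3 * a) - t) *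
  (phase t 4 = 6 * a) * (phase t (-4) = - (6 * a)).
Proof.
rewrite /phase.
have -> : ((0 + 1) %/ 2)%Z = 0 by []. have -> : ((1 + 1) %/ 2)%Z = 1 by [].
have -> : ((-1 + 1) %/ 2)%Z = 0 by []. have -> : ((2 + 1) %/ 2)%Z = 1 by [].
have -> : ((-2 + 1) %/ 2)%Z = -1 by []. have -> : ((3 + 1) %/ 2)%Z = 2 by [].
have -> : ((-3 + 1) %/ 2)%Z = -1 by []. have -> : ((4 + 1) %/ 2)%Z = 2 by [].
have -> : ((-4 + 1) %/ 2)%Z = -2 by [].
do !split; rewrite /= ?mulrN1z ?mulr1z ?mulr0z; try ring.
Qed.

Lemma cosBN x y : cos (x - y) = cos (- x + y) :> R.
Proof. by rewrite -cosN opprB addrC. Qed.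

Lemma observable_explicit (theta : R) : pi / 3 <= theta <= 2 * pi / 3 ->
  observable (explicit_weights theta) (fun q => cos (phase (3 * theta / 8) q)).
Proof.
move=> /andP[th1 th2]; have p := pi_gt0 R.
set t := 3 * theta / 8.
(* On this range the weights are nonnegative: [w2] vanishes at [t = a] and [w1] at [t = pi / 4]. *)
have ht : a <= t <= pi / 4 by rewrite /a /t; apply/andP; split; lra.
rewrite explicit_weightsE -/t; set D := sin (pi / 4 + t) * _.
have D0 : 0 < D := den_gt0 ht.
have c0 : 0 < cos (a + t).
  apply: cos_gt0_pihalf; move: ht => /andP[]; rewrite /a => *.
  by apply/andP; split; lra.
have s0 : 0 < sin t.
  apply: sin_gt0_pi; move: ht => /andP[]; rewrite /a => *.
  by apply/andP; split; lra.
have sp0 : 0 <= sin (pi / 4 - t).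
  apply: sin_ge0_pi; move: ht => /andP[]; rewrite /a => *.
  by apply/andP; split; lra.
have sm0 : 0 <= sin (t - a).
  apply: sin_ge0_pi; move: ht => /andP[]; rewrite /a => *.
  by apply/andP; split; lra.
have h0 := h_gt0; have Dn : D != 0 by rewrite gt_eqF.
have hw x y : x * D <= y ^+ 2 -> x / D <= (y / D) ^+ 2.
  move=> hxy; rewrite ler_pdivrMr // (_ : _ * D = y ^+ 2 / D); last by field.
  by rewrite ler_pdivlMr.
have cpos x : - (pi / 2) <= x <= pi / 2 -> 0 <= cos x by exact: cos_ge0_pihalf.
have pv := phase_values t.
constructor; rewrite /=.
- by apply: divr_gt0 => //; exact: mulr_gt0.
- by apply: divr_gt0 => //; exact: mulr_gt0.
- by apply: divr_gt0 => //; exact: mulr_gt0.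
- by apply: divr_ge0; [apply: mulr_ge0|]; rewrite // ltW.
- by apply: divr_ge0; [apply: mulr_ge0|]; rewrite // ltW.
- by apply: hw; exact: weight_sq1.
- by apply: hw; exact: weight_sq2.
- by rewrite pv cos0.
- rewrite pv; apply: cpos; move: ht => /andP[]; rewrite /a => *.
  by apply/andP; split; lra.
- rewrite pv; apply: cpos; move: ht => /andP[]; rewrite /a => *.
  by apply/andP; split; lra.
- rewrite pv; apply: cos_gt0_pihalf; rewrite /a.
  by apply/andP; split; lra.
- by rewrite !pv cosN.
- move=> q; rewrite /turns !big_cons big_nil /= addr0.
  have F be : cos be = cos (a + t) * sin t / D * cos be +
      (h * sin t / D * cos (be + (3 * a - t)) + h * cos (a + t) / D * cos (be - t)).
    rewrite !addrA; have := trig_straight t be; rewrite -/D => E.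
    apply: (mulfI Dn); rewrite E; move: Dn; clear.
    move: (cos _) (sin _) (cos _) (cos _) (cos _) D => x1 x2 x3 x4 x5 D' Dn'.
    by field.
  have [hq|hq] := parity_cases q.
    rewrite !(phase_even _ _ hq) !pv hq /= !addr0. exact: F.
  (* As the cosine is even, the odd case is the same identity at [- phase t q]. *)
  rewrite !(phase_odd _ _ hq) ?opprK ?oppr0 !pv hq /=. rewrite addr0 !(cosBN (phase t q)).
  have := F (- phase t q); rewrite cosN => {1}->.
  by congr (_ + _); exact: addrC.
- move=> q x hx; cbv zeta.
  have F1 be : h * sin t / D * cos (be - 3 * a)
      + cos (a + t) * sin t / D * cos (be + (6 * a - t))
      - sin (t - a) * sin t / D * cos (be - t) = 0.
    rewrite !addrA; transitivity (sin t / D * (h * cos (be - 3 * a) +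
      cos (a + t) * cos (be + 6 * a - t) - sin (t - a) * cos (be - t))).
      by ring.
    by rewrite trig_loop2 subrr mulr0.
  have F2 be : h * cos (a + t) / D * cos (be + 3 * a)
      + cos (a + t) * sin t / D * cos (be + (- (3 * a) - t))
      - cos (a + t) * sin (pi / 4 - t) / D * cos (be + (3 * a - t)) = 0.
    rewrite !addrA; transitivity (cos (a + t) / D * (h * cos (be + 3 * a) +
      sin t * cos (be - 3 * a - t) - sin (pi / 4 - t) * cos (be + 3 * a - t))).
      by ring.
    by rewrite trig_loop1 subrr mulr0.
  have F3 be : h * sin t / D * cos (be + (- (3 * a) - t))
      + h * cos (a + t) / D * cos (be + (6 * a - t))
      - sin (t - a) * sin t / D * cos (be - 6 * a)
      - cos (a + t) * sin (pi / 4 - t) / D * cos (be + 6 * a) = 0.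
    rewrite !addrA; have E := trig_loop_across t be; transitivity (D^-1 *
      ((h * sin t * cos (be - 3 * a - t) + h * cos (a + t) * cos (be + 6 * a - t))
      - (sin (t - a) * sin t * cos (be - 6 * a) +
         cos (a + t) * sin (pi / 4 - t) * cos (be + 6 * a)))).
      by ring.
    by rewrite E subrr mulr0.
  have [hq|hq] := parity_cases q.
    pose be := phase t q; move: (F1 be) (F2 be) (F3 be); rewrite /be.
    rewrite -!(addrA q) !(phase_even _ _ hq).
    move: (phase t q) => al G1 G2 G3.
    move: hx; rewrite !inE => /or3P[/eqP->|/eqP->|/or4P[]/eqP->] /=;
      rewrite ?pv ?hq /= ?mul0r ?subr0;
      (try by rewrite -[RHS]G1; ring); (try by rewrite -[RHS]G2; ring);
      by rewrite -[RHS]G3; ring.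
  pose be := - phase t q; move: (F1 be) (F2 be) (F3 be); rewrite /be.
  rewrite -!(addrA q) !(phase_odd _ _ hq) !(cosBN (phase t q)).
  move: (- phase t q) => al G1 G2 G3.
  move: hx; rewrite !inE => /or3P[/eqP->|/eqP->|/or4P[]/eqP->] /=;
    rewrite ?pv ?hq /= ?mul0r ?subr0 ?opprK ?oppr0 ?pv;
    (try by rewrite -[RHS]G1; ring); (try by rewrite -[RHS]G2; ring);
    by rewrite -[RHS]G3; ring.
Qed.
End Trigonometry.

(** * Weights of words *)

Definition kinds_at (l : seq label) (r : int * int) : seq (option bool) :=
  [seq x.2 | x <- l & x.1 == r].

Lemma kinds_at_notin l r : r \notin map fst l -> kinds_at l r = [::].
Proof.
move=> h; rewrite /kinds_at; apply/eqP; rewrite -size_eq0 size_map size_filter.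
rewrite eqn0Ngt -has_count; apply: contra h => /hasP[x hx /eqP <-]; exact: map_f.
Qed.

Lemma kinds_at_cat l l' r : kinds_at (l ++ l') r = kinds_at l r ++ kinds_at l' r.
Proof. by rewrite /kinds_at filter_cat map_cat. Qed.

Section Weight.
Variables (R : realType) (W : weights R) (g : int -> R).
Hypothesis ob : observable W g.

(** Kinds suffice, as two arcs in a rhombus of a simple walk surround opposite corners, where the
    angles are equal. Other repeated visits weigh 0, so that sums may run over all simple words,
    admissible or not. *)
Definition config (ks : seq (option bool)) : R :=
  match ks with
  | [::] => 1
  | [:: k] => wt1 W k
  | [:: k; k'] => if k == k' then wt2 W k else 0
  | _ => 0
  end.

Definition omega (l : seq label) : R :=
  \prod_(r <- undup (map fst l)) config (kinds_at l r).

Lemma wt1_gt0 k : 0 < wt1 W k.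
Proof. by case: k => [[]|]; [exact: ob_u1 ob|exact: ob_u2 ob|exact: ob_v ob]. Qed.

Lemma wt2_ge0 k : 0 <= wt2 W k.
Proof. by case: k => [[]|] //; [exact: ob_w1 ob|exact: ob_w2 ob]. Qed.

Lemma wt2_le k : wt2 W k <= wt1 W k * wt1 W k.
Proof.
case: k => [[]|] /=; rewrite -expr2 ?sqr_ge0 //.
  exact: ob_w1_le ob.
exact: ob_w2_le ob.
Qed.

Lemma config_ge0 ks : 0 <= config ks.
Proof.
case: ks => [|k [|k' [|? ?]]] //=; first by rewrite ltW ?wt1_gt0.
by case: eqP => // _; exact: wt2_ge0.
Qed.

Lemma config_cat_le ks ks' : config (ks ++ ks') <= config ks * config ks'.
Proof.
case: ks => [|k [|k1 [|k2 ks]]] /=.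
- by rewrite mul1r.
- case: ks' => [|k' [|k'' ks']] /=; first by rewrite mulr1.
    case: eqP => [->|_]; first exact: wt2_le.
    by rewrite mulr_ge0 ?ltW ?wt1_gt0.
  by apply: mulr_ge0; [exact/ltW/wt1_gt0|exact: (config_ge0 (_ :: _ :: _))].
- case: ks' => [|k' ks']; first by rewrite mulr1.
  by apply: mulr_ge0; [exact: (config_ge0 [:: k; k1])|exact: config_ge0].
- by rewrite mul0r.
Qed.

Lemma config_perm ks ks' : perm_eq ks ks' -> config ks = config ks'.
Proof.
move=> h; have := perm_size h.
case: ks h => [|k [|k1 [|k2 ks]]] h; case: ks' h => [|k' [|k1' [|k2' ks']]] h //= _.
  by have := perm_mem h k'; rewrite !inE eqxx => /eqP ->.
have [E|ne] := eqVneq k k1.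
  rewrite -E in h; have := perm_mem h k'; have := perm_mem h k1'.
  by rewrite !inE !eqxx !orbT !orbb => /eqP-> /eqP->; rewrite eqxx.
case: eqP => // E; rewrite -E in h; have := perm_mem h k; have := perm_mem h k1.
rewrite !inE !eqxx !orbT !orbb => /esym/eqP h1 /esym/eqP h2.
by rewrite h1 h2 eqxx in ne.
Qed.

Lemma config_crossing ks : None \in ks -> (1 < size ks)%N -> config ks = 0.
Proof.
case: ks => [|k [|k1 [|k2 ks]]] //=; rewrite !inE => h _.
by case: eqP => // E; move: h; rewrite -E orbb => /eqP <-.
Qed.

Lemma omega_sup (Rs : seq (int * int)) l : uniq Rs -> {subset map fst l <= Rs} ->
  omega l = \prod_(r <- Rs) config (kinds_at l r).
Proof.
move=> hu hs; rewrite [RHS](bigID (mem (map fst l))) /= [X in _ * X]big1.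
  rewrite mulr1 -big_filter /omega; apply: perm_big; apply: uniq_perm.
  - exact: undup_uniq.
  - exact: filter_uniq.
  - by move=> r; rewrite mem_undup mem_filter; case: (boolP (r \in _)) => //= /hs ->.
by move=> r hr; rewrite kinds_at_notin.
Qed.

Lemma omega_ge0 l : 0 <= omega l.
Proof. by apply: prodr_ge0 => r _; exact: config_ge0. Qed.

Lemma omega_nil : omega [::] = 1.
Proof. by rewrite /omega big_nil. Qed.

Lemma omega_cat_le l l' : omega (l ++ l') <= omega l * omega l'.
Proof.
set Rs := undup (map fst (l ++ l')); have hu : uniq Rs by exact: undup_uniq.
have hm : {subset map fst l ++ map fst l' <= Rs}.
  by move=> r; rewrite mem_undup map_cat.
rewrite (@omega_sup Rs (l ++ l')) //; last by move=> r; rewrite mem_undup.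
rewrite (@omega_sup Rs l) //; last by move=> r hr; apply: hm; rewrite mem_cat hr.
rewrite (@omega_sup Rs l') //; last by move=> r hr; apply: hm; rewrite mem_cat hr orbT.
rewrite -big_split /=; apply: ler_prod => r _.
by rewrite config_ge0 kinds_at_cat config_cat_le.
Qed.

Lemma omega_perm l l' : perm_eq l l' -> omega l = omega l'.
Proof.
move=> h; rewrite (@omega_sup (undup (map fst l')) l) ?undup_uniq //.
  by apply: eq_bigr => r _; apply/config_perm/perm_map/perm_filter.
by move=> r; rewrite mem_undup (perm_mem (perm_map fst h)).
Qed.

Lemma omega_map (phi : int * int -> int * int) l : injective phi ->
  omega [seq (phi x.1, x.2) | x <- l] = omega l.
Proof.
move=> hphi; rewrite (@omega_sup (map phi (undup (map fst l)))).
- rewrite big_map; apply: eq_bigr => r _; congr config.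
  rewrite /kinds_at filter_map -map_comp /=; congr map.
  by apply: eq_filter => x /=; rewrite (inj_eq hphi).
- by rewrite map_inj_uniq ?undup_uniq.
- move=> r /mapP[x /mapP[y hy ->] ->] /=.
  by rewrite mem_map // mem_undup; apply: map_f.
Qed.

Lemma omega_split r l :
  omega l = config (kinds_at l r) * omega [seq x <- l | x.1 != r].
Proof.
set Rs := undup (r :: map fst l); have hu : uniq Rs by exact: undup_uniq.
rewrite (@omega_sup Rs l) //; last by move=> x hx; rewrite mem_undup inE hx orbT.
rewrite (@omega_sup Rs [seq _ <- l | _]) //; last first.
  move=> x /mapP[y]; rewrite mem_filter => /andP[_ hy] ->.
  by rewrite mem_undup inE map_f ?orbT.
have hr : r \in Rs by rewrite mem_undup inE eqxx.
rewrite !(bigD1_seq r) //= [X in _ * (X * _)](_ : _ = 1).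
  rewrite mul1r; congr (_ * _); apply: eq_bigr => x hx; congr config.
  rewrite /kinds_at -filter_predI; congr map; apply: eq_filter => y /=.
  by case: eqP => //= ->.
rewrite kinds_at_notin //; apply/negP => /mapP[y]; rewrite mem_filter => /andP[h _] E.
by rewrite E eqxx in h.
Qed.

Lemma omega_rcons r k l : omega (rcons l (r, k)) =
  config (rcons (kinds_at l r) k) * omega [seq x <- l | x.1 != r].
Proof.
rewrite (omega_split r) filter_rcons /= eqxx /=; congr (config _ * _).
by rewrite /kinds_at filter_rcons /= eqxx map_rcons.
Qed.

Lemma omega_rcons_new r k l : r \notin map fst l ->
  omega (rcons l (r, k)) = omega l * wt1 W k.
Proof.
move=> hr; rewrite omega_rcons [in RHS](omega_split r) kinds_at_notin //=.
by rewrite mul1r mulrC.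
Qed.

Lemma omega_neq0_crossing_free s w : omega (labels s w) != 0 -> crossing_free s w.
Proof.
move=> h i j ij hj hr hN; move/negP: h; apply; apply/eqP.
have hi : (i < size w)%N by apply: ltn_trans hj.
rewrite (omega_split (at_time s w i).1) config_crossing ?mul0r //.
  rewrite -hN; apply/mapP.
  exists ((at_time s w i).1, kind (sd (at_time s w i)) (nth None w i)); last first.
    by rewrite /= hN.
  rewrite mem_filter eqxx /= -(@nth_labels ((0, 0), None)) // mem_nth //.
  by rewrite size_labels.
rewrite size_map size_filter.
have -> : labels s w = take j (labels s w) ++ drop j (labels s w) by rewrite cat_take_drop.
have hlj : (j < size (labels s w))%N by rewrite size_labels.
have hli : (i < size (labels s w))%N by rewrite size_labels.
have nthE m : (m < size w)%N ->
   (nth ((0, 0), None) (labels s w) m).1 = (at_time s w m).1.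
  by move=> hm; rewrite nth_labels.
have c1 : (0 < count (fun x => x.1 == (at_time s w i).1) (take j (labels s w)))%N.
  rewrite -has_count; apply/hasP.
  exists (nth ((0, 0), None) (labels s w) i); last by rewrite nthE.
  by rewrite -(nth_take _ ij) mem_nth // size_take hlj.
have c2 : (0 < count (fun x => x.1 == (at_time s w i).1) (drop j (labels s w)))%N.
  rewrite -has_count; apply/hasP.
  exists (nth ((0, 0), None) (labels s w) j); last by rewrite nthE // hr.
  by rewrite (drop_nth ((0, 0), None)) // inE eqxx.
by rewrite count_cat -(addn1 1) leq_add.
Qed.

Lemma omega_rcons_eq0 l x : omega l = 0 -> omega (rcons l x) = 0.
Proof.
move=> h; apply/eqP; rewrite eq_le omega_ge0 andbT.
by rewrite -cats1 (le_trans (omega_cat_le _ _)) // h mul0r.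
Qed.
End Weight.

(** * The identity in a parallelogram *)

Definition words (N : nat) : seq (seq turn) :=
  [seq bseqval w | w <- enum {: N.-bseq (option bool)}].

Lemma mem_words N w : (w \in words N) = (size w <= N)%N.
Proof.
apply/mapP/idP => [[b _ ->]|h]; first exact: size_bseq.
by exists (Bseq h); rewrite ?mem_enum.
Qed.

Lemma words_uniq N : uniq (words N).
Proof. by rewrite map_inj_uniq ?enum_uniq //; exact: val_inj. Qed.

Definition in_box (T L : nat) (r : int * int) : bool :=
  (0 <= r.1 < T%:Z) && (- L%:Z <= r.2 <= L%:Z).

Definition box_walk (T L : nat) (w : seq turn) : bool :=
  simple origin w && all (in_box T L) (visits origin w).

(** A bound on the number of midpoints: their doubled coordinates in the box take at most
    [2 * T + 1] and [4 * L + 3] values. *)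
Definition box_size (T L : nat) : nat := ((2 * T + 1) * (4 * L + 3))%N.

Definition box_walks (T L : nat) : seq (seq turn) :=
  [seq w <- words (box_size T L) | box_walk T L w].

Lemma mids_in_box T L w z : (all (in_box T L) (visits origin w)) -> z \in mids origin w ->
  (- 1 <= z.1 <= 2 * T%:Z - 1) /\ (- (2 * L%:Z + 1) <= z.2 <= 2 * L%:Z + 1).
Proof.
move=> /allP h /midsP[[|i] hi <-].
  by rewrite at_time0 (_ : mid origin = (-1, 0)) //=; lia.
have := h _ (introT (visitsP _ _ _) (ex_intro2 _ _ i hi erefl)).
rewrite /at_time run_take_next // /in_box /mid /step /sx /sy /sd /=.
move: (_ + tz _) => d; move: (run _ _).1 => -[x y] /=.
by case: (dirP d) => -[_ -> ->]; lia.
Qed.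

Lemma box_walk_size T L w : box_walk T L w -> (size w < box_size T L)%N.
Proof.
move=> /andP[hs hb]; rewrite -ltnS -(size_mids origin).
pose grid := [seq ((i%:Z - 1 : int), (j%:Z - (2 * L%:Z + 1) : int)) |
  i <- iota 0 (2 * T + 1)%N, j <- iota 0 (4 * L + 3)%N].
have -> : (box_size T L).+1 = (size grid).+1 by rewrite size_allpairs !size_iota.
rewrite ltnS; apply: uniq_leq_size => // -[zx zy] hz.
have [] := mids_in_box hb hz; rewrite /fst /snd => h1 h2.
apply/allpairsP; exists (absz (zx + 1), absz (zy + (2 * L%:Z + 1))).
rewrite /fst /snd; split.
- by rewrite mem_iota; move: h1; clear; lia.
- by rewrite mem_iota; move: h2; clear; lia.
- by congr (_, _); move: h1 h2; clear; lia.
Qed.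

Lemma mem_box_walks T L w : (w \in box_walks T L) = box_walk T L w.
Proof.
rewrite mem_filter mem_words; case: (boolP (box_walk T L w)) => //= h.
by rewrite ltnW ?box_walk_size.
Qed.

Lemma box_walks_uniq T L : uniq (box_walks T L).
Proof. by apply: filter_uniq; exact: words_uniq. Qed.

Lemma visits_rcons s w e : visits s (rcons w e) = rcons (visits s w) (run s w).1.
Proof. by rewrite /visits labels_rcons map_rcons. Qed.

Lemma box_walk_rcons T L w e : box_walk T L (rcons w e) =
  [&& box_walk T L w, in_box T L (run origin w).1 & simple origin (rcons w e)].
Proof.
rewrite /box_walk visits_rcons all_rcons; case hs: (simple origin (rcons w e)).
  have -> : simple origin w by move: hs; rewrite simple_rcons => /andP[].
  by rewrite /= andbT andbC.
by rewrite !andbF.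
Qed.

Lemma last_turn_kind q x : x \in loop_table ->
  kind (q + x.2) (last_turn x.1 x.2) = kind q x.1.
Proof.
rewrite !inE => /or3P[/eqP->|/eqP->|/or4P[]/eqP->] //=; congr Some;
  apply/eqP/eqP; lia.
Qed.

Section Identity.
Variables (R : realType) (W : weights R) (g : int -> R).
Hypothesis ob : observable W g.

Definition word_weight (s : state) (w : seq turn) : R := omega W (labels s w).

Lemma weight_ge0 s w : 0 <= word_weight s w.
Proof. exact: omega_ge0 ob _. Qed.

Definition end_value (w : seq turn) : R := word_weight origin w * g (sd (run origin w)).

Definition defect (w : seq turn) : R :=
  end_value w - \sum_(e <- turns | simple origin (rcons w e)) end_value (rcons w e).

Lemma end_value_rcons w e : end_value (rcons w e) =
  omega W (rcons (labels origin w) ((run origin w).1, kind (sd (run origin w)) e)) *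
  g (sd (run origin w) + tz e).
Proof. by rewrite /end_value /word_weight labels_rcons run_rcons. Qed.

Lemma defect_new w : simple origin w -> 0 <= sx (run origin w) ->
  (run origin w).1 \notin visits origin w -> defect w = 0.
Proof.
move=> hs h0 hn; apply/eqP; rewrite subr_eq0; apply/eqP.
rewrite (eq_bigl xpredT); last by move=> e; rewrite simple_new_rhombus.
under eq_bigr => e _ do rewrite end_value_rcons omega_rcons_new // -mulrA.
by rewrite -big_distrr /= -(ob_visit ob).
Qed.

Lemma defect_weight0 w : word_weight origin w = 0 -> defect w = 0.
Proof.
move=> h; rewrite /defect {1}/end_value h mul0r big1 ?subr0 // => e _.
by rewrite end_value_rcons (omega_rcons_eq0 ob) ?mul0r.
Qed.

Lemma sum_turns_pred1 f (F : turn -> R) : \sum_(e <- turns | pred1 f e) F e = F f.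
Proof. by case: f => [[]|]; rewrite /turns !big_cons big_nil /= ?addr0. Qed.

(** Only the turn onto the last free side extends the walk, and it gives the rhombus the weight
    [wt2]. *)
Lemma defect_returning w : returning w ->
  let q := sd (at_time origin w (first_visit w)) in
  defect w = omega W [seq x <- labels origin w | x.1 != (run origin w).1] *
   (wt1 W (kind q (loop_type w).1) * g (q + (loop_type w).2) -
    wt2 W (kind q (loop_type w).1) *
      g (q + (loop_type w).2 + tz (last_turn (loop_type w).1 (loop_type w).2))).
Proof.
move=> hw; cbv zeta; set q := sd _.
have hq : sd (run origin w) = q + (loop_type w).2.
  by rewrite /loop_type /= addrC subrK.
have ht : loop_type w \in loop_table by case/and4P: hw.
rewrite /defect (eq_bigl (pred1 (last_turn (loop_type w).1 (loop_type w).2))).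
  rewrite sum_turns_pred1.
  rewrite end_value_rcons omega_rcons hq last_turn_kind //.
  rewrite /end_value /word_weight (omega_split W (run origin w).1) hq.
  rewrite -!/(kinds_at _ _) /kinds_at returning_labels_here //= -/q eqxx.
  by ring.
by move=> e; exact: returning_simple_rcons.
Qed.

Lemma defect_partner w : returning w -> defect w + defect (partner w) = 0.
Proof.
move=> hw; have [[h1 h2 h3 h4] [h5 h6 h7 h8]] := partner_facts hw.
rewrite (defect_returning hw) (defect_returning h1) h4 h5 h7.
rewrite (omega_perm W h8) -mulrDr.
have ht : loop_type w \in loop_table by case/and4P: hw.
have := ob_loop ob (sd (at_time origin w (first_visit w))) ht; cbv zeta => ->.
by rewrite mulr0.
Qed.

Section Box.
Variables (T L : nat).

Let open_walks := [seq w <- box_walks T L | in_box T L (run origin w).1].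

Let mem_open w : (w \in open_walks) = in_box T L (run origin w).1 && box_walk T L w.
Proof. by rewrite mem_filter mem_box_walks. Qed.

Lemma sum_defect : \sum_(w <- open_walks) defect w = 0.
Proof.
rewrite (bigID returning) /= [X in _ + X]big1_seq ?addr0; last first.
  move=> w /andP[hr]; rewrite mem_open => /andP[hb /andP[hs hv]].
  have h0 : 0 <= sx (run origin w) by case/andP: hb => /andP[].
  have [hn|hv'] := boolP ((run origin w).1 \in visits origin w); last exact: defect_new.
  (* Nonzero weight excludes crossings, and then [word_loop] puts the loop in the table. *)
  apply: defect_weight0; apply/eqP; apply: contraNT hr => hw0.
  have hc := omega_neq0_crossing_free hw0.
  apply/and4P; split=> //.
  apply: word_loop => //.
  - by move=> r /(allP hv) /andP[/andP[]].
  - exact: first_visit_lt.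
  - exact: first_visit_rhombus.
rewrite -big_filter; pose Lr := [seq w <- open_walks | returning w]; rewrite -/Lr.
have memL w : (w \in Lr) = [&& returning w, box_walk T L w & in_box T L (run origin w).1].
  by rewrite mem_filter mem_open; congr (_ && _); rewrite andbC.
have hp : perm_eq (map partner Lr) Lr.
  have hL w : w \in Lr -> partner w \in Lr.
    rewrite !memL => /and3P[h1 /andP[h2 h3] h4].
    have [[h5 _ _ _] [h6 h7 _ _]] := partner_facts h1.
    rewrite h5 h6 h4 /box_walk andbT /=.
    by case/and4P: h5 => -> _ _ _ /=; rewrite (perm_all _ h7).
  have hK w : w \in Lr -> partner (partner w) = w.
    by rewrite memL => /and3P[/partner_facts[[_ -> _ _] _]].
  have hu : uniq Lr by rewrite !filter_uniq // words_uniq.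
  apply: uniq_perm => //.
    rewrite map_inj_in_uniq // => w w' hw hw' E.
    by rewrite -(hK _ hw) E hK.
  move=> w; apply/mapP/idP => [[w' hw' ->]|hw]; first exact: hL.
  by exists (partner w); [exact: hL|rewrite hK].
have E : \sum_(w <- Lr) defect w = \sum_(w <- Lr) defect (partner w).
  by rewrite -(perm_big _ hp) /= big_map.
have : \sum_(w <- Lr) (defect w + defect (partner w)) = 0.
  by apply: big1_seq => w /andP[_]; rewrite memL => /andP[hr _]; exact: defect_partner.
by rewrite big_split /= -E; move: (\sum_(_ <- _) _) => S; lra.
Qed.

Lemma open_extensions :
  perm_eq [seq rcons w e | w <- open_walks,
                           e <- [seq e <- turns | simple origin (rcons w e)]]
          [seq w <- box_walks T L | w != [::]].
Proof.
apply: uniq_perm.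
- apply: allpairs_uniq_dep => [|w _|].
  + by rewrite !filter_uniq // words_uniq.
  + exact: filter_uniq.
  + by move=> [w e] [w' e'] _ _ /= /rcons_inj [-> ->].
- by rewrite !filter_uniq // words_uniq.
- move=> z; apply/allpairsPdep/idP => [[w [e [h1 h2 ->]]]|].
    move: h1; rewrite mem_open => /andP[h1 h1'].
    move: h2; rewrite (mem_filter (fun e => simple origin (rcons w e))) => /andP[h3 _].
    by rewrite mem_filter mem_box_walks box_walk_rcons h1 h1' h3 -size_eq0 size_rcons.
  rewrite mem_filter mem_box_walks => /andP[]; case/lastP: z => [//|w e] _.
  rewrite box_walk_rcons => /and3P[h1 h2 h3]; exists w, e.
  split=> //; first by rewrite mem_open h1 h2.
  by rewrite mem_filter h3 mem_turns.
Qed.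

(** Each nonempty walk of the box extends exactly one open walk by one turn. Summing the defects
    therefore leaves the walks that end outside and the empty walk, of value [g 0 = 1]. *)
Lemma box_identity :
  \sum_(w <- box_walks T L | ~~ in_box T L (run origin w).1) end_value w = 1.
Proof.
have h0 : [::] \in box_walks T L by rewrite mem_box_walks.
have E : \sum_(w <- open_walks) end_value w = \sum_(w <- box_walks T L | w != [::]) end_value w.
  rewrite -[RHS]big_filter -(perm_big _ open_extensions) big_allpairs_dep.
  apply/eqP; rewrite -subr_eq0 -sumrB; apply/eqP; rewrite -[RHS]sum_defect.
  by apply: eq_bigr => w _; rewrite /defect big_filter.
have : \sum_(w <- box_walks T L) end_value w =
    1 + \sum_(w <- box_walks T L | w != [::]) end_value w.
  rewrite (bigD1_seq [::]) //=; last exact: box_walks_uniq.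
  by rewrite /end_value /word_weight omega_nil (ob_right ob) mulr1.
rewrite (bigID (fun w => in_box T L (run origin w).1)) /=.
by rewrite -E big_filter addrC => /addIr.
Qed.
End Box.
End Identity.

(** * Bridges and arches *)

Definition in_strip (T : nat) (r : int * int) : bool := 0 <= r.1 < T%:Z.
Definition strip_walk (T : nat) (w : seq turn) : bool :=
  simple origin w && all (in_strip T) (visits origin w).
Definition bridge (T : nat) (w : seq turn) : bool :=
  strip_walk T w && (sx (run origin w) == T%:Z).
Definition arch (T : nat) (w : seq turn) : bool :=
  strip_walk T w && (sx (run origin w) == -1).

Lemma sx_step s e : sx (step s e) = sx s + ex (sd s + tz e). Proof. by []. Qed.
Lemma sy_step s e : sy (step s e) = sy s + ey (sd s + tz e). Proof. by []. Qed.

Lemma run_dist s w : `|sx (run s w) - sx s| + `|sy (run s w) - sy s| <= (size w)%:Z.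
Proof.
elim/last_ind: w => [|w e IH]; first by rewrite !subrr.
rewrite run_rcons size_rcons sx_step sy_step; move: IH.
by case: (dirP (sd (run s w) + tz e)) => -[_ -> ->]; lia.
Qed.

Lemma visits_dist s w r : r \in visits s w ->
  `|r.1 - sx s| + `|r.2 - sy s| <= (size w)%:Z.
Proof.
move=> /visitsP[i hi <-]; have := run_dist s (take i w).
rewrite /at_time size_take hi => h; apply: (le_trans h).
by rewrite lez_nat ltnW.
Qed.

Lemma box_strip T L w : box_walk T L w -> strip_walk T w.
Proof.
move=> /andP[hs /allP h]; rewrite /strip_walk hs; apply/allP => r /h.
by case/andP.
Qed.

Lemma strip_box T w L : (size w <= L)%N -> strip_walk T w -> box_walk T L w.
Proof.
move=> hL /andP[hs /allP h]; rewrite /box_walk hs; apply/allP => r hr.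
have := visits_dist hr; have := h _ hr; rewrite /in_box /in_strip /=.
by move: hL; clear; case: r => x y; rewrite /sx /sy /origin /=; lia.
Qed.

Lemma last_visit w : (0 < size w)%N -> exists2 r, r \in visits origin w &
  `|sx (run origin w) - r.1| + `|sy (run origin w) - r.2| <= 1.
Proof.
case/lastP: w => [//|w e] _; exists (run origin w).1.
  by rewrite visits_rcons mem_rcons inE eqxx.
rewrite run_rcons /step /sx /sy /=.
by case: (dirP (sd (run origin w) + tz e)) => -[_ -> ->]; lia.
Qed.

Variant exit_spec (T L : nat) (w : seq turn) : Prop :=
  | ExitRight of sx (run origin w) = T%:Z & sd (run origin w) = 0
  | ExitLeft of sx (run origin w) = -1 &
      sd (run origin w) = 2 \/ sd (run origin w) = -2
  | ExitTop of sx (run origin w) != T%:Z & sx (run origin w) != -1 &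
      sd (run origin w) = 1 & (L < size w)%N
  | ExitBottom of sx (run origin w) != T%:Z & sx (run origin w) != -1 &
      sd (run origin w) = -1 & (L < size w)%N.

Lemma exitP T L w : box_walk T L w -> ~~ in_box T L (run origin w).1 ->
  crossing_free origin w -> exit_spec T L w.
Proof.
move=> hb ho hc; have /andP[hs /allP hv] := hb.
have hr r : r \in visits origin w -> 0 <= r.1 by move=> /hv /andP[/andP[]].
have [w0|n0] := posnP (size w).
  (* The empty walk ends outside only for [T = 0], when the start is already in column [T]. *)
  move/size0nil: w0 ho => -> ho; apply: ExitRight => //.
  move: ho; rewrite /in_box /sx /=; lia.
have [r hrv hrd] := last_visit n0.
have hb1 := hv _ hrv; have hd := run_dist origin w.
have : [\/ sx (run origin w) = T%:Z, sx (run origin w) = -1,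
    [/\ sx (run origin w) != T%:Z, sx (run origin w) != -1 &
        sy (run origin w) = L%:Z + 1] |
    [/\ sx (run origin w) != T%:Z, sx (run origin w) != -1 &
        sy (run origin w) = - (L%:Z + 1)]].
  move: ho hb1 hrd; rewrite /in_box /sx /sy; case: (run origin w).1 => a b.
  case: r {hrv} => a' b' /=; clear => h1 h2 h3.
  have [|h4] := eqVneq a T%:Z; first by constructor 1.
  have [|h5] := eqVneq a (-1); first by constructor 2.
  have [|h6] := eqVneq b (L%:Z + 1); first by constructor 3.
  by constructor 4; split=> //; lia.
case=> [h|h|[h4 h5 h]|[h4 h5 h]].
- apply: ExitRight => //; apply: word_exit_right => // x /hv /andP[/andP[_]].
  by rewrite h.
- by apply: ExitLeft => //; apply: word_exit_left.
- apply: ExitTop => //; last by move: hd; rewrite h /sx /sy /=; lia.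
  by apply: word_exit_top => // x /hv /andP[_ /andP[_ h2]]; rewrite h ltzD1.
- apply: ExitBottom => //; last by move: hd; rewrite h /sx /sy /=; lia.
  by apply: word_exit_bottom => // x /hv /andP[_ /andP[h2 _]]; rewrite h;
    apply: lt_le_trans h2; lia.
Qed.

(** The comparison behind all decompositions: [phi] rebuilds an object from its pieces, so distinct
    objects have distinct pieces. *)
Lemma ler_sum_cover (R : numDomainType) (I J : eqType) (s : seq I) (t : seq J)
    (P : pred I) (Q : pred J) (F : I -> R) (G : J -> R) (phi : J -> I) :
  uniq s -> (forall y, y \in t -> Q y -> 0 <= G y) ->
  (forall x, x \in s -> P x ->
     exists y, [/\ y \in t, Q y, phi y = x & F x <= G y]) ->
  \sum_(x <- s | P x) F x <= \sum_(y <- t | Q y) G y.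
Proof.
move=> us G0 H.
apply: (@le_trans _ _ (\sum_(x <- s | P x) \sum_(y <- t | Q y && (phi y == x)) G y)).
  rewrite big_seq_cond [leRHS]big_seq_cond; apply: ler_sum => x /andP[xs Px].
  have [y [yt Qy <- Fy]] := H x xs Px.
  apply: (le_trans Fy); rewrite (big_rem y) //= Qy eqxx /= lerDl.
  by rewrite big_seq_cond sumr_ge0 // => z /andP[/mem_rem zt /andP[Qz _]]; exact: G0.
rewrite (exchange_big_dep Q) /=; last by move=> x y _ /andP[].
rewrite big_seq_cond [leRHS]big_seq_cond; apply: ler_sum => y /andP[yt Qy].
have [ys|yns] := boolP (phi y \in s); last first.
  rewrite big_seq_cond big1 ?G0 // => x /andP[xs /andP[_ /andP[_ /eqP E]]].
  by rewrite E xs in yns.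
rewrite -big_filter; set f := [seq _ <- _ | _].
have [->|] : f = [::] \/ f = [:: phi y].
  have uf : uniq f by exact: filter_uniq.
  have sf x : x \in f -> x = phi y by rewrite mem_filter => /andP[/andP[_ /andP[_ /eqP]]].
  case: f uf sf => [|a [|b f]] uf sf; first by left.
    by right; rewrite (sf a) ?inE.
  move: uf; rewrite /= (sf a) ?inE ?eqxx // (sf b) ?inE ?eqxx ?orbT //.
- by rewrite big_nil G0.
- by move=> ->; rewrite big_seq1.
Qed.

Section Bounds.
Variables (R : realType) (W : weights R) (g : int -> R).
Hypothesis ob : observable W g.
Local Notation weight := (word_weight W).

Definition bridge_sum (T N : nat) : R :=
  \sum_(w <- words N | bridge T w) weight origin w.
Definition arch_sum (T N : nat) : R :=
  \sum_(w <- words N | arch T w) weight origin w.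
Definition long_sum (L N : nat) : R :=
  \sum_(w <- words N | simple origin w && (L < size w)%N) weight origin w.

Lemma end_valueP T L w : box_walk T L w -> ~~ in_box T L (run origin w).1 ->
  (bridge T w)%:R * weight origin w + g 2 * ((arch T w)%:R * weight origin w)
   <= end_value W g w <=
  (bridge T w)%:R * weight origin w + g 2 * ((arch T w)%:R * weight origin w)
   + (g 1 + g (-1)) * ((L < size w)%N%:R * weight origin w).
Proof.
move=> hb ho; have w0 := weight_ge0 ob origin w; rewrite /end_value.
have [->|/omega_neq0_crossing_free hc] := eqVneq (weight origin w) 0.
  by rewrite !(mulr0, mul0r, addr0) lexx.
have g1 := ob_top ob; have g2 := ob_bottom ob; have g3 := ob_left ob.
have hst := box_strip hb; rewrite /bridge /arch hst /=.
have t0 : 0 <= (g 1 + g (-1)) * ((L < size w)%N%:R * weight origin w).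
  by rewrite !mulr_ge0 ?addr_ge0.
have neq : (T%:Z == -1) = false by apply/negP => /eqP; lia.
have neq' : (-1 == T%:Z) = false by apply/negP => /eqP; lia.
case: (exitP hb ho hc) => [h1 h2|h1 h2|h1 h2 h3 h4|h1 h2 h3 h4].
- rewrite h1 h2 (ob_right ob) neq eqxx !(mul0r, mulr0, mul1r, mulr1, addr0) lexx /=.
  by rewrite lerDl.
- rewrite h1 eqxx neq' !(mul0r, mulr0, mul1r, mulr1, add0r).
  have -> : g (sd (run origin w)) = g 2 by case: h2 => -> //; exact: ob_left' ob.
  by rewrite mulrC lexx /= lerDl.
- rewrite (negbTE h1) (negbTE h2) h3 h4 !(mul0r, mulr0, mul1r, mulr1, add0r) mulrC.
  by rewrite mulr_ge0 //= ler_wpM2r // lerDl.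
- rewrite (negbTE h1) (negbTE h2) h3 h4 !(mul0r, mulr0, mul1r, mulr1, add0r) mulrC.
  by rewrite mulr_ge0 //= ler_wpM2r // lerDr.
Qed.

Lemma sum_indicator (I : Type) (s : seq I) (P : pred I) (F : I -> R) :
  \sum_(x <- s) (P x)%:R * F x = \sum_(x <- s | P x) F x.
Proof.
rewrite [RHS]big_mkcond; apply: eq_bigr => x _.
by case: (P x); rewrite ?mul1r ?mul0r.
Qed.

(** Walks of length at most [N] stay within height [N], so these bridges and arches all occur in the
    identity for the box with [L = N], whose other terms are nonnegative. *)
Lemma strip_sum_le1 T N : bridge_sum T N + g 2 * arch_sum T N <= 1.
Proof.
rewrite -[leRHS](box_identity ob T N) /bridge_sum /arch_sum.
rewrite -(sum_indicator _ (bridge T)) -(sum_indicator _ (arch T)).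
rewrite mulr_sumr -big_split /=.
rewrite (bigID (fun w => bridge T w || arch T w)) /= [X in _ + X]big1 ?addr0; last first.
  by move=> w /norP[/negbTE-> /negbTE->]; rewrite !mul0r mulr0 addr0.
have nn w : 0 <= (bridge T w)%:R * weight origin w + g 2 * ((arch T w)%:R * weight origin w).
  have w0 := weight_ge0 ob origin w; have g3 := ob_left ob.
  have i0 b : 0 <= (b : bool)%:R * weight origin w by exact: mulr_ge0 (ler0n _ _) w0.
  exact: addr_ge0 (i0 _) (mulr_ge0 (ltW g3) (i0 _)).
apply: (@le_trans _ _ (\sum_(w <- box_walks T N | ~~ in_box T N (run origin w).1)
  ((bridge T w)%:R * weight origin w + g 2 * ((arch T w)%:R * weight origin w)))).
  apply: (@ler_sum_cover _ _ _ _ _ _ _ _ _ id) => [|//|w hw hP].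
    exact: words_uniq.
  exists w; split=> //.
    rewrite mem_box_walks; apply: strip_box; first by rewrite -mem_words.
    by case/orP: hP => /andP[].
  case/orP: hP => /andP[_ /eqP E]; move: E; rewrite /in_box /sx => ->.
    by rewrite ltxx andbF.
  by [].
rewrite big_seq_cond [leRHS]big_seq_cond; apply: ler_sum => w.
by rewrite mem_box_walks => /andP[h1 h2]; have /andP[] := end_valueP h1 h2.
Qed.

(** No walk of the box is longer than [N], so every term of the identity is counted; the exits at
    top and bottom have length above [L]. *)
Lemma strip_sum_ge1 T L : let N := box_size T L in
  1 <= bridge_sum T N + g 2 * arch_sum T N + (g 1 + g (-1)) * long_sum L N.
Proof.
cbv zeta; set N := box_size T L.
rewrite -[leLHS](box_identity ob T L) /bridge_sum /arch_sum /long_sum.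
rewrite -(sum_indicator _ (bridge T)) -(sum_indicator _ (arch T)).
rewrite -(sum_indicator _ (fun w => simple origin w && (L < size w)%N)).
rewrite !mulr_sumr -!big_split /=.
have nn w : 0 <= (bridge T w)%:R * weight origin w +
    g 2 * ((arch T w)%:R * weight origin w) +
    (g 1 + g (-1)) * ((simple origin w && (L < size w)%N)%:R * weight origin w).
  have w0 := weight_ge0 ob origin w; have g1 := ob_top ob.
  have g2 := ob_bottom ob; have g3 := ob_left ob.
  have i0 b : 0 <= (b : bool)%:R * weight origin w by exact: mulr_ge0 (ler0n _ _) w0.
  apply: addr_ge0; last exact: mulr_ge0 (addr_ge0 g1 g2) (i0 _).
  exact: addr_ge0 (i0 _) (mulr_ge0 (ltW g3) (i0 _)).
apply: (@ler_sum_cover _ _ _ _ _ _ _ _ _ id) => [|//|w hw hP].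
  exact: box_walks_uniq.
rewrite mem_box_walks in hw.
exists w; split=> //; first by rewrite mem_words ltnW // box_walk_size.
have /andP[_ h] := end_valueP hw hP; apply: (le_trans h).
by case/andP: hw => -> _.
Qed.
End Bounds.

(** * Cutting a walk at its last visit to its rightmost column *)

Definition turn_right (d : int) : turn :=
  if (d %% 4)%Z == 1 then Some false
  else if (d %% 4)%Z == 3 then Some true else None.

Lemma turn_rightP d : (d %% 4)%Z <> 2 -> ((d + tz (turn_right d)) %% 4)%Z = 0.
Proof.
rewrite /turn_right; case: eqP => [h _|h1]; first by rewrite /=; lia.
by case: eqP => [h _|h2 h3]; rewrite /=; lia.
Qed.

Lemma turn_right_unique d e : ((d + tz e) %% 4)%Z = 0 -> turn_right d = e.
Proof.
rewrite /turn_right; case: e => [[]|] /= h; have [h1|h1] := eqVneq (d %% 4)%Z 1 => //;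
  have [h2|h2] := eqVneq (d %% 4)%Z 3 => //; lia.
Qed.

Lemma last_such (A : Type) (p : pred A) (x0 : A) (s : seq A) : has p s ->
  exists i, [/\ (i < size s)%N, p (nth x0 s i) &
    forall j, (i < j)%N -> (j < size s)%N -> ~~ p (nth x0 s j)].
Proof.
move=> /(has_nthP x0)[i0 hi0 hp0].
pose q i := (i < size s)%N && p (nth x0 s i).
have q0 : exists i, q i by exists i0; rewrite /q hi0.
have qb i : q i -> (i <= size s)%N by move=> /andP[/ltnW].
have [i /andP[hi hp] hmax] := ex_maxnP q0 qb.
exists i; split=> // j ij hj; apply/negP => hpj.
by have := hmax j; rewrite /q hj hpj => /(_ isT); rewrite leqNgt ij.
Qed.

Lemma at_time_catl s P Q i : (i <= size P)%N -> at_time s (P ++ Q) i = at_time s P i.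
Proof. by move=> hi; rewrite /at_time takel_cat. Qed.

Lemma visits_cat s w w' : visits s (w ++ w') = visits s w ++ visits (run s w) w'.
Proof. by rewrite /visits labels_cat map_cat. Qed.

Section Cut.
Variables (T : int) (P Q : seq turn) (e : turn).
Let w := P ++ e :: Q.
Hypothesis w_simple : simple origin w.
Hypothesis w_left : forall r, r \in visits origin w -> r.1 <= T.
Hypothesis P_end : sx (run origin P) = T.
Hypothesis Q_left : forall r, r \in visits (step (run origin P) e) Q -> r.1 < T.

Let s := run origin P.
Let e' := turn_right (sd s).

Let size_P : (size P < size w)%N. Proof. by rewrite /w size_cat /= addnS ltnS leq_addr. Qed.

Let at_P i : (i <= size P)%N -> at_time origin w i = at_time origin P i.
Proof. by move=> hi; rewrite /w at_time_catl. Qed.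

Lemma not_from_right i : (i <= size P)%N -> sx (at_time origin w i) = T ->
  (sd (at_time origin w i) %% 4)%Z <> 2.
Proof.
case: i => [|i] hi hT; first by rewrite at_time0.
have hiw : (i < size w)%N by apply: ltn_trans size_P.
have h := word_x origin hiw; have h' : sx (at_time origin w i) <= T.
  by apply: w_left; apply/visitsP; exists i.
by move: h; rewrite hT; case: (dirP (sd (at_time origin w i.+1))) => -[hm -> _]; lia.
Qed.

Let s_dir : ((sd s + tz e') %% 4)%Z = 0.
Proof.
apply: turn_rightP; have := @not_from_right (size P) (leqnn _).
by rewrite at_P // at_time_size; apply.
Qed.

Let ex_s : ex (sd s + tz e') = 1.
Proof. by rewrite /ex s_dir. Qed.

Lemma cut_run : sx (run origin (rcons P e')) = T + 1 /\
  ((sd (run origin (rcons P e'))) %% 4)%Z = 0.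
Proof. by rewrite run_rcons sx_step -/s ex_s P_end. Qed.

Lemma cut_simple : simple origin (rcons P e').
Proof.
rewrite simple_rcons (@simple_catl _ _ (e :: Q)) //=; apply/negP => /midsP[i hi].
rewrite -at_P // => -[hx _].
have hT : sx (at_time origin w i) <= T.
  by apply: w_left; apply/visitsP; exists i => //; exact: leq_ltn_trans size_P.
move: hx; rewrite sx_step -/s ex_s P_end => hx.
have ed : sd (step s e') = sd s + tz e' by [].
rewrite ?ed ?ex_s in hx.
have [h1 h2] : sx (at_time origin w i) = T /\ ex (sd (at_time origin w i)) = -1.
  by move: hx hT; case: (dirP (sd (at_time origin w i))) => -[_ -> _] *; lia.
have := not_from_right hi h1; move: h2.
by case: (dirP (sd (at_time origin w i))) => -[-> -> _].
Qed.

Lemma cut_visits r : r \in visits origin (rcons P e') -> r \in visits origin w.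
Proof.
rewrite visits_rcons mem_rcons inE /w visits_cat mem_cat /= inE.
by case/orP => [->|->]; rewrite ?orbT.
Qed.

Lemma cut_rest : Q = [::] \/
  sx (step s e) = T - 1 /\ (sd (step s e) %% 4)%Z = 2.
Proof.
case: Q Q_left => [|f Q' h]; [by left|right].
have := h (step s e).1; rewrite inE eqxx => /(_ isT) h'.
have : sx (step s e) < T by [].
rewrite sx_step P_end /sd /=; set d := _ + tz e.
by case: (dirP d) => -[hm -> _]; move: hm; clear; lia.
Qed.

Lemma cut_rest_simple : simple (step s e) Q.
Proof.
have : simple origin (rcons P e ++ Q) by rewrite cat_rcons.
by move=> /simple_catr; rewrite run_rcons.
Qed.

(** With an earlier visit all four sides would be used, among them the right one. But column [T + 1]
    is never visited, and the last exit is not to the right since [e] differs from [e']. *)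
Lemma cut_new : e != e' -> s.1 \notin visits origin P.
Proof.
move=> ne; apply/negP => /visitsP[j hj hr].
have hPj : (j <= size P)%N by exact: ltnW.
have Es : at_time origin w (size P) = s by rewrite at_P // at_time_size.
have hr' : (at_time origin w j).1 = (at_time origin w (size P)).1 by rewrite Es at_P.
have [hx hy] := rhombus_eq hr'.
have hsT : sx (at_time origin w (size P)) = T by rewrite Es.
have hnth : nth None w (size P) = e by rewrite /w nth_cat ltnn subnn.
have hjw : (j < size w)%N by exact: ltn_trans size_P.
have dP := word_d origin size_P; rewrite hnth Es in dP.
have dj := word_d origin hjw.
have d1 := entry_distinct (word_distinct w_simple) hj (ltnW size_P) hx hy.
have d2 := exit_entry_distinct (@word_x origin w) (@word_y _ _)
  (word_distinct w_simple) hj (ltnW size_P) hx hy.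
have d3 := entry_exit_distinct (@word_x origin w) (@word_y _ _)
  (word_distinct w_simple) hj size_P hx hy.
have d4 := exit_exit_distinct (@word_x origin w) (@word_y _ _)
  (word_distinct w_simple) hj size_P hx hy.
have n1 := not_from_right (leqnn _) hsT.
have n2 : (sd (at_time origin w j) %% 4)%Z <> 2.
  by apply: not_from_right => //; rewrite hx.
have n3 : (sd (at_time origin w j.+1) %% 4)%Z <> 0.
  move=> h0; have := word_x origin hjw; rewrite hx hsT {1}/ex h0 /= => h1.
  have : sx (at_time origin w j.+1) <= T.
    apply: w_left; apply/visitsP; exists j.+1 => //.
    exact: leq_ltn_trans size_P.
  by rewrite h1; lia.
have n4 : (sd (at_time origin w (size P).+1) %% 4)%Z <> 0.
  by rewrite dP => /turn_right_unique E; rewrite /e' E eqxx in ne.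
have d5 := own_sides_distinct (@word_d origin w) hjw.
have d6 := own_sides_distinct (@word_d origin w) size_P.
move: d1 d2 d3 d4 d5 d6 n1 n2 n3 n4; clear.
move: (sd (at_time origin w j)) (sd (at_time origin w j.+1)).
move: (sd (at_time origin w (size P))) (sd (at_time origin w (size P).+1)) => *.
lia.
Qed.
End Cut.

Lemma cut_exists (T : int) w :
  (forall r, r \in visits origin w -> r.1 <= T) ->
  (exists2 r, r \in visits origin w & r.1 = T) ->
  exists P e Q, [/\ w = P ++ e :: Q, sx (run origin P) = T &
    forall r, r \in visits (step (run origin P) e) Q -> r.1 < T].
Proof.
move=> hle [r0 hr0 hT].
have : has (fun r : int * int => r.1 == T) (visits origin w).
  by apply/hasP; exists r0 => //; apply/eqP.
move=> /(last_such (0, 0))[i [hi /eqP hp hmax]].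
rewrite size_visits in hi hmax; rewrite nth_visits // in hp.
exists (take i w), (nth None w i), (drop i.+1 w); split=> //.
  by rewrite -drop_nth // cat_take_drop.
have E : visits origin w = visits origin (take i.+1 w) ++
    visits (step (run origin (take i w)) (nth None w i)) (drop i.+1 w).
  by rewrite -{1}(cat_take_drop i.+1 w) visits_cat (take_nth None hi) run_rcons.
move=> r hr; rewrite lt_neqAle hle ?andbT; last by rewrite E mem_cat hr orbT.
have [j hj <-] := nthP (0, 0) hr; rewrite size_visits size_drop in hj.
have := hmax (i.+1 + j)%N; rewrite E nth_cat size_visits size_take.
have -> : (if (i.+1 < size w)%N then i.+1 else size w) = i.+1 by case: ltnP => h; lia.
have -> : (i.+1 + j < i.+1)%N = false by lia.
by rewrite addKn => h; apply: h; lia.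
Qed.

(** * Generating functions *)

Section Decomposition.
Variables (R : realType) (W : weights R) (g : int -> R).
Hypothesis ob : observable W g.
Local Notation weight := (word_weight W).

Lemma weight_translate c k s w : (k %% 4)%Z = 0 ->
  weight (translate c k s) w = weight s w.
Proof.
move=> hk; rewrite /word_weight (labels_translate _ hk).
rewrite (omega_map W (phi := fun z => (c.1 + z.1, c.2 + z.2))) //.
by move=> [a b] [a' b'] /= [] /addrI -> /addrI ->.
Qed.

Lemma weight_rotate c k s w : (k %% 4)%Z = 2 -> weight (rotate c k s) w = weight s w.
Proof.
move=> hk; rewrite /word_weight (labels_rotate _ hk).
rewrite (omega_map W (phi := fun z => (c.1 - z.1, c.2 - z.2))) //.
by move=> [a b] [a' b'] /= [] /addrI /oppr_inj -> /addrI /oppr_inj ->.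
Qed.

Lemma weight_swap s w : weight (swap s) (map topp w) = weight s w.
Proof.
rewrite /word_weight labels_swap (omega_map W (phi := fun z => (z.2, z.1))) //.
by move=> [a b] [a' b'] /= [-> ->].
Qed.

Lemma weight_back s w : weight (turn_back (run s w)) (rev_word w) = weight s w.
Proof. by rewrite /word_weight labels_back; apply: omega_perm; rewrite perm_rev. Qed.

Lemma weight_cat_le s w w' : weight s (w ++ w') <= weight s w * weight (run s w) w'.
Proof. by rewrite /word_weight labels_cat; exact: omega_cat_le ob _ _. Qed.

(** Chosen to dominate every ratio between the weights of two single passages. *)
Definition turn_cost : R :=
  (u1 W + u2 W + v W) * ((u1 W)^-1 + (u2 W)^-1 + (v W)^-1).

Lemma wt1_le_cost k k' : wt1 W k <= turn_cost * wt1 W k'.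
Proof.
have h1 := ob_u1 ob; have h2 := ob_u2 ob; have h3 := ob_v ob.
have i1 : 0 < (u1 W)^-1 by rewrite invr_gt0. have i2 : 0 < (u2 W)^-1 by rewrite invr_gt0.
have i3 : 0 < (v W)^-1 by rewrite invr_gt0.
have hs : wt1 W k <= u1 W + u2 W + v W by case: k => [[]|] /=; lra.
have hi : (wt1 W k')^-1 <= (u1 W)^-1 + (u2 W)^-1 + (v W)^-1.
  by case: k' => [[]|] /=; lra.
have p := wt1_gt0 ob k'; rewrite /turn_cost -mulrA.
apply: (le_trans hs); rewrite ler_peMr //; first by lra.
by rewrite -ler_pdivrMr // mul1r.
Qed.

Lemma turn_cost_ge0 : 0 <= turn_cost.
Proof.
have h1 := ob_u1 ob; have h2 := ob_u2 ob; have h3 := ob_v ob.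
by rewrite mulr_ge0 // !addr_ge0 ?invr_ge0 // ltW.
Qed.

Lemma turn_cost_ge1 : 1 <= turn_cost.
Proof.
have := wt1_le_cost None None; have p := ob_v ob.
by rewrite /= -[leLHS]mul1r ler_pM2r.
Qed.

(** If the turn changes, [cut_new] says that its rhombus is new, and the change costs a ratio of
    single weights. *)
Lemma cut_weight T P Q e : let w := P ++ e :: Q in
  let s := run origin P in
  simple origin w -> (forall r, r \in visits origin w -> r.1 <= T) ->
  sx s = T ->
  weight origin w <= turn_cost *
    weight origin (rcons P (turn_right (sd s))) * weight (step s e) Q.
Proof.
cbv zeta; move=> hs hv hT.
rewrite -cat_rcons; apply: (le_trans (weight_cat_le _ _ _)); rewrite run_rcons.
rewrite ler_wpM2r ?(weight_ge0 ob) //.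
have [->|ne] := eqVneq e (turn_right (sd (run origin P))).
  by rewrite ler_peMl ?turn_cost_ge1 ?(weight_ge0 ob).
have hn := cut_new hs hv hT ne.
rewrite /word_weight !labels_rcons !omega_rcons_new //.
rewrite mulrCA ler_wpM2l ?(omega_ge0 ob) //.
exact: wt1_le_cost.
Qed.

Section FromLeft.
Variable s : state.
Hypothesis s_left : (sd s %% 4)%Z = 2.
Let to_origin : origin = rotate s.1 (- sd s) s.
Proof. by rewrite /rotate /sx /sy !subrr. Qed.
Let hk : ((- sd s) %% 4)%Z = 2. Proof. by lia. Qed.

Lemma left_simple w : simple s w = simple origin w.
Proof. by rewrite to_origin simple_rotate. Qed.

Lemma left_weight w : weight s w = weight origin w.
Proof. by rewrite to_origin weight_rotate. Qed.

Lemma left_visits w r : r \in visits origin w ->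
  exists2 r', r' \in visits s w & r.1 = sx s - r'.1.
Proof.
rewrite to_origin /visits (labels_rotate _ hk) => /mapP[l /mapP[l' hl' ->] ->] /=.
by exists l'.1 => //; apply: map_f.
Qed.

Lemma left_run w : sx (run origin w) = sx s - sx (run s w).
Proof. by rewrite to_origin run_rotate. Qed.
End FromLeft.

Lemma strip_walk_size N w : (size w <= N)%N -> simple origin w ->
  (forall r, r \in visits origin w -> 0 <= r.1) -> strip_walk N.+1 w.
Proof.
move=> hN hs h; rewrite /strip_walk hs; apply/allP => r hr.
rewrite /in_strip h //=; have := visits_dist hr.
rewrite (_ : sx origin = 0) // (_ : sy origin = 0) // !subr0.
move: hN; clear; case: r => a b /=; lia.
Qed.

(* The last turn of the first piece replaces the turn made where the walk was
   cut, which is the third component. *)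
Definition splice (y : seq turn * seq turn * turn) : seq turn :=
  take (size y.1.1).-1 y.1.1 ++ y.2 :: y.1.2.

Lemma splice_rcons P f Q e : splice (rcons P f, Q, e) = P ++ e :: Q.
Proof. by rewrite /splice size_rcons /= -cats1 take_size_cat. Qed.

Definition triples (N : nat) : seq (seq turn * seq turn * turn) :=
  [seq (p, e) | p <- [seq (b, Q) | b <- words N, Q <- words N], e <- turns].

Lemma mem_triples N b Q e : (size b <= N)%N -> (size Q <= N)%N ->
  (b, Q, e) \in triples N.
Proof.
move=> hb hQ; apply/allpairsP; exists ((b, Q), e) => /=; split=> //; last exact: mem_turns.
by apply/allpairsP; exists (b, Q); rewrite !mem_words.
Qed.

(** The factor 3 counts the turns that may have stood at the cut. *)
Lemma sum_triples N (A B : pred (seq turn)) (F G : seq turn -> R) :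
  \sum_(y <- triples N | A y.1.1 && B y.1.2) F y.1.1 * G y.1.2 =
  3 * ((\sum_(b <- words N | A b) F b) * (\sum_(Q <- words N | B Q) G Q)).
Proof.
rewrite big_mkcond /triples big_allpairs_dep big_allpairs_dep /=.
rewrite [\sum_(b <- _ | A b) _]big_mkcond mulr_suml mulr_sumr.
apply: eq_bigr => b _; rewrite [\sum_(Q <- _ | B Q) _]big_mkcond !mulr_sumr.
apply: eq_bigr => Q _; rewrite /turns !big_cons big_nil addr0 /=.
by case: (A b); case: (B Q) => /=; ring.
Qed.

Variable x : R.
Hypothesis x_ge0 : 0 <= x.

Definition gweight (w : seq turn) : R := weight origin w * x ^+ size w.

Definition bridge_gsum (T N : nat) : R := \sum_(w <- words N | bridge T w) gweight w.
Definition strip_gsum (T N : nat) : R := \sum_(w <- words N | strip_walk T w) gweight w.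
Definition simple_gsum (N : nat) : R := \sum_(w <- words N | simple origin w) gweight w.

Lemma gweight_ge0 w : 0 <= gweight w.
Proof. by rewrite mulr_ge0 ?exprn_ge0 ?(weight_ge0 ob). Qed.

Lemma gweight_cut w b Q : weight origin w <= turn_cost * weight origin b * weight origin Q ->
  size w = (size b + size Q)%N -> gweight w <= turn_cost * (gweight b * gweight Q).
Proof.
move=> h hs; rewrite /gweight hs exprD.
rewrite (_ : turn_cost * _ = turn_cost * weight origin b * weight origin Q *
  (x ^+ size b * x ^+ size Q)); last by ring.
by rewrite ler_wpM2r // mulr_ge0 // exprn_ge0.
Qed.

Lemma cut_rest_weight T P Q e : sx (run origin P) = T ->
  (forall r, r \in visits (step (run origin P) e) Q -> r.1 < T) ->
  weight (step (run origin P) e) Q = weight origin Q.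
Proof.
move=> hP hQ; have [->|[_ h2]] := cut_rest hP hQ; last exact: left_weight.
by rewrite /word_weight /= !omega_nil.
Qed.

Lemma cut_rest_origin T P Q e : sx (run origin P) = T ->
  (forall r, r \in visits (step (run origin P) e) Q -> r.1 < T) ->
  simple origin (P ++ e :: Q) ->
  simple origin Q /\ forall r, r \in visits origin Q ->
    exists2 r', r' \in visits (step (run origin P) e) Q & r.1 = T - 1 - r'.1.
Proof.
move=> hP hQ hs; have [->|[h1 h2]] := cut_rest hP hQ; first by [].
rewrite -(left_simple h2) (cut_rest_simple hs); split=> // r /(left_visits h2)[r' hr' ->].
by exists r'; rewrite // h1.
Qed.

Lemma size_splice (P Q : seq turn) (e f : turn) :
  size (P ++ e :: Q) = (size (rcons P f) + size Q)%N.
Proof. by rewrite size_cat size_rcons /= addnS. Qed.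

(* Cutting a walk in a strip at its last visit to the rightmost column. *)
Lemma strip_cut T N w : (size w <= N)%N -> strip_walk T.+1 w -> ~~ strip_walk T w ->
  exists b Q e, [/\ (b, Q, e) \in triples N, bridge T.+1 b, strip_walk T Q,
    splice (b, Q, e) = w & gweight w <= turn_cost * (gweight b * gweight Q)] /\
    (arch T.+1 w -> bridge T Q).
Proof.
move=> hN /andP[hs /allP hT1] hT.
have hle r : r \in visits origin w -> r.1 <= T%:Z.
  by move=> /hT1 /andP[_]; move: (r.1) => z; lia.
have hex : exists2 r, r \in visits origin w & r.1 = T%:Z.
  move: hT; rewrite /strip_walk hs /= => /allPn[r hr hr']; exists r => //.
  have := hle _ hr; have := hT1 _ hr; move: hr'; rewrite /in_strip.
  by move: (r.1) => z; clear; lia.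
have [P [e [Q [E hP hQ]]]] := cut_exists hle hex.
rewrite E in hs hle hT1 hN *.
set f := turn_right (sd (run origin P)).
exists (rcons P f), Q, e; rewrite (size_splice P Q e f) in hN.
have [hrun _] := cut_run hs hle hP.
have [hQs hQv] := cut_rest_origin hP hQ hs.
have hQT : strip_walk T Q.
  rewrite /strip_walk hQs; apply/allP => r /hQv[r' hr' E'].
  have := hQ _ hr'; have : 0 <= r'.1.
    have : in_strip T.+1 r'.
      by apply: hT1; rewrite visits_cat mem_cat /= inE hr' !orbT.
    by case/andP.
  by rewrite /in_strip E'; move: (r'.1) => z; clear; lia.
split; [split=> //|].
- by apply: mem_triples; apply: leq_trans hN; [exact: leq_addr|exact: leq_addl].
- rewrite /bridge hrun (_ : T%:Z + 1 = T.+1%:Z); last by lia.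
  rewrite eqxx andbT /strip_walk (cut_simple hs hle hP) /=.
  by apply/allP => r /(cut_visits Q e) /hT1.
- exact: splice_rcons.
- apply: gweight_cut; last exact: size_splice.
  by have := cut_weight hs hle hP; rewrite (cut_rest_weight hP hQ).
- move=> /andP[_ /eqP]; rewrite run_cat /= /bridge hQT /= => hend.
  (* If [Q] is empty, the arch steps from column [T] to column -1, so [T = 0] and the empty word is
     a bridge of width 0. *)
  have [EQ|[h1 h2]] := cut_rest hP hQ.
    move: hend; rewrite EQ /= sx_step hP.
    by case: (dirP (sd (run origin P) + tz e)) => -[_ -> _]; clear; rewrite /sx /=; lia.
  by rewrite (left_run h2) h1 hend; apply/eqP; clear; lia.
Qed.

Lemma gsum_cover N (S A B : pred (seq turn)) :
  (forall w, (size w <= N)%N -> S w -> exists b Q e, [/\ (b, Q, e) \in triples N,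
     A b, B Q, splice (b, Q, e) = w & gweight w <= turn_cost * (gweight b * gweight Q)]) ->
  \sum_(w <- words N | S w) gweight w <= 3 * turn_cost *
    ((\sum_(b <- words N | A b) gweight b) * (\sum_(Q <- words N | B Q) gweight Q)).
Proof.
move=> h.
have -> : 3 * turn_cost * ((\sum_(b <- words N | A b) gweight b) *
    (\sum_(Q <- words N | B Q) gweight Q)) =
  \sum_(y <- triples N | A y.1.1 && B y.1.2) turn_cost * gweight y.1.1 * gweight y.1.2.
  rewrite (sum_triples N A B (fun b => turn_cost * gweight b) gweight) -mulr_sumr.
  by ring.
apply: (@ler_sum_cover _ _ _ _ _ _ _ _ _ splice).
- exact: words_uniq.
- move=> y _ _; apply: mulr_ge0; last exact: gweight_ge0.
  by apply: mulr_ge0; [exact: turn_cost_ge0|exact: gweight_ge0].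
- move=> w; rewrite mem_words => hN hS; have [b [Q [e [h1 h2 h3 h4 h5]]]] := h w hN hS.
  by exists (b, Q, e); split=> //=; [rewrite h2|rewrite -mulrA].
Qed.

Lemma strip_walkS T w : strip_walk T w -> strip_walk T.+1 w.
Proof.
move=> /andP[hs /allP h]; rewrite /strip_walk hs; apply/allP => r /h.
by rewrite /in_strip; move: (r.1) => z; clear; lia.
Qed.

Lemma strip_gsumS T N : strip_gsum T.+1 N <=
  strip_gsum T N + 3 * turn_cost * (bridge_gsum T.+1 N * strip_gsum T N).
Proof.
rewrite {1}/strip_gsum (bigID (strip_walk T)) /=; apply: lerD.
  rewrite (eq_bigl (strip_walk T)) // => w.
  by apply/andP/idP => [[]//|h]; split=> //; exact: strip_walkS.
apply: gsum_cover => w hN /andP[h1 h2].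
have [b [Q [e [[k1 k2 k3 k4 k5] _]]]] := strip_cut hN h1 h2.
by exists b, Q, e.
Qed.

Definition arch_gsum (T N : nat) : R := \sum_(w <- words N | arch T w) gweight w.

(** An arch that reaches column [T] is cut there into a bridge of width [T.+1] and, after a
    half-turn, one of width [T]. *)
Lemma arch_gsumS T N : arch_gsum T.+1 N <=
  arch_gsum T N + 3 * turn_cost * (bridge_gsum T.+1 N * bridge_gsum T N).
Proof.
rewrite {1}/arch_gsum (bigID (strip_walk T)) /=; apply: lerD.
  rewrite (eq_bigl (arch T)) // => w; rewrite /arch.
  have [h|h] := boolP (strip_walk T w); last by rewrite andbF.
  by rewrite (strip_walkS h) andbT.
apply: gsum_cover => w hN /andP[h1 h2]; have /andP[h3 _] := h1.
have [b [Q [e [[k1 k2 k3 k4 k5] k6]]]] := strip_cut hN h3 h2.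
by exists b, Q, e; split=> //; exact: k6.
Qed.

Lemma max_column (s : seq (int * int)) : s != [::] ->
  exists2 r, r \in s & forall r', r' \in s -> r'.1 <= r.1.
Proof.
elim: s => [//|r [|r1 s] IH] _.
  by exists r; rewrite ?inE // => r'; rewrite inE => /eqP ->.
have [r2 h1 h2] := IH isT.
have [le|/ltW le] := lerP r.1 r2.1.
  exists r2; first by rewrite inE h1 orbT.
  by move=> r'; rewrite inE => /orP[/eqP->|/h2].
exists r; first by rewrite inE eqxx.
by move=> r'; rewrite inE => /orP[/eqP->//|/h2 h]; exact: le_trans h le.
Qed.

(* Cutting a walk at its last visit to its rightmost column leaves two walks
   in a half-plane, the first one traversed backwards. *)
Lemma simple_cut N w : (size w <= N)%N -> simple origin w && (w != [::]) ->
  exists b Q e, [/\ (b, Q, e) \in triples N,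
     strip_walk N.+1 (rev_word b) && (gweight b <= gweight (rev_word b)),
     strip_walk N.+1 Q, splice (b, Q, e) = w &
     gweight w <= turn_cost * (gweight b * gweight Q)].
Proof.
move=> hN /andP[hs wn0].
have vn0 : visits origin w != [::] by rewrite -size_eq0 size_visits size_eq0.
have [r0 hr0 hle0] := max_column vn0; pose T : int := r0.1.
have hle r : r \in visits origin w -> r.1 <= T by exact: hle0.
have hex : exists2 r, r \in visits origin w & r.1 = T by exists r0.
have [P [e [Q [E hP hQ]]]] := cut_exists hle hex.
rewrite E in hs hle hN *.
set f := turn_right (sd (run origin P)); rewrite (size_splice P Q e f) in hN.
have [hrun hdir] := cut_run hs hle hP; rewrite -/f in hrun hdir.
have hbs := cut_simple hs hle hP; rewrite -/f in hbs.
have [hQs hQv] := cut_rest_origin hP hQ hs.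
have hbN : (size (rcons P f) <= N)%N by apply: leq_trans hN; exact: leq_addr.
have hQN : (size Q <= N)%N by apply: leq_trans hN; exact: leq_addl.
set b := rcons P f; set s := turn_back (run origin b).
have hsd : (sd s %% 4)%Z = 2.
  rewrite (_ : sd s = sd (run origin b) + 2) //; move: hdir; rewrite -/b.
  by move: (sd _) => z; clear; lia.
have hsx : sx s = T.
  rewrite (_ : sx s = sx (run origin b) - ex (sd (run origin b))) //.
  by rewrite /ex hdir hrun eqxx; clear; lia.
have hrs : simple s (rev_word b) by rewrite /s simple_back.
have hro : simple origin (rev_word b) by rewrite -(left_simple hsd).
have hrw : weight origin (rev_word b) = weight origin b.
  by rewrite -(left_weight hsd) /s weight_back.
exists b, Q, e; split.
- exact: mem_triples.
- rewrite /gweight hrw size_rev_word lexx andbT.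
  apply: strip_walk_size => //; first by rewrite size_rev_word.
  move=> r /(left_visits hsd)[r' hr' ->]; rewrite hsx subr_ge0.
  move: hr'; rewrite /s /visits labels_back map_rev mem_rev => hr'.
  by apply/hle/(cut_visits Q e hr').
- apply: strip_walk_size => // r /hQv[r' hr' ->].
  by have := hQ _ hr'; move: (r'.1) => z; clear; lia.
- exact: splice_rcons.
- apply: gweight_cut; last exact: size_splice.
  by have := cut_weight hs hle hP; rewrite (cut_rest_weight hP hQ).
Qed.

Lemma nil_gsum_le N (A : pred (seq turn)) :
  \sum_(w <- words N | A w && (w == [::])) gweight w <= 1.
Proof.
have -> : 1 = \sum_(w <- [:: [::]] | xpredT w) gweight w.
  by rewrite big_seq1 /gweight /word_weight omega_nil expr0 mulr1.
apply: (@ler_sum_cover _ _ _ _ _ _ _ _ _ id); first exact: words_uniq.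
  by move=> w _ _; exact: gweight_ge0.
by move=> w _ /andP[_ /eqP ->]; exists [::]; rewrite inE.
Qed.

Lemma simple_gsum_le N :
  simple_gsum N <= 1 + 3 * turn_cost * (strip_gsum N.+1 N * strip_gsum N.+1 N).
Proof.
rewrite /simple_gsum (bigID (fun w => w == [::])) /=; apply: lerD.
  exact: (nil_gsum_le N (simple origin)).
apply: (le_trans (gsum_cover (@simple_cut N))).
apply: ler_wpM2l; first by apply: mulr_ge0 => //; exact: turn_cost_ge0.
apply: ler_wpM2r; first by apply: sumr_ge0 => w _; exact: gweight_ge0.
apply: (@ler_sum_cover _ _ _ _ _ _ _ _ _ rev_word).
- exact: words_uniq.
- by move=> w _ _; exact: gweight_ge0.
- move=> w; rewrite mem_words => hN /andP[h1 h2]; exists (rev_word w).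
  by rewrite mem_words size_rev_word rev_wordK.
Qed.

Lemma strip_gsum0 N : strip_gsum 0 N <= 1.
Proof.
apply: le_trans (nil_gsum_le N xpredT); rewrite /strip_gsum.
rewrite (eq_bigl (fun w => xpredT w && (w == [::]))) // => w /=.
by apply/andP/eqP => [[_]|-> //]; case: w.
Qed.

Lemma bridge_size T w : bridge T w -> (T <= size w)%N.
Proof.
move=> /andP[_ /eqP h]; have := run_dist origin w; rewrite h.
rewrite (_ : sx origin = 0) // subr0; move: (sy _) => z.
by move: (size w) => n; clear; lia.
Qed.

Hypothesis x_le1 : x <= 1.

Lemma bridge_gsum_le T N : bridge_gsum T N <= x ^+ T.
Proof.
apply: (@le_trans _ _ (x ^+ T * bridge_sum W T N)).
  rewrite /bridge_gsum /bridge_sum mulr_sumr; apply: ler_sum => w hw.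
  rewrite /gweight mulrC ler_wpM2r ?(weight_ge0 ob) //.
  by apply: ler_wiXn2l => //; exact: bridge_size.
rewrite ler_piMr ?exprn_ge0 //; apply: le_trans (strip_sum_le1 ob T N).
by rewrite lerDl mulr_ge0 ?(ltW (ob_left ob)) // sumr_ge0 // => w _; exact: weight_ge0 ob _ _.
Qed.

(** The recursion multiplies the bound by [1 + 3 * turn_cost * x ^+ t] at each width [t], which is
    at most an exponential. *)
Lemma strip_gsum_le T N :
  strip_gsum T N <= expR (3 * turn_cost * \sum_(t < T) x ^+ t.+1).
Proof.
elim: T => [|T IH]; first by rewrite big_ord0 mulr0 expR0 strip_gsum0.
have K0 := turn_cost_ge0.
have s0 : 0 <= strip_gsum T N by apply: sumr_ge0 => w _; exact: gweight_ge0.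
apply: (le_trans (strip_gsumS T N)).
apply: (@le_trans _ _ (strip_gsum T N * (1 + 3 * turn_cost * x ^+ T.+1))).
  rewrite mulrDr mulr1 lerD2l (_ : _ * (_ * _) =
    strip_gsum T N * (3 * turn_cost * bridge_gsum T.+1 N)); last by ring.
  apply: (ler_wpM2l s0); apply: ler_wpM2l; first exact: mulr_ge0.
  exact: bridge_gsum_le.
rewrite big_ord_recr /= [in leRHS]mulrDr expRD; apply: ler_pM => //.
  by apply: addr_ge0 => //; apply: mulr_ge0; [exact: mulr_ge0|exact: exprn_ge0].
exact: expR_ge1Dx.
Qed.
End Decomposition.

Lemma geometric_le (R : realType) (x : R) T : 0 < x < 1 ->
  \sum_(t < T) x ^+ t.+1 <= (1 - x)^-1.
Proof.
move=> /andP[x0 x1].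
suff h : (\sum_(t < T) x ^+ t.+1) * (1 - x) = x - x ^+ T.+1.
  rewrite -[leRHS]mul1r ler_pdivlMr ?subr_gt0 // h.
  by apply: (@le_trans _ _ x); [rewrite gerBl exprn_ge0 // ltW|exact: ltW].
elim: T => [|T IH]; first by rewrite big_ord0 mul0r expr1 subrr.
by rewrite big_ord_recr /= mulrDl IH mulrBr mulr1 -exprSr addrA subrK.
Qed.

Lemma simple_gsum_bounded (R : realType) (W : weights R) (g : int -> R) (x : R) :
  observable W g -> 0 < x < 1 -> exists C, forall N, simple_gsum W x N <= C.
Proof.
move=> ob hx; have /andP[x0 x1] := hx.
pose E := expR (3 * turn_cost W * (1 - x)^-1).
have K0 := turn_cost_ge0 ob.
exists (1 + 3 * turn_cost W * (E * E)) => N.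
apply: (le_trans (simple_gsum_le ob (ltW x0) N)).
have hE : strip_gsum W x N.+1 N <= E.
  apply: (le_trans (strip_gsum_le ob (ltW x0) (ltW x1) N.+1 N)).
  rewrite ler_expR; apply: ler_wpM2l; first exact: mulr_ge0.
  exact: geometric_le.
have h0 : 0 <= strip_gsum W x N.+1 N.
  by apply: sumr_ge0 => w _; apply: (gweight_ge0 ob); exact: ltW.
rewrite lerD2l; apply: ler_wpM2l; first exact: mulr_ge0.
exact: ler_pM.
Qed.

(** * Submultiplicativity and the lower bound *)

Section AnyState.
Variables (R : realType) (W : weights R) (g : int -> R).
Hypothesis ob : observable W g.
Local Notation weight := (word_weight W).

(* A diagonal reflection exchanges the two kinds of edges. *)
Definition normal_word (d : int) (w : seq turn) : seq turn :=
  if (d %% 2)%Z == 0 then w else map topp w.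

Lemma normal_wordK d : involutive (normal_word d).
Proof.
move=> w; rewrite /normal_word; case: (_ == 0) => //.
by rewrite -map_comp (eq_map toppK) map_id.
Qed.

Lemma size_normal_word d w : size (normal_word d w) = size w.
Proof. by rewrite /normal_word; case: ifP => // _; rewrite size_map. Qed.

Lemma even_state s w : (sd s %% 2)%Z = 0 ->
  weight s w = weight origin w /\ simple s w = simple origin w.
Proof.
move=> h; have [h4|h4] : (sd s %% 4)%Z = 0 \/ (sd s %% 4)%Z = 2.
- by move: h; clear; lia.
- have E : origin = translate (- sx s, - sy s) (- sd s) s.
    by rewrite /translate /= !addNr subrr.
  have hk : ((- sd s) %% 4)%Z = 0 by move: h4; clear; lia.
  by rewrite E weight_translate // simple_translate.
- by rewrite left_weight // left_simple.
Qed.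

Lemma state_normal s w : weight s w = weight origin (normal_word (sd s) w) /\
  simple s w = simple origin (normal_word (sd s) w).
Proof.
rewrite /normal_word; case: eqP => h; first exact: even_state.
have h' : (sd (swap s) %% 2)%Z = 0.
  rewrite (_ : sd (swap s) = 1 - sd s) //.
  by move: h; clear; lia.
by have [<- <-] := even_state (map topp w) h'; rewrite weight_swap simple_swap.
Qed.

Definition length_sum (s : state) (n : nat) : R :=
  \sum_(w <- words n | simple s w && (size w == n)) weight s w.

Lemma length_sum_state s n : length_sum s n = length_sum origin n.
Proof.
have key s1 s2 (nu : seq turn -> seq turn) : involutive nu ->
    (forall w, size (nu w) = size w) ->
    (forall w, weight s1 w = weight s2 (nu w) /\ simple s1 w = simple s2 (nu w)) ->
    length_sum s1 n <= length_sum s2 n.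
  move=> nuK hsz h; apply: (@ler_sum_cover _ _ _ _ _ _ _ _ _ nu).
  - exact: words_uniq.
  - by move=> w _ _; exact: weight_ge0 ob _ _.
  - move=> w; rewrite mem_words => hw /andP[h1 h2]; exists (nu w).
    by have [e1 e2] := h w; rewrite mem_words hsz nuK -e2 h1 h2 e1.
have sz := size_normal_word (sd s).
apply/eqP; rewrite eq_le (key s origin (normal_word (sd s))) //; last 2 first.
- exact: normal_wordK.
- by move=> w; exact: state_normal.
rewrite /= (key origin s (normal_word (sd s))) //; first exact: normal_wordK.
by move=> w; have [-> ->] := state_normal s (normal_word (sd s) w); rewrite normal_wordK.
Qed.

Lemma length_sum_ge0 s n : 0 <= length_sum s n.
Proof. by apply: sumr_ge0 => w _; exact: weight_ge0 ob _ _. Qed.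

(** The walk is cut after [n] turns; the second part may start on either kind of edge, and
    [normal_word] carries it to the origin. *)
Lemma length_sum_submul n m :
  length_sum origin (n + m) <= length_sum origin n * length_sum origin m.
Proof.
rewrite /length_sum; pose t := [seq (a, b) | a <- words n, b <- words m].
pose A (y : seq turn * seq turn) := simple origin y.1 && (size y.1 == n).
pose B (y : seq turn * seq turn) := simple origin y.2 && (size y.2 == m).
have -> : (\sum_(a <- words n | simple origin a && (size a == n)) weight origin a) *
    (\sum_(b <- words m | simple origin b && (size b == m)) weight origin b) =
  \sum_(y <- t | A y && B y) weight origin y.1 * weight origin y.2.
  rewrite [RHS]big_mkcond /t big_allpairs_dep /= big_mkcond mulr_suml.
  apply: eq_bigr => a _; rewrite [X in _ * X]big_mkcond mulr_sumr.
  by apply: eq_bigr => b _; rewrite /A /B /=; case: ifP => //= _; case: ifP => _;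
    rewrite ?mul0r ?mulr0.
pose phi (y : seq turn * seq turn) :=
  y.1 ++ normal_word (sd (run origin y.1)) y.2.
apply: (@ler_sum_cover _ _ _ _ _ _ _ _ _ phi).
- exact: words_uniq.
- by move=> y _ _; rewrite mulr_ge0 ?(weight_ge0 ob).
move=> w; rewrite mem_words => _ /andP[h1 /eqP h2].
have hn : size (take n w) = n by rewrite size_takel // h2 leq_addr.
have hm : size (drop n w) = m by rewrite size_drop h2 addKn.
have E := cat_take_drop n w.
exists (take n w, normal_word (sd (run origin (take n w))) (drop n w)).
rewrite /A /B /phi /= normal_wordK size_normal_word hn hm !eqxx E.
have [<- <-] := state_normal (run origin (take n w)) (drop n w).
rewrite -E in h1; rewrite (simple_catl h1) (simple_catr h1); split=> //.
  apply/allpairsP.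
  exists (take n w, normal_word (sd (run origin (take n w))) (drop n w)).
  by rewrite !mem_words /= size_normal_word hn hm.
by rewrite -[X in weight _ X <= _]E; exact: (weight_cat_le ob).
Qed.

Lemma long_sum_le L N :
  long_sum W L N <= \sum_(n < N.+1 | (L < n)%N) length_sum origin n.
Proof.
pose F (w : seq turn) (n : 'I_N.+1) : R :=
  if size w == n then weight origin w else 0.
have -> : long_sum W L N = \sum_(w <- words N | simple origin w && (L < size w)%N)
    \sum_(n < N.+1 | (L < n)%N) F w n.
  rewrite /long_sum big_seq_cond [RHS]big_seq_cond; apply: eq_bigr => w.
  rewrite mem_words => /and3P[hN _ hL].
  have hN1 : (size w < N.+1)%N by [].
  rewrite (bigD1 (Ordinal hN1)) //= /F eqxx big1 ?addr0 // => n /andP[_ ne].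
  by case: eqP => // E; move: ne; rewrite -val_eqE /= E eqxx.
rewrite exchange_big /=; apply: ler_sum => n hn.
rewrite /F -big_mkcondr /=.
apply: (@ler_sum_cover _ _ _ _ _ _ _ _ _ id).
- exact: words_uniq.
- by move=> w _ _; exact: weight_ge0 ob _ _.
- by move=> w _ /andP[/andP[h1 h2] /eqP h3]; exists w; rewrite mem_words h1 h3 leqnn eqxx.
Qed.
End AnyState.

Local Open Scope classical_set_scope.
Local Open Scope ring_scope.

Lemma bernoulli_le (R : realType) (y : R) n : 0 <= y <= 1 -> 1 - n%:R * y <= (1 - y) ^+ n.
Proof.
move=> /andP[y0 y1]; elim: n => [|n IH]; first by rewrite mul0r subr0 expr0.
rewrite exprS; apply: (@le_trans _ _ ((1 - y) * (1 - n%:R * y))); last first.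
  by rewrite ler_wpM2l // subr_ge0.
have n0 : 0 <= n%:R * y * y by rewrite !mulr_ge0.
rewrite -natr1; lra.
Qed.

Lemma submultiplicative_decay (R : realType) (f : nat -> R) (n0 : nat) :
  (forall n, 0 <= f n) -> (forall n m, f (n + m)%N <= f n * f m) ->
  (0 < n0)%N -> f n0 < 1 ->
  exists C r, [/\ 0 < r, r < 1, 0 <= C & forall n, f n <= C * r ^+ n].
Proof.
move=> f0 fM n00 fn0.
(* The maximum keeps [r] positive below. By Bernoulli, [r = 1 - (1 - q) / n0] has [q <= r ^+ n0],
   which replaces taking a root of [q]. *)
pose q := Num.max (f n0) (1 / 2 : R).
have q1 : q < 1 by rewrite gt_max fn0 /=; lra.
have qh : 1 / 2 <= q by rewrite le_max lexx orbT.
have qf : f n0 <= q by rewrite le_max lexx.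
pose y := (1 - q) / n0%:R; pose r := 1 - y.
have n0r : 1 <= n0%:R :> R by rewrite ler1n.
have n0p : 0 < n0%:R :> R by lra.
have yn : n0%:R * y = 1 - q by rewrite /y mulrCA divff ?mulr1 // gt_eqF.
have y0 : 0 < y by rewrite divr_gt0 ?subr_gt0.
have y1 : y <= 1 - q.
  by rewrite -[leRHS]yn ler_peMl // ltW.
have r0 : 0 < r by rewrite /r; lra.
have r1 : r < 1 by rewrite /r; lra.
have rq : q <= r ^+ n0.
  have := @bernoulli_le R y n0; rewrite yn -/r => h.
  by apply: le_trans (h _); [lra|apply/andP; split; lra].
pose M := \sum_(j < n0) f j.
have M0 : 0 <= M by apply: sumr_ge0.
have fk k j : (j < n0)%N -> f (k * n0 + j)%N <= q ^+ k * M.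
  move=> hj; elim: k => [|k IH].
    rewrite mul0n add0n expr0 mul1r /M (bigD1 (Ordinal hj)) //= lerDl.
    exact: sumr_ge0.
  rewrite mulSn -addnA exprS -mulrA; apply: (le_trans (fM _ _)).
  exact: ler_pM.
(* Rounding [n] down to a multiple of [n0] loses less than [n0], hence the division by [r ^+ n0]. *)
exists (M / r ^+ n0), r; split=> // [|n].
  by rewrite divr_ge0 // exprn_ge0 // ltW.
rewrite {1}(divn_eq n n0); have hj : (n %% n0 < n0)%N by rewrite ltn_mod.
apply: (le_trans (fk _ _ hj)).
apply: (@le_trans _ _ (r ^+ (n %/ n0 * n0) * M)).
  apply: ler_wpM2r => //; rewrite mulnC exprM.
  by apply: lerXn2r => //; rewrite nnegrE ?exprn_ge0 ?ltW //; lra.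
rewrite mulrC -mulrA; apply: ler_wpM2l => //.
rewrite ler_pdivlMl ?exprn_gt0 // -exprD [X in _ <= _ ^+ X](divn_eq n n0) addnC.
by apply: ler_wiXn2l; rewrite ?ltW // leq_add2l ltnW.
Qed.

Lemma geometric_tail (R : realType) (r : R) (L N : nat) : 0 < r < 1 ->
  \sum_(n < N | (L < n)%N) r ^+ n <= r ^+ L / (1 - r).
Proof.
move=> /andP[r0 r1]; rewrite ler_pdivlMr ?subr_gt0 //.
suff : (\sum_(n < N | (L < n)%N) r ^+ n) * (1 - r) <= r ^+ L - r ^+ (maxn L N).
  by move=> h; apply: (le_trans h); rewrite gerBl; apply/exprn_ge0/ltW.
elim: N => [|N IH]; first by rewrite big_ord0 mul0r maxn0 subrr.
rewrite big_mkcond big_ord_recr /= -big_mkcond /= mulrDl.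
case: ltnP => hN.
  move: IH; rewrite (maxn_idPr (ltnW hN)) (maxn_idPr (leqW (ltnW hN))) => IH.
  by rewrite exprS; lra.
rewrite mul0r addr0; apply: (le_trans IH); rewrite lerD2l lerN2 (maxn_idPl hN).
by apply: ler_wiXn2l; rewrite ?ltW // leq_maxl.
Qed.

(** * The lower bound 1 for the total weight of each length *)

Section LowerBound.
Variables (R : realType) (W : weights R) (g : int -> R).
Hypothesis ob : observable W g.

Let weight0 s w : 0 <= word_weight W s w := weight_ge0 ob s w.

Lemma sum_words_mono (A : pred (seq turn)) :
  nondecreasing_seq (fun N => \sum_(w <- words N | A w) word_weight W origin w).
Proof.
move=> N M NM; apply: (@ler_sum_cover _ _ _ _ _ _ _ _ _ id) => //.
  exact: words_uniq.
move=> w; rewrite mem_words => hN hA; exists w.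
by rewrite mem_words (leq_trans hN NM).
Qed.

Lemma gsum1 (A : pred (seq turn)) N :
  \sum_(w <- words N | A w) gweight W 1 w = \sum_(w <- words N | A w) word_weight W origin w.
Proof. by apply: eq_bigr => w _; rewrite /gweight expr1n mulr1. Qed.

Lemma arch_sumS T N : arch_sum W T.+1 N <=
  arch_sum W T N + 3 * turn_cost W * (bridge_sum W T.+1 N * bridge_sum W T N).
Proof. by have := arch_gsumS ob ler01 T N; rewrite /arch_gsum /bridge_gsum !gsum1. Qed.

Lemma bridge_sum_ge0 T N : 0 <= bridge_sum W T N.
Proof. exact: sumr_ge0. Qed.

Lemma arch_sum_ge0 T N : 0 <= arch_sum W T N.
Proof. exact: sumr_ge0. Qed.

Lemma bridge_sum_le1 T N : bridge_sum W T N <= 1.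
Proof.
apply: le_trans (strip_sum_le1 ob T N); rewrite lerDl.
exact: mulr_ge0 (ltW (ob_left ob)) (arch_sum_ge0 _ _).
Qed.

Lemma arch_sum_le T N : arch_sum W T N <= (g 2)^-1.
Proof.
rewrite -[leRHS]mul1r ler_pdivlMr ?(ob_left ob) // mulrC.
by apply: le_trans (strip_sum_le1 ob T N); rewrite lerDr bridge_sum_ge0.
Qed.

(** A walk is a bridge for one width at most, so no weight is counted twice. *)
Lemma bridge_sums_le T N :
  \sum_(t < T) bridge_sum W t N <= \sum_(w <- words N | simple origin w) word_weight W origin w.
Proof.
rewrite /bridge_sum (exchange_big_dep (simple origin)) /=; last first.
  by move=> t w _ /andP[/andP[]].
apply: ler_sum => w hw.
have [[t0 ht0]|no] := pselect (exists t : 'I_T, bridge t w); last first.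
  by rewrite big_pred0 // => t; apply/negP => h; apply: no; exists t.
rewrite (bigD1 t0) //= big_pred0 ?addr0 // => t.
apply/negP => /andP[/andP[_ /eqP h1] /negP]; apply; apply/eqP/val_inj.
by case/andP: ht0 => _; rewrite h1 => /eqP[].
Qed.

Section Contradiction.
Variables (C r : R).
Hypothesis r_gt0 : 0 < r.
Hypothesis r_lt1 : r < 1.
Hypothesis C_ge0 : 0 <= C.
Hypothesis decay : forall n, length_sum W origin n <= C * r ^+ n.

Let S := 1 + C / (1 - r).

Lemma long_sum_decay L N : long_sum W L N <= C * (r ^+ L / (1 - r)).
Proof.
apply: (le_trans (long_sum_le ob L N)).
apply: (@le_trans _ _ (\sum_(n < N.+1 | (L < n)%N) C * r ^+ n)).
  by apply: ler_sum.
rewrite -mulr_sumr; apply: ler_wpM2l => //.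
by apply: geometric_tail; rewrite r_gt0.
Qed.

Lemma simple_sum_bounded N :
  \sum_(w <- words N | simple origin w) word_weight W origin w <= S.
Proof.
have := long_sum_decay 0 N; rewrite expr0 div1r => h.
rewrite (bigID (fun w => w == [::])) /=; apply: lerD.
  have := nil_gsum_le ob (x := 1) ler01 N (simple origin).
  by rewrite gsum1.
apply: le_trans h; rewrite /long_sum le_eqVlt; apply/orP; left; apply/eqP.
by apply: eq_bigl => w; rewrite lt0n size_eq0.
Qed.

Let mono_cvg (A : pred (seq turn)) (B : R) :
    (forall N, \sum_(w <- words N | A w) word_weight W origin w <= B) ->
  exists l, (\sum_(w <- words N | A w) word_weight W origin w) @[N --> \oo] --> l /\
    forall N, \sum_(w <- words N | A w) word_weight W origin w <= l.
Proof.
move=> hB; have hm := sum_words_mono A.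
have hc := nondecreasing_is_cvgn hm (ex_intro _ B _).
eexists; split; first by apply: hc; move=> _ [N _ <-].
by move=> N; apply: nondecreasing_cvgn_le => //; apply: hc => _ [M _ <-].
Qed.

Lemma decay_impossible : False.
Proof.
have /choice[b hb] : forall T, exists l,
    bridge_sum W T N @[N --> \oo] --> l /\ forall N, bridge_sum W T N <= l.
  by move=> T; apply: mono_cvg => N; exact: bridge_sum_le1.
have /choice[a ha] : forall T, exists l,
    arch_sum W T N @[N --> \oo] --> l /\ forall N, arch_sum W T N <= l.
  by move=> T; apply: mono_cvg => N; exact: arch_sum_le.
have g2 := ob_left ob; have K0 := turn_cost_ge0 ob.
have b0 T : 0 <= b T by exact: le_trans (bridge_sum_ge0 T 0) ((hb T).2 0).
have idT T : b T + g 2 * a T = 1.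
  apply/eqP; rewrite eq_le; apply/andP; split.
    have h : bridge_sum W T N + g 2 * arch_sum W T N @[N --> \oo] --> b T + g 2 * a T.
      by apply: cvgD; [exact: (hb T).1|apply: cvgMl_tmp; exact: (ha T).1].
    apply: (cvgr_to_le h); apply: nearW => N.
    exact: (strip_sum_le1 ob T N).
  pose D := (g 1 + g (-1)) * (C / (1 - r)).
  have h : 1 - D * r ^+ L @[L --> \oo] --> 1 - D * 0.
    apply: cvgB; first exact: cvg_cst.
    by apply: cvgMl_tmp; apply: cvg_expr; rewrite ger0_norm // ltW.
  rewrite mulr0 subr0 in h; apply: (cvgr_to_le h); apply: nearW => L.
  have h1 := strip_sum_ge1 ob T L; have h2 := long_sum_decay L (box_size T L).
  have h3 := (hb T).2 (box_size T L); have h4 := (ha T).2 (box_size T L).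
  have h5 : 0 <= g 1 + g (-1) by exact: addr_ge0 (ob_top ob) (ob_bottom ob).
  have h6 := ler_wpM2l h5 h2; have h7 := ler_wpM2l (ltW g2) h4.
  rewrite lerBlDr; apply: (le_trans h1); apply: lerD; first exact: lerD.
  by apply: (le_trans h6); rewrite /D le_eqVlt; apply/orP; left; apply/eqP; ring.
pose k := g 2 * (3 * turn_cost W).
have k0 : 0 <= k by apply: mulr_ge0; [exact: ltW|exact: mulr_ge0].
(* By [idT], the drop from [b T] to [b T.+1] is [g 2] times the growth of [a], which the cut of
   arches bounds. *)
have rec T : b T <= b T.+1 * (1 + k * b T).
  have hr : a T.+1 <= a T + 3 * turn_cost W * (b T.+1 * b T).
    apply: (cvgr_to_le (ha T.+1).1); apply: nearW => N.
    apply: (le_trans (arch_sumS T N)); apply: lerD; first exact: (ha T).2.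
    apply: ler_wpM2l; first exact: mulr_ge0.
    by apply: ler_pM; rewrite ?bridge_sum_ge0 // ?(hb _).2.
  have := ler_wpM2l (ltW g2) hr; have := idT T; have := idT T.+1; rewrite /k.
  set p := b T.+1; set q := b T; set p' := a T.+1; set q' := a T.
  move: (turn_cost W) (g 2) => K G e1 e2 e3; nra.
(* The empty walk is a bridge of width 0. *)
have b00 : 1 <= b 0%N.
  apply: le_trans ((hb 0%N).2 0%N); rewrite /bridge_sum.
  have -> : 1 = \sum_(w <- [:: [::]] | xpredT w) word_weight W origin w.
    by rewrite big_seq1 /word_weight omega_nil.
  apply: (@ler_sum_cover _ _ _ _ _ _ _ _ _ id) => // w; rewrite inE => /eqP -> _.
  by exists [::]; rewrite mem_words.
have lower T : 1 <= b T * expR (k * \sum_(t < T) b t).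
  elim: T => [|T IH]; first by rewrite big_ord0 mulr0 expR0 mulr1.
  rewrite big_ord_recr /= mulrDr [_ + k * b T]addrC expRD mulrA.
  apply: (le_trans IH); apply: ler_wpM2r; first exact: expR_ge0.
  apply: (le_trans (rec T)); apply: ler_wpM2l => //; exact: expR_ge1Dx.
have upper T : \sum_(t < T) b t <= S.
  have h : \sum_(t < T) bridge_sum W t N @[N --> \oo] --> \sum_(t < T) b t.
    elim: T => [|T IH].
      rewrite big_ord0; under eq_fun do rewrite big_ord0.
      exact: cvg_cst.
    rewrite big_ord_recr /=; under eq_fun do rewrite big_ord_recr /=.
    by apply: cvgD => //; exact: (hb T).1.
  apply: (cvgr_to_le h); apply: nearW => N.
  by apply: le_trans (bridge_sums_le T N) (simple_sum_bounded N).
pose m := expR (- (k * S)).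
have m0 : 0 < m by exact: expR_gt0.
have bm T : m <= b T.
  have e0 := expR_gt0 (k * \sum_(t < T) b t).
  have := lower T; rewrite -ler_pdivrMr // div1r -expRN => h.
  apply: le_trans h; rewrite ler_expR lerN2; exact: ler_wpM2l.
have Tm T : T%:R * m <= S.
  apply: le_trans (upper T); rewrite mulr_natl -[T in leLHS]card_ord -sumr_const.
  by apply: ler_sum.
have S0 : 0 <= S by have := Tm 0%N; rewrite mul0r.
have := Tm (Num.bound (S / m)); apply/negP; rewrite -ltNge -ltr_pdivrMr //.
by apply: archi_boundP; rewrite divr_ge0 // ltW.
Qed.
End Contradiction.

Lemma length_sum0 : length_sum W origin 0 = 1.
Proof.
rewrite /length_sum; have -> : words 0 = [:: [::]].
  apply: perm_small_eq => //; apply: uniq_perm => //; first exact: words_uniq.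
  by move=> w; rewrite mem_words inE leqn0 size_eq0.
by rewrite big_mkcond big_seq1 /= /word_weight omega_nil.
Qed.

Lemma length_sum_ge1 n : 1 <= length_sum W origin n.
Proof.
case: n => [|n]; first by rewrite length_sum0.
rewrite leNgt; apply/negP => h.
have [C [r [r0 r1 C0 hr]]] := submultiplicative_decay (length_sum_ge0 ob origin)
  (length_sum_submul ob) (ltn0Sn n) h.
exact: (decay_impossible r0 r1 C0 hr).
Qed.

Lemma length_sum_le_gsum (x : R) n : 0 < x < 1 ->
  length_sum W origin n * x ^+ n <= simple_gsum W x n.
Proof.
move=> /andP[x0 _]; rewrite /length_sum mulr_suml.
apply: (@ler_sum_cover _ _ _ _ _ _ _ _ _ id); first exact: words_uniq.
  by move=> w _ _; apply: (gweight_ge0 ob); exact: ltW.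
by move=> w hw /andP[h1 /eqP h2]; exists w; rewrite /gweight h2.
Qed.
End LowerBound.

(** * Walks on the lattice *)

Definition entry_side (d : int) : side :=
  if (d %% 4)%Z == 0 then (true, false) else if (d %% 4)%Z == 1 then (false, false)
  else if (d %% 4)%Z == 2 then (true, true) else (false, true).

(** The side left in a direction is the one entered in the opposite direction, hence the [+ 2]. *)
Definition passage_of (s : state) (e : turn) : passage :=
  (s.1, (entry_side (sd s), entry_side (sd s + tz e + 2))).

Fixpoint trace (s : state) (w : seq turn) : seq passage :=
  if w is e :: w' then passage_of s e :: trace (step s e) w' else [::].

Definition midpoint_of (s : state) : midpoint := side_midpoint s.1 (entry_side (sd s)).

(** The doubled coordinates that [mid] uses. *)
Definition code (m : midpoint) : int * int :=
  if m.1.1 then (2 * m.1.2 - 1, 2 * m.2) else (2 * m.1.2, 2 * m.2 - 1).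

Lemma code_inj : injective code.
Proof.
move=> [[t x] y] [[t' x'] y']; rewrite /code /=.
by case: t; case: t' => -[h1 h2]; first [exfalso; lia|congr (_, _, _); lia].
Qed.

Lemma entry_sideP (d : int) :
  [\/ (d %% 4)%Z = 0 /\ entry_side d = (true, false),
      (d %% 4)%Z = 1 /\ entry_side d = (false, false),
      (d %% 4)%Z = 2 /\ entry_side d = (true, true) |
      (d %% 4)%Z = 3 /\ entry_side d = (false, true)].
Proof.
rewrite /entry_side; case: (dirP d) => -[-> _ _] /=;
  by [constructor 1|constructor 2|constructor 3|constructor 4].
Qed.

Lemma code_midpoint s : code (midpoint_of s) = mid s.
Proof.
rewrite /midpoint_of /mid /code /side_midpoint /sx /sy.
case: (entry_sideP (sd s)) => -[h ->]; rewrite /ex /ey h /=; congr (_, _); lia.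
Qed.

Lemma entry_side_eq d d' : entry_side d = entry_side d' -> (d %% 4)%Z = (d' %% 4)%Z.
Proof. by case: (entry_sideP d) => -[-> ->]; case: (entry_sideP d') => -[-> ->]. Qed.

Lemma entry_side_mod d d' : (d %% 4)%Z = (d' %% 4)%Z -> entry_side d = entry_side d'.
Proof. by rewrite /entry_side => ->. Qed.

Lemma source_passage s e : arc_source (passage_of s e) = midpoint_of s.
Proof. by []. Qed.

Lemma target_passage s e : arc_target (passage_of s e) = midpoint_of (step s e).
Proof.
apply: code_inj; rewrite code_midpoint /arc_target /passage_of.
rewrite -[LHS]/(code (midpoint_of (s.1, sd s + tz e + 2))) code_midpoint.
rewrite /mid /sx /sy /step /sd /= ex_add2 // ey_add2 //.
by congr (_, _); ring.
Qed.

Lemma visited_trace s w : map code (visited (midpoint_of s) (trace s w)) = mids s w.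
Proof.
elim: w s => [|e w IH] s; first by rewrite /= code_midpoint.
by rewrite /= code_midpoint target_passage -IH.
Qed.

Lemma uniq_visited_trace s w : uniq (visited (midpoint_of s) (trace s w)) = simple s w.
Proof. by rewrite /simple -visited_trace (map_inj_uniq code_inj). Qed.

Lemma sorted_trace s w : sorted crosses (trace s w).
Proof.
case: w => [//|e w] /=; elim: w s e => [//|f w IH] s e /=.
rewrite {1}/crosses target_passage source_passage eqxx /= IH andbT.
apply/negP => /eqP E; have := congr1 fst E; have := congr1 snd E; rewrite /step /=.
by case: (dirP (sd s + tz e)) => -[_ -> ->]; rewrite /sx /sy; lia.
Qed.

Definition passage_kind (a : passage) : option bool := omap theta_corner (arc_corner a).

Lemma passage_kind_of s e : passage_kind (passage_of s e) = kind (sd s) e.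
Proof.
rewrite /passage_kind /arc_corner /passage_of /=.
have [h|[h|[h|h]]] : (sd s %% 4)%Z = 0 \/ (sd s %% 4)%Z = 1 \/ (sd s %% 4)%Z = 2 \/
  (sd s %% 4)%Z = 3 by lia.
all: have h2 : (sd s %% 2)%Z = ((sd s %% 4)%Z %% 2)%Z by lia.
all: rewrite h in h2; rewrite /kind h2.
all: case: e => [[]|] /=; rewrite /entry_side h.
all: set z := ((_ + _ + 2) %% 4)%Z.
all: first [have -> : z = 0 by rewrite /z; lia|have -> : z = 1 by rewrite /z; lia|
  have -> : z = 2 by rewrite /z; lia|have -> : z = 3 by rewrite /z; lia].
all: by [].
Qed.

Lemma labels_trace s w : labels s w = [seq (a.1, passage_kind a) | a <- trace s w].
Proof. by elim: w s => [//|e w IH] s /=; rewrite IH passage_kind_of. Qed.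

Lemma kinds_at_trace s w r :
  kinds_at (labels s w) r = map passage_kind (arcs_in (trace s w) r).
Proof. by rewrite labels_trace /kinds_at filter_map -map_comp. Qed.

Definition dir_of_side (a : side) : int :=
  if a.1 then (if a.2 then 2 else 0) else (if a.2 then 3 else 1).

Lemma entry_dir a : entry_side (dir_of_side a) = a.
Proof. by case: a => [[] []]. Qed.

Lemma turn_exists d b : b != entry_side d ->
  exists e : turn, entry_side (d + tz e + 2) = b.
Proof.
move=> hb.
have [h|h|h] : [\/ ((dir_of_side b - (d + 2)) %% 4)%Z = 0,
    ((dir_of_side b - (d + 2)) %% 4)%Z = 1 | ((dir_of_side b - (d + 2)) %% 4)%Z = 3].
  have : ((dir_of_side b - (d + 2)) %% 4)%Z <> 2.
    move=> h; move/eqP: hb; apply; rewrite -(entry_dir b).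
    by apply: entry_side_mod; lia.
  move: (dir_of_side b) => z h.
  have [h'|[h'|h']] : ((z - (d + 2)) %% 4)%Z = 0 \/ ((z - (d + 2)) %% 4)%Z = 1 \/
    ((z - (d + 2)) %% 4)%Z = 3 by lia.
  - by constructor 1.
  - by constructor 2.
  - by constructor 3.
- by exists None; rewrite -(entry_dir b); apply: entry_side_mod; rewrite /=; lia.
- by exists (Some true); rewrite -(entry_dir b); apply: entry_side_mod; rewrite /=; lia.
- by exists (Some false); rewrite -(entry_dir b); apply: entry_side_mod; rewrite /=; lia.
Qed.

Lemma turn_inj d e e' : entry_side (d + tz e + 2) = entry_side (d + tz e' + 2) -> e = e'.
Proof.
by move=> /entry_side_eq; case: e => [[]|]; case: e' => [[]|] //=; lia.
Qed.

Lemma trace_inj s w w' : trace s w = trace s w' -> w = w'.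
Proof.
elim: w w' s => [|e w IH] [|e' w'] s //= [/turn_inj E].
by rewrite E => /IH ->.
Qed.

Lemma size_trace s w : size (trace s w) = size w.
Proof. by elim: w s => [//|e w IH] s /=; rewrite IH. Qed.

Definition starts (o : midpoint) : seq state :=
  if o.1.1 then [:: ((o.1.2, o.2), 0); ((o.1.2 - 1, o.2), 2)]
  else [:: ((o.1.2, o.2), 1); ((o.1.2, o.2 - 1), 3)].

Lemma starts_midpoint o s : s \in starts o -> midpoint_of s = o.
Proof.
case: o => [[t x] y]; rewrite /starts /=; case: t; rewrite !inE => /orP[]/eqP->;
  rewrite /midpoint_of /entry_side /side_midpoint /=; congr (_, _, _); lia.
Qed.

Lemma source_starts o a : arc_source a = o ->
  exists s, [/\ s \in starts o, s.1 = a.1 & entry_side (sd s) = a.2.1].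
Proof.
move=> <-; exists (a.1, dir_of_side a.2.1); rewrite entry_dir; split=> //.
case: a => [[x y] [[t b] c]]; rewrite /starts /arc_source /side_midpoint /dir_of_side /=.
by case: t; case: b; rewrite /= !inE /= ?addr0 ?addrK ?eqxx ?orbT.
Qed.

Lemma trace_exists (g : seq passage) s :
  (if g is a :: _ then s.1 = a.1 /\ entry_side (sd s) = a.2.1 else True) ->
  sorted crosses g -> all (fun a : passage => a.2.1 != a.2.2) g ->
  exists w, trace s w = g.
Proof.
elim: g s => [|a g IH] s hs; first by exists [::].
case: hs => h1 h2 hsort /= /andP[ha hg].
have [e he] : exists e, entry_side (sd s + tz e + 2) = a.2.2.
  by apply: turn_exists; rewrite h2 eq_sym.
have Ea : passage_of s e = a by rewrite /passage_of h1 h2 he; case: (a) => [? []].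
have [w hw] : exists w, trace (step s e) w = g.
  apply: IH => //; last exact: path_sorted hsort.
  case: g hsort {hg} => [//|b g] /= /andP[/andP[/eqP hc hne] _].
  rewrite -Ea target_passage in hc.
  have [s' [hs' e1 e2]] := source_starts (esym hc).
  have e3 : s'.1 != s.1 by rewrite e1 h1 eq_sym.
  have hm : mid s' = mid (step s e).
    by rewrite -!code_midpoint (starts_midpoint hs').
  have back : (turn_back (step s e)).1 = s.1.
    by rewrite /turn_back /step /sx /sy /sd /= !addrK -surjective_pairing.
  case: (mid_eq hm) => -[k1 k2]; last by rewrite k1 back eqxx in e3.
  split; first by rewrite -e1 k1.
  rewrite -e2; apply: entry_side_mod; move: k2; rewrite /step /sd /=.
  by move: (_ + tz e) (s'.2) => z z'; clear; lia.
by exists (e :: w); rewrite /= Ea hw.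
Qed.

Lemma admissible_turns (l : seq passage) a : admissible l -> a \in l -> a.2.1 != a.2.2.
Proof.
have key (b : passage) c : arc_corner b = Some c -> b.2.1 != b.2.2.
  by case: b => [? [[[] ?] [[] ?]]].
case: l => [|b [|b' [|? ?]]] //=; first by rewrite inE => h /eqP ->.
case E: (arc_corner b) => [c|] //; case E': (arc_corner b') => [c'|] // _.
by rewrite !inE => /orP[]/eqP->; [exact: key E|exact: key E'].
Qed.

Lemma walk_trace o (g : seq passage) : self_avoiding o g -> g != [::] ->
  exists s w, s \in starts o /\ trace s w = g.
Proof.
case: g => [//|a g] [h1 h2 h3 h4] _.
have [s [hs e1 e2]] := source_starts h1.
have [w hw] : exists w, trace s w = a :: g.
  apply: trace_exists => //; apply/allP => b hb.
  apply: (@admissible_turns _ _ (h4 b.1)).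
  by rewrite mem_filter eqxx.
by exists s, w.
Qed.

(** The first passage determines the state. The empty walk, in contrast, comes from both starts,
    which is why the sums below have positive length. *)
Lemma trace_starts o s s' e w e' w' : s \in starts o -> s' \in starts o ->
  trace s (e :: w) = trace s' (e' :: w') -> s = s'.
Proof.
case: o => [[t x] y]; rewrite /starts /=.
by case: t; rewrite !inE => /orP[]/eqP-> /orP[]/eqP-> //= -[] *; exfalso; lia.
Qed.

Lemma opposite_theta c : theta_corner (opposite c) = theta_corner c.
Proof. by case: c => [[] []]. Qed.

Section Link.
Variables (R : realType) (W : weights R) (g : int -> R).
Hypothesis ob : observable W g.

Lemma config_weightE (l : seq passage) : admissible l ->
  config_weight W l = config W (map passage_kind l).
Proof.
case: l => [|a [|b [|c l]]] //=.
  by rewrite /passage_kind; case: (arc_corner a) => [c|] //= _; case: ifP.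
rewrite /passage_kind; case: (arc_corner a) => [c|] //; case: (arc_corner b) => [d|] //=.
by move=> /eqP ->; rewrite opposite_theta eqxx; case: ifP.
Qed.

Lemma walk_weightE s w : (forall r, admissible (arcs_in (trace s w) r)) ->
  walk_weight W (trace s w) = word_weight W s w.
Proof.
move=> h; rewrite /walk_weight /word_weight /omega.
rewrite (fsbigE (undup (map fst (labels s w)))) ?undup_uniq //.
  rewrite big_mkcond; apply: eq_bigr => r _.
  by rewrite in_setT kinds_at_trace config_weightE.
move=> r _; rewrite mem_undup => hr.
by rewrite config_weightE // -kinds_at_trace kinds_at_notin.
Qed.

Lemma distinct_sides s w i j : simple s w -> (i < j)%N -> (j < size w)%N ->
  (at_time s w i).1 = (at_time s w j).1 ->
  let a := passage_of (at_time s w i) (nth None w i) in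
  let b := passage_of (at_time s w j) (nth None w j) in
  [/\ a.2.1 != b.2.1, a.2.1 != b.2.2, a.2.2 != b.2.1 & a.2.2 != b.2.2].
Proof.
move=> hs ij hj hr; have [hx hy] := rhombus_eq hr.
have hi : (i < size w)%N by exact: ltn_trans hj.
have di := word_d s hi; have dj := word_d s hj.
rewrite /passage_of /= -di -dj.
split; apply/eqP => /entry_side_eq.
- exact: (entry_distinct (word_distinct hs) ij (ltnW hj) hx hy).
- exact: (entry_exit_distinct (@word_x s w) (@word_y _ _) (word_distinct hs) ij hj hx hy).
- exact: (exit_entry_distinct (@word_x s w) (@word_y _ _) (word_distinct hs) ij (ltnW hj) hx hy).
- have := exit_exit_distinct (@word_x s w) (@word_y _ _) (word_distinct hs) ij hj hx hy.
  by move: (sd _) (sd _) => z z'; clear; lia.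
Qed.

Lemma nth_trace z s w i : (i < size w)%N ->
  nth z (trace s w) i = passage_of (at_time s w i) (nth None w i).
Proof.
rewrite /at_time; elim: w s i => [|e w IH] s [|i] //= hi.
by rewrite IH.
Qed.

Lemma passage_sides s e : (passage_of s e).2.1 != (passage_of s e).2.2.
Proof.
apply/eqP => /entry_side_eq; case: (tzP e) => ->; move: (sd s) => z; clear; lia.
Qed.

Lemma filter_pair (T : eqType) (p : pred T) (t : seq T) a b x0 : [seq x <- t | p x] = [:: a; b] ->
  exists i j, [/\ (i < j)%N, (j < size t)%N, nth x0 t i = a & nth x0 t j = b].
Proof.
elim: t => [//|c t IH] /=; case: (p c) => [[-> h]|/IH[i [j [h1 h2 h3 h4]]]]; last first.
  by exists i.+1, j.+1.
have : has p t by rewrite has_filter h.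
move=> /(has_nthP x0)[j hj hp].
suff [j' hj' <-] : exists2 j', (j' < size t)%N & nth x0 t j' = b by exists 0%N, j'.+1.
clear -h; elim: t h => [//|c t IH] /=; case: (p c) => [[-> _]|/IH[j h1 h2]].
  by exists 0%N.
by exists j.+1.
Qed.

Lemma two_arcs_admissible (a b : passage) c d : arc_corner a = Some c ->
  arc_corner b = Some d ->
  [/\ a.2.1 != b.2.1, a.2.1 != b.2.2, a.2.2 != b.2.1 & a.2.2 != b.2.2] ->
  d == opposite c.
Proof.
case: a => r [[a1 a2] [a3 a4]]; case: b => r' [[b1 b2] [b3 b4]]; rewrite /arc_corner /=.
by move: a1 a3 b1 b3 => [] [] [] [] //= [<-] [<-] [];
  move: a2 a4 b2 b4 => [] [] [] [].
Qed.

(** Simple words that are not admissible thus add nothing to the sums. Two passages of nonzero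
    weight are arcs, and on four distinct sides they surround opposite corners. *)
Lemma weight_admissible s w : simple s w -> word_weight W s w != 0 ->
  forall r, admissible (arcs_in (trace s w) r).
Proof.
move=> hs hw r; have hc : config W (map passage_kind (arcs_in (trace s w) r)) != 0.
  rewrite -kinds_at_trace; apply: contraNneq hw => h.
  by rewrite /word_weight (omega_split W r) h mul0r.
have hin a : a \in arcs_in (trace s w) r -> a.2.1 != a.2.2.
  rewrite mem_filter => /andP[_] /(nthP a)[i]; rewrite size_trace => hi <-.
  by rewrite nth_trace //; exact: passage_sides.
move: hc hin; case E : (arcs_in (trace s w) r) => [|a [|b [|c l]]] //=.
- by move=> _ h; apply: h; rewrite inE.
- have [hk hk0 _|hk] := eqVneq (passage_kind a) (passage_kind b); last first.
    by rewrite eqxx.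
  have [i [j [ij]]] := filter_pair a E; rewrite size_trace => hj.
  have hi : (i < size w)%N by exact: ltn_trans hj.
  rewrite !nth_trace // => ha hb.
  have hr x : x \in arcs_in (trace s w) r -> x.1 = r.
    by rewrite mem_filter => /andP[/eqP].
  have har : a.1 = r by apply: hr; rewrite E inE eqxx.
  have hbr : b.1 = r by apply: hr; rewrite E !inE eqxx orbT.
  have hij : (at_time s w i).1 = (at_time s w j).1.
    have -> : (at_time s w i).1 = a.1 by rewrite -ha.
    by rewrite har -hbr -hb.
  have := distinct_sides hs ij hj hij; cbv zeta; rewrite ha hb => hd.
  move: hk hk0; rewrite /passage_kind.
  case Ea : (arc_corner a) => [c|]; case Eb : (arc_corner b) => [d|] //= _.
    by move=> _; exact: (two_arcs_admissible Ea Eb hd).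
  by rewrite eqxx.
- by rewrite eqxx.
Qed.

Definition start_words (o : midpoint) (n : nat) : seq (seq passage) :=
  [seq trace s w | s <- starts o,
     w <- [seq w <- words n | `[< self_avoiding o (trace s w) >] && (size w == n)]].

Lemma self_avoiding_trace o s w : s \in starts o ->
  self_avoiding o (trace s w) <->
  simple s w /\ forall r, admissible (arcs_in (trace s w) r).
Proof.
move=> hs; have ho := starts_midpoint hs; split.
  by case=> _ _ h3 h4; rewrite -uniq_visited_trace ho.
case=> h1 h2; split=> //.
- by case: w {h1 h2} => [//|e w] /=; rewrite source_passage.
- exact: sorted_trace.
- by rewrite -ho uniq_visited_trace.
Qed.

Lemma starts_uniq o : uniq (starts o).
Proof. by rewrite /starts; case: ifP => _; rewrite /= inE andbT; apply/eqP => -[]. Qed.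

Lemma start_words_uniq o n : (0 < n)%N -> uniq (start_words o n).
Proof.
move=> n0; apply: allpairs_uniq_dep.
- exact: starts_uniq.
- by move=> s _; rewrite filter_uniq // words_uniq.
- move=> [s w] [s' w'] /allpairsPdep[s1 [w1 [h1 h2 [-> ->]]]].
  move=> /allpairsPdep[s2 [w2 [h3 h4 [-> ->]]]] /= E.
  move: h2 h4; rewrite 2!mem_filter => /andP[/andP[_ /eqP k1] _] /andP[/andP[_ /eqP k2] _].
  have Es : s1 = s2.
    have : w1 != [::] by rewrite -size_eq0 k1 -lt0n.
    have : w2 != [::] by rewrite -size_eq0 k2 -lt0n.
    by case: (w1) (w2) E => [|e1 v1] [|e2 v2] // E _ _; exact: (trace_starts h1 h3 E).
  by rewrite Es in E *; rewrite (trace_inj E).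
Qed.

Lemma walks_sum o n : (0 < n)%N ->
  \sum_(g \in walks o n) walk_weight W g = \sum_(s <- starts o) length_sum W s n.
Proof.
move=> n0.
have hmem g0 : (g0 \in start_words o n) = `[< walks o n g0 >].
  apply/allpairsPdep/asboolP => [[s [w [hs]]]|[h1 h2]].
    by rewrite mem_filter => /andP[/andP[/asboolP h1 /eqP h2] _] ->; split;
      rewrite // /walk_length size_trace.
  have gn0 : g0 != [::] by rewrite -size_eq0 -[size _]/(walk_length g0) h2 -lt0n.
  have [s [w [hs E]]] := walk_trace h1 gn0; exists s, w; split=> //.
  have hw : size w = n by rewrite -(size_trace s) E.
  by rewrite mem_filter mem_words hw leqnn eqxx E !andbT; apply/asboolP.
rewrite (fsbigE (start_words o n)).
- rewrite (eq_bigl (fun g0 => g0 \in start_words o n)); last first.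
    by move=> g0; rewrite hmem; apply/idP/asboolP => [/set_mem|/mem_set].
  rewrite -big_seq big_allpairs_dep big_seq [RHS]big_seq; apply: eq_bigr => s hs.
  rewrite big_filter /length_sum big_mkcond [RHS]big_mkcond; apply: eq_bigr => w _.
  case: (size w == n); last by rewrite !andbF.
  rewrite !andbT; case: asboolP => [/(self_avoiding_trace _ hs)[h1 h2]|h1].
    by rewrite h1 walk_weightE.
  case hsi : (simple s w) => //; apply/esym/eqP.
  apply: contra_notT h1 => hw; apply/(self_avoiding_trace _ hs); split=> //.
  exact: weight_admissible.
- exact: start_words_uniq.
- by move=> g0 /=; rewrite hmem => /asboolP.
- by move=> g0 h; rewrite hmem; case: asboolP.
Qed.

(** The factor 2 stands for the two directions in which a walk can leave its first midpoint. *)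
Lemma walks_sumE o n : (0 < n)%N ->
  \sum_(g \in walks o n) walk_weight W g = 2 * length_sum W origin n.
Proof.
move=> n0; rewrite walks_sum // (eq_bigr (fun=> length_sum W origin n)).
  by rewrite /starts; case: ifP => _; rewrite !big_cons big_nil; ring.
by move=> s _; exact: (length_sum_state ob).
Qed.
End Link.

(** * The limit of the n-th roots *)

Lemma root_limit (R : realType) (f : nat -> R) :
  (forall n, (0 < n)%N -> 1 <= f n) ->
  (forall x, 0 < x < 1 -> exists C, forall n, (0 < n)%N -> f n * x ^+ n <= C) ->
  f n `^ n%:R^-1 @[n --> \oo] --> (1 : R).
Proof.
move=> f1 fC; apply/cvgrPdist_le => /= ep ep0.
(* As [h] lies strictly between 1 and [z], the bound [C * h ^+ n] drops below [z ^+ n] for large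
   [n]. *)
pose h := 1 + ep / 2; pose z := 1 + ep; pose y := h / z.
have h0 : 1 < h by rewrite /h; lra.
have z0 : 0 < z by rewrite /z; lra.
have y0 : 0 < y by rewrite divr_gt0 //; lra.
have y1 : y < 1 by rewrite ltr_pdivrMr // mul1r /h /z; lra.
have [C hC] : exists C, forall n, (0 < n)%N -> f n * h^-1 ^+ n <= C.
  by apply: fC; rewrite invr_gt0 invf_lt1 //; lra.
have C0 : 0 < C.
  apply: lt_le_trans (hC 1%N isT); rewrite mulr_gt0 ?exprn_gt0 ?invr_gt0 //; last by lra.
  by apply: lt_le_trans (f1 1%N isT).
have small : \forall n \near \oo, y ^+ n <= C^-1.
  have hy : `|y| < 1 by rewrite ger0_norm // ltW.
  have /cvgrPdist_le/(_ C^-1) := cvg_expr hy.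
  rewrite invr_gt0 => /(_ C0); apply: filterS => n /=.
  by rewrite sub0r normrN ger0_norm // exprn_ge0 // ltW.
near=> n.
have n0 : (0 < n)%N by near: n; exact: nbhs_infty_gt.
have nr : 0 < n%:R^-1 :> R by rewrite invr_gt0 ltr0n.
have hf : 1 <= f n by exact: f1.
have root (a : R) : 0 <= a -> (a ^+ n) `^ n%:R^-1 = a.
  move=> a0; rewrite -powR_mulrn // -powRrM mulfV ?powRr1 //.
  by rewrite pnatr_eq0 -lt0n.
have lo : 1 <= f n `^ n%:R^-1.
  apply: (@le_trans _ _ (1 `^ n%:R^-1)); first by rewrite powR1.
  by apply: (ge0_ler_powR (ltW nr)); rewrite ?nnegrE //; exact: le_trans hf.
have hi : f n `^ n%:R^-1 <= z.
  rewrite -(root z (ltW z0)); apply: (ge0_ler_powR (ltW nr)); rewrite ?nnegrE.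
  - exact: le_trans hf.
  - exact: exprn_ge0 (ltW z0).
  have hy : y ^+ n <= C^-1 by near: n.
  have hn0 : 0 < h ^+ n by rewrite exprn_gt0 //; lra.
  have := hC n n0; rewrite exprVn ler_pdivrMr // => h1; apply: (le_trans h1).
  have E : h ^+ n = y ^+ n * z ^+ n by rewrite -exprMn /y divfK // gt_eqF.
  rewrite E mulrA ler_piMl ?exprn_ge0 ?(ltW z0) //.
  by rewrite -(@divff _ C) ?gt_eqF // ler_wpM2l // ltW.
rewrite ler_norml; apply/andP; split; first by move: hi; rewrite /z; lra.
by move: lo ep0; lra.
Unshelve. all: by end_near.
Qed.

Lemma connective_constant_observable (R : realType) (W : weights R) (g : int -> R)
    (o : midpoint) : observable W g -> connective_constant_eq o W.
Proof.
move=> ob; have u0 := ob_u1 ob.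
split; first by rewrite gt_eqF.
- move=> n; rewrite /ctilde mulr_ge0 ?invr_ge0 ?exprn_ge0 ?(ltW u0) //.
  (* Length 0 is separate, because its only walk, the empty one, is not counted twice. *)
  case: n => [|n].
    apply: fsumr_ge0 => g0 [_ /size0nil ->].
    rewrite -[ [::] ]/(trace origin [::]) walk_weightE //; exact: (weight_ge0 ob).
  by rewrite (walks_sumE ob) // mulr_ge0 // (length_sum_ge0 ob).
pose f n : R := 2 * length_sum W origin n.
have lim1 : f n `^ n%:R^-1 @[n --> \oo] --> (1 : R).
  apply: root_limit => [n _|x hx].
    have := length_sum_ge1 ob n; rewrite /f; lra.
  have [C hC] := simple_gsum_bounded ob hx; exists (2 * C) => n _.
  rewrite /f -mulrA ler_wpM2l //; apply: le_trans (hC n).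
  exact: (length_sum_le_gsum ob).
have lim2 : (u1 W)^-1 * (f n `^ n%:R^-1) @[n --> \oo] --> (u1 W)^-1 * 1.
  exact: cvgMl_tmp.
rewrite mulr1 in lim2; apply: cvg_trans lim2; apply: near_eq_cvg.
near=> n; have n0 : (0 < n)%N by near: n; exact: nbhs_infty_gt.
rewrite /ctilde (walks_sumE ob) // -/(f n) [in RHS]powRM.
- rewrite /=; congr (_ * _); rewrite -exprVn -powR_mulrn ?invr_ge0 ?(ltW u0) //.
  by rewrite -powRrM mulfV ?powRr1 ?invr_ge0 ?(ltW u0) // pnatr_eq0 -lt0n.
- by rewrite invr_ge0 exprn_ge0 // ltW.
- by rewrite /f mulr_ge0 // (length_sum_ge0 ob).
Unshelve. all: by end_near.
Qed.

Theorem theorem1p1 (R : realType) (o : midpoint) :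
  (exists W : R -> weights R,
     forall theta : R, pi / 3 <= theta <= 2 * pi / 3 ->
       connective_constant_eq o (W theta))
  /\
  (forall theta : R, pi / 3 <= theta <= 2 * pi / 3 ->
     connective_constant_eq o (explicit_weights theta)).
Proof.
have main (theta : R) : pi / 3 <= theta <= 2 * pi / 3 ->
    connective_constant_eq o (explicit_weights theta).
  by move=> /observable_explicit ob; exact: connective_constant_observable ob.
by split; [exists (@explicit_weights R) | exact: main].
Qed.
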